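(* Let $H$ be any bialgebra over a field $\mathbf{k}$, let $F=\sum F^1\otimes F^2\in H\otimes H$ be a Drinfeld twist with inverse $F^{-1}=\sum\bar F^1\otimes\bar F^2$, and let $A$ be a braided commutative left-right Yetter--Drinfeld $H$-module algebra. Let $\mathcal{H}=A\sharp H$ be the scalar extension $A$-bialgebroid $(A\sharp H,s,t,\Delta^{\mathcal{H}},\epsilon^{\mathcal{H}})$, and let $\mathcal{G}=(1\sharp\bar F^1)\otimes_A(1\sharp\bar F^2)\in\mathcal{H}\otimes_A\mathcal{H}$ be the Drinfeld--Xu bialgebroid 2-cocycle induced by $F$. Then the map $$\zeta_{A,H}\colon A_F\sharp H^F\to(A\sharp H)^{\mathcal{G}},\qquad a\sharp^F h\mapsto\sum(\bar F^1\triangleright a)\sharp\bar F^2h,$$ which is an algebra isomorphism of smash product algebras, is an isomorphism of bialgebroids over $A_F=A^{\mathcal{G}}$ from the scalar extension $A_F$-bialgebroid $(A_F\sharp H^F,s^F,t^F,\Delta^F,\epsilon^F)$ to the $\mathcal{G}$-twist $((A\sharp H)^{\mathcal{G}},s^{\mathcal{G}},t^{\mathcal{G}},\Delta^{\mathcal{H}^{\mathcal{G}}},\epsilon^{\mathcal{H}^{\mathcal{G}}})$ of the scalar extension bialgebroid $(A\sharp H,s,t,\Delta^{\mathcal{H}},\epsilon^{\mathcal{H}})$.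
   Context: Sweedler notation is used, summation signs often omitted: $\Delta(h)=h_{(1)}\otimes h_{(2)}$; $\epsilon$ is the counit of $H$. Drinfeld twist: an invertible $F=\sum F^1\otimes F^2\in H\otimes H$ satisfying $F^1\otimes F'^1F^2_{(1)}\otimes F'^2F^2_{(2)}=F'^1F^1_{(1)}\otimes F'^2F^1_{(2)}\otimes F^2$ (with $F'$ another copy of $F$) and $(\epsilon\otimes\mathrm{id})(F)=(\mathrm{id}\otimes\epsilon)(F)=1$. The twisted bialgebra $H^F$ is $H$ as an algebra, with the same counit and coproduct $\Delta^F(h)=F\Delta(h)F^{-1}=h_{(1)F}\otimes h_{(2)F}$. Yetter--Drinfeld module algebras: a left-right Yetter--Drinfeld (YD) $H$-module is a $\mathbf{k}$-vector space $M$ with a left $H$-action $\triangleright$ and a right $H$-coaction $m\mapsto m_{[0]}\otimes m_{[1]}$ such that $(h_{(1)}\triangleright m_{[0]})\otimes h_{(2)}m_{[1]}=(h_{(2)}\triangleright m)_{[0]}\otimes(h_{(2)}\triangleright m)_{[1]}h_{(1)}$. A YD $H$-module algebra is a YD $H$-module $A$ with an algebra structure making it a left $H$-module algebra and a right $H^{op}$-comodule algebra (so the coaction satisfies $(ab)_{[0]}\otimes(ab)_{[1]}=a_{[0]}b_{[0]}\otimes b_{[1]}a_{[1]}$ and $1\mapsto1\otimes1$). It is braided commutative if $b_{[0]}\cdot(b_{[1]}\triangleright a)=a\cdot b$ for all $a,b\in A$. Twist $A_F$: for $A$ a braided commutative YD $H$-module algebra, $A_F$ is the vector space $A$ with the same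 action $\triangleright$ of $H^F=H$ (as algebras), product $a\cdot_{A_F}b=(\bar F^1\triangleright a)\cdot(\bar F^2\triangleright b)$ and $H^F$-coaction $\rho^F(a)=a_{[0]F}\otimes a_{[1]F}=F^1\triangleright(\bar F^2\triangleright a)_{[0]}\otimes F^2(\bar F^2\triangleright a)_{[1]}\bar F^1$; it is a braided commutative YD $H^F$-module algebra. Left bialgebroids: for an algebra $A$, a left $A$-bialgebroid is $(\mathcal{H},s,t,\Delta^{\mathcal{H}},\epsilon^{\mathcal{H}})$, where $\mathcal{H}$ is an algebra; $s\colon A\to\mathcal{H}$ (source) and $t\colon A^{op}\to\mathcal{H}$ (target) are algebra maps with commuting images, making $\mathcal{H}$ an $A$-bimodule via $a.h.a'=s(a)t(a')h$; and $\Delta^{\mathcal{H}}\colon\mathcal{H}\to\mathcal{H}\otimes_A\mathcal{H}$ and $\epsilon^{\mathcal{H}}\colon\mathcal{H}\to A$ are a coassociative comultiplication and counit in $A$-bimodules such that: the image of $\Delta^{\mathcal{H}}$ lies in the Takeuchi product $\{\sum h\otimes_A h' : \sum h\,t(a)\otimes_A h'=\sum h\otimes_A h'\,s(a)\ \forall a\in A\}$ and $\Delta^{\mathcal{H}}$ is a unital algebra map into it (with factorwise multiplication); $\epsilon^{\mathcal{H}}(1)=1$; and $\epsilon^{\mathcal{H}}(h\,s(\epsilon^{\mathcal{H}}(h')))=\epsilon^{\mathcal{H}}(hh')=\epsilon^{\mathcal{H}}(h\,t(\epsilon^{\mathcal{H}}(h')))$. Put $h\blacktriangleright a=\epsilon^{\mathcal{H}}(h\,s(a))$.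 An isomorphism of left bialgebroids over the same base algebra is an algebra isomorphism of total algebras intertwining the source maps, the target maps, the comultiplications and the counits. Smash product and scalar extension bialgebroid: $A\sharp H$ is $A\otimes H$ with elements $a\otimes h$ written $a\sharp h$ and product $(a\sharp h)(b\sharp k)=a(h_{(1)}\triangleright b)\sharp h_{(2)}k$. For $A$ a braided commutative YD $H$-module algebra, $\mathcal{H}=A\sharp H$ is a left $A$-bialgebroid (the scalar extension bialgebroid) with $s(a)=a\sharp1$, $t(a)=a_{[0]}\sharp a_{[1]}$, $\Delta^{\mathcal{H}}(a\sharp h)=(a\sharp h_{(1)})\otimes_A(1\sharp h_{(2)})$, $\epsilon^{\mathcal{H}}(a\sharp h)=a\,\epsilon(h)$; here $(a\sharp h)\blacktriangleright b=a(h\triangleright b)$. The scalar extension $A_F$-bialgebroid $(A_F\sharp H^F,s^F,t^F,\Delta^F,\epsilon^F)$ is given by the same construction applied to the bialgebra $H^F$ and the braided commutative YD $H^F$-module algebra $A_F$; its elements $a\otimes h$ are written $a\sharp^F h$. Twisting a bialgebroid: for a bialgebroid 2-cocycle $\mathcal{G}=\sum\mathcal{G}^1\otimes\mathcal{G}^2\in\mathcal{H}\otimes_A\mathcal{H}$ (that is, $\mathcal{G}$ satisfies the bialgebroid versions of the 2-cocycle condition $(\Delta\otimes\mathrm{id})(\mathcal{G})(\mathcal{G}\otimes1)=(\mathrm{id}\otimes\Delta)(\mathcal{G})(1\otimes\mathcal{G})$ and of counitality), the twisted base algebra $A^{\mathcal{G}}$ is the vector space $A$ with product $a\ast b=(\mathcal{G}^1\blacktriangleright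 a)\cdot_A(\mathcal{G}^2\blacktriangleright b)$, and the twisted source and target are $s^{\mathcal{G}}(a)=s(\mathcal{G}^1\blacktriangleright a)\mathcal{G}^2$, $t^{\mathcal{G}}(a)=t(\mathcal{G}^2\blacktriangleright a)\mathcal{G}^1$. These give an $A^{\mathcal{G}}$-bimodule structure on the algebra $\mathcal{H}$, denoted $\mathcal{H}^{\mathcal{G}}$. $\mathcal{G}$ is a Drinfeld--Xu (invertible) 2-cocycle if there is $\mathcal{G}^{-1}\in\mathcal{H}^{\mathcal{G}}\otimes_{A^{\mathcal{G}}}\mathcal{H}^{\mathcal{G}}$ with $\mathcal{G}^{-1}\mathcal{G}=1\otimes_{A^{\mathcal{G}}}1$ and $\mathcal{G}\mathcal{G}^{-1}=1\otimes_A1$. Then the twisted left $A^{\mathcal{G}}$-bialgebroid is $(\mathcal{H}^{\mathcal{G}},s^{\mathcal{G}},t^{\mathcal{G}},\Delta^{\mathcal{H}^{\mathcal{G}}},\epsilon^{\mathcal{H}^{\mathcal{G}}})$ with the same total algebra $\mathcal{H}$, $\Delta^{\mathcal{H}^{\mathcal{G}}}(x)=\mathcal{G}^{-1}\Delta^{\mathcal{H}}(x)\mathcal{G}$ (left multiplication by $\mathcal{G}^{-1}$ being a well-defined map $\mathcal{H}\otimes_A\mathcal{H}\to\mathcal{H}^{\mathcal{G}}\otimes_{A^{\mathcal{G}}}\mathcal{H}^{\mathcal{G}}$) and $\epsilon^{\mathcal{H}^{\mathcal{G}}}=\epsilon^{\mathcal{H}}$. For $\mathcal{H}=A\sharp H$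 and $\mathcal{G}=(1\sharp\bar F^1)\otimes_A(1\sharp\bar F^2)$, $\mathcal{G}$ is a Drinfeld--Xu 2-cocycle with inverse $(1\sharp F^1)\otimes_{A^{\mathcal{G}}}(1\sharp F^2)$, and $A^{\mathcal{G}}=A_F$ as algebras. *)

(* Defs.v *)
From HB Require Import structures.
From mathcomp Require Import all_boot all_algebra.
From mathcomp Require Import boolp.

Set Implicit Arguments.
Unset Strict Implicit.
Unset Printing Implicit Defensive.

Import GRing.Theory.
Local Open Scope ring_scope.
Local Open Scope quotient_scope.

(* Balanced tensor product of abelian groups: finite formal sums of pairs      *)
(* modulo biadditivity and (r i m) (x) n = m (x) (l i n) for all i : I. Here   *)
(* r plays the right action on M and l the left action on N of a common        *)
(* "scalar" type I. With I = k and scalar multiplications this is the tensor   *)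
(* product over k; with I = A it is the tensor product over a noncommutative   *)
(* algebra A.                                                                  *)
Section BalancedTensor.
Variables (I : Type) (M N : zmodType) (r : I -> M -> M) (l : I -> N -> N).

Inductive teq : seq (M * N) -> seq (M * N) -> Prop :=
| teq_refl s : teq s s
| teq_sym s1 s2 : teq s1 s2 -> teq s2 s1
| teq_trans s1 s2 s3 : teq s1 s2 -> teq s2 s3 -> teq s1 s3
| teq_perm s1 s2 : perm_eq s1 s2 -> teq s1 s2
| teq_cat s1 s2 s : teq s1 s2 -> teq (s1 ++ s) (s2 ++ s)
| teq_0l n : teq [:: (0, n)] [::]
| teq_Dl m m' n : teq [:: (m + m', n)] [:: (m, n); (m', n)]
| teq_Dr m n n' : teq [:: (m, n + n')] [:: (m, n); (m, n')]
| teq_bal i m n : teq [:: (r i m, n)] [:: (m, l i n)].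

Definition teqb (s1 s2 : seq (M * N)) : bool := `[< teq s1 s2 >].

Lemma teqb_refl : reflexive teqb.
Proof. by move=> s; apply/asboolP; exact: teq_refl. Qed.

Lemma teqb_sym : symmetric teqb.
Proof. by move=> s1 s2; apply/asboolP/asboolP; exact: teq_sym. Qed.

Lemma teqb_trans : transitive teqb.
Proof.
by move=> s2 s1 s3 /asboolP h1 /asboolP h2; apply/asboolP; exact: teq_trans h2.
Qed.

Canonical teq_equiv := EquivRel teqb teqb_refl teqb_sym teqb_trans.

Definition btens := {eq_quot teq_equiv}.

HB.instance Definition _ := Choice.on btens.
HB.instance Definition _ := EqQuotient.on btens.

Definition bclass (s : seq (M * N)) : btens := \pi_btens s.
Definition brepr (u : btens) : seq (M * N) := repr u.

Definition tens (m : M) (n : N) : btens := bclass [:: (m, n)].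

Lemma breprK u : bclass (brepr u) = u.
Proof. exact: reprK. Qed.

Lemma bclassP s1 s2 : bclass s1 = bclass s2 <-> teq s1 s2.
Proof.
split; first by move/eqmodP => /asboolP.
by move=> h; apply/eqmodP/asboolP.
Qed.

Lemma brepr_class s : teq (brepr (bclass s)) s.
Proof. by apply/bclassP; rewrite breprK. Qed.

Lemma teq_cat2 s1 s2 t1 t2 : teq s1 s2 -> teq t1 t2 -> teq (s1 ++ t1) (s2 ++ t2).
Proof.
move=> h1 h2; apply: teq_trans (teq_cat t1 h1) _.
apply: teq_trans (teq_perm (permEl (perm_catC _ _))) _.
apply: teq_trans (teq_cat s2 h2) _.
exact: teq_perm (permEl (perm_catC _ _)).
Qed.

Lemma teq_oppK s : teq ([seq (- p.1, p.2) | p <- s] ++ s) [::].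
Proof.
elim: s => [|[m n] s IHs] /=; first exact: teq_refl.
apply: (@teq_trans _ ([:: (- m, n); (m, n)] ++
   ([seq (- p.1, p.2) | p <- s] ++ s))).
  apply: teq_perm; rewrite /= perm_cons -cat1s perm_catCA perm_cons.
  exact: perm_refl.
apply: (@teq_trans _ ([::] ++ [::])); last exact: teq_refl.
apply: teq_cat2 => //; apply: teq_trans (teq_sym (teq_Dl _ _ _)) _.
by rewrite addNr; exact: teq_0l.
Qed.

Definition badd u v := bclass (brepr u ++ brepr v).
Definition bopp u := bclass [seq (- p.1, p.2) | p <- brepr u].

Lemma bclass_cat s1 s2 : bclass (s1 ++ s2) = badd (bclass s1) (bclass s2).
Proof.
by apply/bclassP/teq_cat2; apply: teq_sym; exact: brepr_class.
Qed.

Lemma baddC : commutative badd.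
Proof.
by move=> u v; apply/bclassP/teq_perm; rewrite perm_catC.
Qed.

Lemma baddA : associative badd.
Proof.
move=> u v w; rewrite -(breprK u) -(breprK v) -(breprK w).
by rewrite -!bclass_cat catA.
Qed.

Lemma badd0 : left_id (bclass [::]) badd.
Proof. by move=> u; rewrite -(breprK u) -bclass_cat. Qed.

Lemma baddN : left_inverse (bclass [::]) bopp badd.
Proof.
move=> u; rewrite /bopp -{2}(breprK u) -bclass_cat; apply/bclassP.
exact: teq_oppK.
Qed.

HB.instance Definition _ :=
  GRing.isZmodule.Build btens baddA baddC badd0 baddN.

(* Sum of f over a chosen presentation of u as a formal sum, i.e. literally    *)
(* the Sweedler convention. The value is independent of that choice as soon    *)
(* as f is biadditive and balanced (tlift_tens, tliftD below), and then this   *)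
(* is the map out of the tensor product induced by f.                          *)
Definition tlift (P : zmodType) (f : M -> N -> P) (u : btens) : P :=
  \sum_(p <- brepr u) f p.1 p.2.

Definition balanced (P : zmodType) (f : M -> N -> P) : Prop :=
  [/\ forall m m' n, f (m + m') n = f m n + f m' n,
      forall m n n', f m (n + n') = f m n + f m n'
    & forall i m n, f (r i m) n = f m (l i n)].

Lemma balanced_teq (P : zmodType) (f : M -> N -> P) s1 s2 :
  balanced f -> teq s1 s2 ->
  \sum_(p <- s1) f p.1 p.2 = \sum_(p <- s2) f p.1 p.2.
Proof.
move=> [fDl fDr fb]; elim=> {s1 s2} //.
- by move=> s1 s2 s3 _ -> _ ->.
- by move=> s1 s2 h; exact: perm_big.
- by move=> s1 s2 s _ h; rewrite !big_cat /= h.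
- move=> n; rewrite big_cons !big_nil /= addr0.
  by apply: (addrI (f 0 n)); rewrite -fDl !addr0.
- by move=> m m' n; rewrite !big_cons !big_nil /= !addr0 fDl.
- by move=> m n n'; rewrite !big_cons !big_nil /= !addr0 fDr.
- by move=> i m n; rewrite !big_cons !big_nil /= !addr0 fb.
Qed.

Lemma tlift_tens (P : zmodType) (f : M -> N -> P) m n :
  balanced f -> tlift f (tens m n) = f m n.
Proof.
by move=> hf; rewrite /tlift (balanced_teq hf (brepr_class _)) big_cons big_nil addr0.
Qed.

Lemma tliftD (P : zmodType) (f : M -> N -> P) u v :
  balanced f -> tlift f (u + v) = tlift f u + tlift f v.
Proof.
by move=> hf; rewrite /tlift (balanced_teq hf (brepr_class _)) big_cat.
Qed.

Lemma tens_balanced : balanced tens.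
Proof.
split=> [m m' n|m n n'|i m n].
- by rewrite -[RHS]bclass_cat; apply/bclassP/teq_Dl.
- by rewrite -[RHS]bclass_cat; apply/bclassP/teq_Dr.
- by apply/bclassP/teq_bal.
Qed.

Lemma tens_sum u : u = \sum_(p <- brepr u) tens p.1 p.2.
Proof.
rewrite -{1}(breprK u); elim: (brepr u) => [|[m n] s IHs].
  by rewrite big_nil.
by rewrite big_cons -IHs -[RHS]bclass_cat.
Qed.

Lemma tens_ind (Q : btens -> Prop) :
  Q 0 -> (forall m n, Q (tens m n)) -> (forall u v, Q u -> Q v -> Q (u + v)) ->
  forall u, Q u.
Proof.
by move=> Q0 Qt QD u; rewrite (tens_sum u); elim/big_ind: _ => // p _; exact: Qt.
Qed.

End BalancedTensor.

Arguments tens {I M N r l} m n.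

Notation "\sw_ ( x , y <- u ) e" := (tlift (fun x y => e) u)
  (at level 41, x name, y name, u at level 40, e at level 41,
   right associativity, format "\sw_ ( x ,  y  <-  u )  e").

(* Tensor product of vector spaces over k. *)
Definition ktens (k : fieldType) (M N : lmodType k) :=
  btens (fun (c : k) (m : M) => c *: m) (fun (c : k) (n : N) => c *: n).

Notation "M ⊗ N" := (ktens M N) (at level 40, left associativity) : type_scope.

Section TensorOverField.
Variables (k : fieldType) (M N : lmodType k).

HB.instance Definition _ := GRing.Zmodule.on (M ⊗ N).

Definition kscale (c : k) (u : M ⊗ N) : M ⊗ N :=
  \sw_(m, n <- u) (tens (c *: m) n : M ⊗ N).

Let kscale_bal c :
  balanced (fun (d : k) (m : M) => d *: m) (fun (d : k) (n : N) => d *: n)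
           (fun m n => tens (c *: m) n : M ⊗ N).
Proof.
case: (tens_balanced (fun (d : k) (m : M) => d *: m)
                     (fun (d : k) (n : N) => d *: n)) => tDl tDr tb.
split=> [m m' n|m n n'|d m n]; first by rewrite scalerDr tDl.
  by rewrite tDr.
by rewrite -tb !scalerA mulrC.
Qed.

Lemma kscale_tens c m n : kscale c (tens m n) = tens (c *: m) n.
Proof. exact: tlift_tens. Qed.

Lemma kscaleDr c : {morph kscale c : u v / u + v}.
Proof. by move=> u v; exact: tliftD. Qed.

Lemma kscale0 c : kscale c 0 = 0.
Proof. by apply: (addrI (kscale c 0)); rewrite -kscaleDr !addr0. Qed.

Lemma kscaleA a b u : kscale a (kscale b u) = kscale (a * b) u.
Proof.
elim/tens_ind: u => [|m n|u v hu hv]; first by rewrite !kscale0.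
  by rewrite !kscale_tens scalerA.
by rewrite !kscaleDr hu hv.
Qed.

Lemma kscale1 : left_id 1 kscale.
Proof.
elim/tens_ind => [|m n|u v hu hv]; first by rewrite kscale0.
  by rewrite kscale_tens scale1r.
by rewrite kscaleDr hu hv.
Qed.

Lemma kscaleDl u : {morph kscale^~ u : a b / a + b}.
Proof.
move=> a b; elim/tens_ind: u => [|m n|u v hu hv].
- by rewrite !kscale0 addr0.
- by rewrite !kscale_tens scalerDl; case: (tens_balanced
    (fun (d : k) (m : M) => d *: m) (fun (d : k) (n : N) => d *: n)) => ->.
- by rewrite !kscaleDr hu hv addrACA.
Qed.

HB.instance Definition _ := GRing.Zmodule_isLmodule.Build k (M ⊗ N)
  kscaleA kscale1 kscaleDr kscaleDl.

End TensorOverField.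

(* A unital algebra structure on a given vector space. The same space carries  *)
(* several products below (A, A_F and A^G), and the zero algebra is allowed,   *)
(* so this is not an algType, which would also require 1 != 0.                 *)
Record algebra_on (k : fieldType) (V : lmodType k) :=
  AlgebraOn { amul : V -> V -> V; aone : V }.

Record is_algebra (k : fieldType) (V : lmodType k) (a : algebra_on V) : Prop := {
  amul_linl : forall y, linear ((amul a)^~ y);
  amul_linr : forall x, linear (amul a x);
  amulA : associative (amul a);
  amul1l : left_id (aone a) (amul a);
  amul1r : right_id (aone a) (amul a) }.

Section Bialgebra.
Variables (k : fieldType) (H : algType k).

Definition tmul (u v : H ⊗ H) : H ⊗ H :=
  \sw_(x1, x2 <- u) \sw_(y1, y2 <- v) (tens (x1 * y1) (x2 * y2) : H ⊗ H).

Record coalgebra_on := CoalgebraOn { cop : H -> H ⊗ H; cou : H -> k }.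

(* Threefold tensors are bracketed to the right throughout. *)
Record is_bialgebra (B : coalgebra_on) : Prop := {
  cop_lin : linear (cop B);
  cou_lin : linear (cou B : H -> k^o);
  copA : forall h,
    \sw_(h1, h2 <- cop B h) \sw_(h11, h12 <- cop B h1)
      (tens h11 (tens h12 h2) : H ⊗ (H ⊗ H))
    = \sw_(h1, h2 <- cop B h) (tens h1 (cop B h2) : H ⊗ (H ⊗ H));
  cop_coul : forall h, \sw_(h1, h2 <- cop B h) (cou B h1 *: h2) = h;
  cop_cour : forall h, \sw_(h1, h2 <- cop B h) (cou B h2 *: h1) = h;
  cop1 : cop B 1 = tens 1 1;
  copM : forall g h, cop B (g * h) = tmul (cop B g) (cop B h);
  cou1 : cou B 1 = 1;
  couM : forall g h, cou B (g * h) = cou B g * cou B h }.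

Record drinfeld_twist (B : coalgebra_on) (F Finv : H ⊗ H) : Prop := {
  twist_mulV : tmul F Finv = tens 1 1;
  twist_mulVl : tmul Finv F = tens 1 1;
  twist_cocycle :
    \sw_(f1, f2 <- F) (tens f1 (tmul F (cop B f2)) : H ⊗ (H ⊗ H))
    = \sw_(f1, f2 <- F) \sw_(x, y <- tmul F (cop B f1))
        (tens x (tens y f2) : H ⊗ (H ⊗ H));
  twist_coul : \sw_(f1, f2 <- F) (cou B f1 *: f2) = 1;
  twist_cour : \sw_(f1, f2 <- F) (cou B f2 *: f1) = 1 }.

(* H^F; its underlying algebra is that of H. *)
Definition twisted_bialgebra (B : coalgebra_on) (F Finv : H ⊗ H) : coalgebra_on :=
  CoalgebraOn (fun h => tmul (tmul F (cop B h)) Finv) (cou B).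

End Bialgebra.

Section YetterDrinfeld.
Variables (k : fieldType) (H : algType k) (A : lmodType k).

Record yd_data := YdData {
  yd_alg : algebra_on A;
  act : H -> A -> A;
  coact : A -> A ⊗ H }.

Record is_yd_module (B : coalgebra_on H) (X : yd_data) : Prop := {
  act_linl : forall a, linear ((act X)^~ a);
  act_linr : forall h, linear (act X h);
  act1 : forall a, act X 1 a = a;
  actM : forall g h a, act X (g * h) a = act X g (act X h a);
  coact_lin : linear (coact X);
  coactA : forall a,
    \sw_(a0, a1 <- coact X a) \sw_(a00, a01 <- coact X a0)
      (tens a00 (tens a01 a1) : A ⊗ (H ⊗ H))
    = \sw_(a0, a1 <- coact X a) (tens a0 (cop B a1) : A ⊗ (H ⊗ H));
  coact_cou : forall a, \sw_(a0, a1 <- coact X a) (cou B a1 *: a0) = a;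
  yd_compat : forall h a,
    \sw_(h1, h2 <- cop B h) \sw_(a0, a1 <- coact X a)
      (tens (act X h1 a0) (h2 * a1) : A ⊗ H)
    = \sw_(h1, h2 <- cop B h) \sw_(b0, b1 <- coact X (act X h2 a))
        (tens b0 (b1 * h1) : A ⊗ H) }.

(* The H-components of the coaction of a product come in reversed order: A is  *)
(* a right comodule algebra over the opposite bialgebra of H.                  *)
Record is_yd_module_algebra (B : coalgebra_on H) (X : yd_data) : Prop := {
  yd_module : is_yd_module B X;
  yd_algebra : is_algebra (yd_alg X);
  act_mul : forall h a b,
    act X h (amul (yd_alg X) a b)
    = \sw_(h1, h2 <- cop B h) amul (yd_alg X) (act X h1 a) (act X h2 b);
  act_one : forall h, act X h (aone (yd_alg X)) = cou B h *: aone (yd_alg X);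
  coact_mul : forall a b,
    coact X (amul (yd_alg X) a b)
    = \sw_(a0, a1 <- coact X a) \sw_(b0, b1 <- coact X b)
        (tens (amul (yd_alg X) a0 b0) (b1 * a1) : A ⊗ H);
  coact_one : coact X (aone (yd_alg X)) = tens (aone (yd_alg X)) 1 }.

Definition braided_commutative (X : yd_data) : Prop :=
  forall a b,
    \sw_(b0, b1 <- coact X b) amul (yd_alg X) b0 (act X b1 a)
    = amul (yd_alg X) a b.

(* A_F. *)
Definition twisted_yd (X : yd_data) (F Finv : H ⊗ H) : yd_data :=
  YdData
    (AlgebraOn
       (fun a b => \sw_(e1, e2 <- Finv) amul (yd_alg X) (act X e1 a) (act X e2 b))
       (aone (yd_alg X)))
    (act X)
    (fun a => \sw_(f1, f2 <- F) \sw_(e1, e2 <- Finv)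
       \sw_(x0, x1 <- coact X (act X e2 a))
         (tens (act X f1 x0) (f2 * x1 * e1) : A ⊗ H)).

End YetterDrinfeld.

Arguments YdData {k H A}.

Section Bialgebroid.
Variables (k : fieldType) (A : lmodType k).

(* M (x)_A M for the A-bimodule structure a.h.a' = s(a) t(a') h. *)
Definition bialgebroid_tens (M : lmodType k) (mul : M -> M -> M) (s t : A -> M) :=
  btens (fun (a : A) (h : M) => mul (t a) h) (fun (a : A) (h : M) => mul (s a) h).

HB.instance Definition _ (M : lmodType k) (mul : M -> M -> M) (s t : A -> M) :=
  GRing.Zmodule.on (bialgebroid_tens mul s t).

(* Raw data of a left bialgebroid; the laws are in is_left_bialgebroid. *)
Record bialgebroid (M : lmodType k) := Bialgebroid {
  base_alg : algebra_on A;
  total_alg : algebra_on M;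
  src : A -> M;
  tgt : A -> M;
  comul : M -> bialgebroid_tens (amul total_alg) src tgt;
  counit : M -> A }.

Section OneBialgebroid.
Variables (M : lmodType k) (B : bialgebroid M).

Local Notation "x *' y" := (amul (total_alg B) x y) (at level 40, left associativity).
Local Notation "a *_A b" := (amul (base_alg B) a b) (at level 40, left associativity).
Local Notation one := (aone (total_alg B)).
Local Notation s := (src B).
Local Notation t := (tgt B).
Local Notation Delta := (comul B).
Local Notation eps := (counit B).

Definition tens2 := bialgebroid_tens (amul (total_alg B)) s t.

Definition bimod2 (a a' : A) (u : tens2) : tens2 :=
  \sw_(x, y <- u) (tens (s a *' x) (t a' *' y) : tens2).

(* M (x)_A (M (x)_A M). *)
Definition tens3 :=
  btens (fun (a : A) (h : M) => t a *' h)
        (fun (a : A) (u : tens2) => bimod2 a (aone (base_alg B)) u).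

HB.instance Definition _ := GRing.Zmodule.on tens2.
HB.instance Definition _ := GRing.Zmodule.on tens3.

Definition takeuchi (u : tens2) : Prop :=
  forall a, \sw_(x, y <- u) (tens (x *' t a) y : tens2)
            = \sw_(x, y <- u) (tens x (y *' s a) : tens2).

(* Factorwise product, independent of representatives when u lies in the       *)
(* Takeuchi product.                                                           *)
Definition mul2 (u v : tens2) : tens2 :=
  \sw_(x1, x2 <- u) \sw_(y1, y2 <- v) (tens (x1 *' y1) (x2 *' y2) : tens2).

Record is_left_bialgebroid : Prop := {
  base_algebra : is_algebra (base_alg B);
  total_algebra : is_algebra (total_alg B);
  src_lin : linear s;
  src1 : s (aone (base_alg B)) = one;
  srcM : forall a b, s (a *_A b) = s a *' s b;
  tgt_lin : linear t;
  tgt1 : t (aone (base_alg B)) = one;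
  tgtM : forall a b, t (a *_A b) = t b *' t a;
  src_tgtC : forall a b, s a *' t b = t b *' s a;
  comulD : {morph Delta : x y / x + y};
  comul_bimod : forall a a' h, Delta (s a *' (t a' *' h)) = bimod2 a a' (Delta h);
  counit_lin : linear eps;
  counit_bimod : forall a a' h, eps (s a *' (t a' *' h)) = a *_A eps h *_A a';
  comulA : forall h,
    \sw_(x, y <- Delta h) \sw_(x1, x2 <- Delta x)
      (tens x1 (tens x2 y : tens2) : tens3)
    = \sw_(x, y <- Delta h) (tens x (Delta y) : tens3);
  comul_counitl : forall h, \sw_(x, y <- Delta h) s (eps x) *' y = h;
  comul_counitr : forall h, \sw_(x, y <- Delta h) t (eps y) *' x = h;
  comul_takeuchi : forall h, takeuchi (Delta h);
  comul1 : Delta one = tens one one;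
  comulM : forall g h, Delta (g *' h) = mul2 (Delta g) (Delta h);
  counit1 : eps one = aone (base_alg B);
  counit_src : forall g h, eps (g *' s (eps h)) = eps (g *' h);
  counit_tgt : forall g h, eps (g *' t (eps h)) = eps (g *' h) }.

Definition base_act (h : M) (a : A) : A := eps (h *' s a).

Section Twist.
Variable G : tens2.

Definition twist_base : algebra_on A :=
  AlgebraOn (fun a b => \sw_(g1, g2 <- G) base_act g1 a *_A base_act g2 b)
            (aone (base_alg B)).

Definition twist_src (a : A) : M := \sw_(g1, g2 <- G) s (base_act g1 a) *' g2.
Definition twist_tgt (a : A) : M := \sw_(g1, g2 <- G) t (base_act g2 a) *' g1.

Definition twist_tens2 := bialgebroid_tens (amul (total_alg B)) twist_src twist_tgt.

HB.instance Definition _ := GRing.Zmodule.on twist_tens2.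

Variable Ginv : twist_tens2.

Definition twist_inv_mul (u : tens2) : twist_tens2 :=
  \sw_(e1, e2 <- Ginv) \sw_(x, y <- u) (tens (e1 *' x) (e2 *' y) : twist_tens2).

Definition twist_mul (v : twist_tens2) : tens2 :=
  \sw_(g1, g2 <- G) \sw_(x, y <- v) (tens (g1 *' x) (g2 *' y) : tens2).

Record drinfeld_xu_cocycle : Prop := {
  dx_cocycle :
    \sw_(g1, g2 <- G) \sw_(x, y <- mul2 (Delta g1) G)
      (tens x (tens y g2 : tens2) : tens3)
    = \sw_(g1, g2 <- G) (tens g1 (mul2 (Delta g2) G) : tens3);
  dx_counitl : \sw_(g1, g2 <- G) s (eps g1) *' g2 = one;
  dx_counitr : \sw_(g1, g2 <- G) t (eps g2) *' g1 = one;
  dx_invl : twist_inv_mul G = tens one one;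
  dx_invr : twist_mul Ginv = tens one one }.

Definition twist_bialgebroid : bialgebroid M :=
  @Bialgebroid M twist_base (total_alg B) twist_src twist_tgt
    (fun x => twist_inv_mul (mul2 (Delta x) G)) eps.

End Twist.

End OneBialgebroid.

(* Isomorphism of left bialgebroids over the same base algebra. *)
Record left_bialgebroid_iso (M M' : lmodType k) (B : bialgebroid M)
    (B' : bialgebroid M') (f : M -> M') : Prop := {
  iso_dom : is_left_bialgebroid B;
  iso_cod : is_left_bialgebroid B';
  iso_base_mul : forall a b, amul (base_alg B) a b = amul (base_alg B') a b;
  iso_base_one : aone (base_alg B) = aone (base_alg B');
  iso_bij : bijective f;
  iso_lin : linear f;
  iso_mul : forall x y,
    f (amul (total_alg B) x y) = amul (total_alg B') (f x) (f y);
  iso_one : f (aone (total_alg B)) = aone (total_alg B');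
  iso_src : forall a, f (src B a) = src B' a;
  iso_tgt : forall a, f (tgt B a) = tgt B' a;
  iso_comul : forall h,
    \sw_(x, y <- comul B h) (tens (f x) (f y) : tens2 B') = comul B' (f h);
  iso_counit : forall h, counit B' (f h) = counit B h }.

End Bialgebroid.

Section ScalarExtension.
Variables (k : fieldType) (H : algType k) (A : lmodType k).
Variables (B : coalgebra_on H) (X : @yd_data k H A).

Local Notation "1_A" := (aone (yd_alg X)).
Local Notation "a *_A b" := (amul (yd_alg X) a b) (at level 40, left associativity).

Definition smash_alg : algebra_on (A ⊗ H) :=
  AlgebraOn
    (fun u v : A ⊗ H => \sw_(a, h <- u) \sw_(b, g <- v) \sw_(h1, h2 <- cop B h)
       (tens (a *_A act X h1 b) (h2 * g) : A ⊗ H))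
    (tens 1_A 1).

Definition smash_src (a : A) : A ⊗ H := tens a 1.
Definition smash_tgt (a : A) : A ⊗ H := coact X a.

Definition smash_tens2 := bialgebroid_tens (amul smash_alg) smash_src smash_tgt.
HB.instance Definition _ := GRing.Zmodule.on smash_tens2.

Definition scalar_extension : bialgebroid A (A ⊗ H) :=
  @Bialgebroid k A (A ⊗ H) (yd_alg X) smash_alg smash_src smash_tgt
    (fun u : A ⊗ H => \sw_(a, h <- u) \sw_(h1, h2 <- cop B h)
       (tens (tens a h1 : A ⊗ H) (tens 1_A h2 : A ⊗ H) : smash_tens2))
    (fun u : A ⊗ H => \sw_(a, h <- u) (cou B h *: a)).

Definition ext_cocycle (Finv : H ⊗ H) : tens2 scalar_extension :=
  \sw_(e1, e2 <- Finv)
    (tens (tens 1_A e1 : A ⊗ H) (tens 1_A e2 : A ⊗ H) : tens2 scalar_extension).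

Definition ext_cocycle_inv (F Finv : H ⊗ H) : twist_tens2 (ext_cocycle Finv) :=
  \sw_(f1, f2 <- F)
    (tens (tens 1_A f1 : A ⊗ H) (tens 1_A f2 : A ⊗ H)
       : twist_tens2 (ext_cocycle Finv)).

Definition zeta (Finv : H ⊗ H) (u : A ⊗ H) : A ⊗ H :=
  \sw_(a, h <- u) \sw_(e1, e2 <- Finv) (tens (act X e1 a) (e2 * h) : A ⊗ H).

End ScalarExtension.

(* Main.v *)
From mathcomp Require Import all_boot all_algebra.
From mathcomp Require Import boolp.
Require Import Defs.

(** Write [s], [t] for source and target of [A # H], [j h = 1 # h], and
    [e = F^-1]. The twisted source and target are [sG a = s (e1 ▷ a) j e2] and
    [tG a = t (e2 ▷ a) j e1], so [zeta (a # h) = sG a * j h], and the cocycle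
    identity of [e] makes [zeta] multiplicative. Moreover [zeta] maps the
    coaction of [A_F] to [tG], so that apart from coassociativity and the
    counit law the laws of the coaction of [A_F] are pulled back along [zeta]
    from the identities
    [j h * tG a = tG (h_(2) ▷ a) * j h_(1)] (coproduct of [H^F]),
    [sG a * tG b = tG b * sG a] and [tG b * tG a = tG (a *_F b)] in [A # H].
    Comultiplications match because
    [Delta (zeta (a # h)) G = G (zeta (a # h_(1)) ⊗ zeta (1 # h_(2)))] and left
    multiplication by [F] inverts left multiplication by [G]. The laws of the
    twisted bialgebroid are those of the scalar extension of [(H^F, A_F)],
    transported along [zeta]. *)

Set Implicit Arguments.
Unset Strict Implicit.
Unset Printing Implicit Defensive.

Import GRing.Theory.
Local Open Scope ring_scope.

(** * Sweedler sums and linearity *)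

(** The statement includes that both sides are bialgebroids, so the Yetter-Drinfeld laws of A_F and
    all axioms of the twist have to be proved. A direct check of the twisted axioms would handle
    [F * Delta(x) * F^-1] over two base algebras at once. Transport avoids this: the scalar
    extension is verified once for arbitrary data and applied both to (H, A) and to (H^F, A_F).
    Coassociativity of the coaction of A_F is an equation in [A ⊗ (H ⊗ H)] and not in the smash
    product, so [zeta] cannot reach it; it is computed from three forms of the cocycle identity in
    the threefold tensor power of H. A Sweedler sum [\sw] runs over a chosen presentation and
    behaves like a map out of the tensor product only for a balanced summand. Over k this follows
    from bilinearity, which the tactic [lin] reads off the syntax. Over A it is a separate argument
    for each summand, and it is there that the bialgebroid axioms enter. *)

Lemma morph0 (P Q : zmodType) (g : P -> Q) :
  {morph g : x y / x + y} -> g 0 = 0.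
Proof. by move=> gD; apply: (addrI (g 0)); rewrite -gD !addr0. Qed.

Section Sums.
Variables (I : Type) (M N : zmodType) (r : I -> M -> M) (l : I -> N -> N).
Implicit Types (P Q : zmodType) (u v : btens r l).

Lemma eq_sw P (f g : M -> N -> P) u :
  (forall x y, f x y = g x y) -> tlift f u = tlift g u.
Proof. by move=> fg; apply: eq_bigr => p _; apply: fg. Qed.

Lemma sw_morph P Q (g : P -> Q) (f : M -> N -> P) u :
  {morph g : x y / x + y} -> g (tlift f u) = \sw_(x, y <- u) g (f x y).
Proof.
by move=> gD; apply: (big_morph g gD); apply: morph0.
Qed.

Lemma swD P (f g : M -> N -> P) u :
  \sw_(x, y <- u) (f x y + g x y) = tlift f u + tlift g u.
Proof. exact: big_split. Qed.

Lemma tens_ext P (f g : btens r l -> P) :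
  {morph f : x y / x + y} -> {morph g : x y / x + y} ->
  (forall m n, f (tens m n) = g (tens m n)) -> f =1 g.
Proof.
move=> fD gD fg; apply: tens_ind => //; last by move=> u v fu fv; rewrite fD gD fu fv.
by rewrite !morph0.
Qed.

End Sums.

Lemma sw_sw (I I' : Type) (M N M' N' P : zmodType) (r : I -> M -> M)
    (l : I -> N -> N) (r' : I' -> M' -> M') (l' : I' -> N' -> N')
    (f : M -> N -> P) (g : M' -> N' -> btens r l) (w : btens r' l') :
  balanced r l f ->
  tlift f (\sw_(a, b <- w) g a b) = \sw_(a, b <- w) tlift f (g a b).
Proof. by move=> fb; apply: (sw_morph _ _ (g := tlift f)) => u v; apply: tliftD. Qed.

(** Both sides are finite sums over fixed presentations of [u] and [v], so this holds for every
    [f]. *)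
Lemma sw_exch (I I' : Type) (M N M' N' P : zmodType) (r : I -> M -> M)
    (l : I -> N -> N) (r' : I' -> M' -> M') (l' : I' -> N' -> N')
    (f : M -> N -> M' -> N' -> P) (u : btens r l) (v : btens r' l') :
  \sw_(x, y <- u) \sw_(z, w <- v) f x y z w =
  \sw_(z, w <- v) \sw_(x, y <- u) f x y z w.
Proof. exact: exchange_big. Qed.

Lemma sw_pull3 (I1 I2 I3 : Type) (M1 M2 M3 N1 N2 N3 P : zmodType)
    (r1 : I1 -> M1 -> M1) (l1 : I1 -> N1 -> N1) (r2 : I2 -> M2 -> M2) (l2 : I2 -> N2 -> N2)
    (r3 : I3 -> M3 -> M3) (l3 : I3 -> N3 -> N3) (u : btens r1 l1)
    (v : M1 -> N1 -> btens r2 l2) (w : btens r3 l3) f :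
  \sw_(a, a' <- u) \sw_(b, b' <- v a a') \sw_(c, c' <- w) (f a a' b b' c c' : P) =
  \sw_(c, c' <- w) \sw_(a, a' <- u) \sw_(b, b' <- v a a') f a a' b b' c c'.
Proof. by rewrite [RHS]sw_exch; apply: eq_sw => a a'; rewrite sw_exch. Qed.

Section Linearity.
Variable k : fieldType.

(* The target is an abelian group with a given scaling rather than a vector
   space, so that this applies to maps into M (x)_A N, on which a vector space
   structure exists only under the bialgebroid axioms. *)
Definition linS (V : lmodType k) (P : zmodType) (sc : k -> P -> P) (f : V -> P) :=
  {morph f : x y / x + y} /\ forall c x, f (c *: x) = sc c (f x).

Definition additiveS (P : zmodType) (sc : k -> P -> P) :=
  forall c, {morph sc c : x y / x + y}.

Definition bilS (V W : lmodType k) (P : zmodType) (sc : k -> P -> P)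
    (f : V -> W -> P) :=
  (forall y, linS sc (f^~ y)) /\ (forall x, linS sc (f x)).

Definition trilS (U V W : lmodType k) (P : zmodType) (sc : k -> P -> P)
    (f : U -> V -> W -> P) :=
  [/\ forall y z, linS sc (fun x => f x y z),
      forall x z, linS sc (fun y => f x y z)
    & forall x y, linS sc (fun z => f x y z)].

Local Notation lin := (linS *:%R).
Implicit Types (V W M N : lmodType k) (P : zmodType).

Lemma lin_linear V W (f : V -> W) : linear f <-> lin f.
Proof.
split=> [fl|[fD fZ] c x y]; last by rewrite fD fZ.
have fD : {morph f : x y / x + y} by move=> x y; rewrite -[x]scale1r fl !scale1r.
by split=> // c x; rewrite -[c *: x]addr0 fl (morph0 fD) addr0.
Qed.

Lemma linS_id V : lin (fun x : V => x).
Proof. by []. Qed.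

Lemma linS_comp V W P sc (g : W -> P) (f : V -> W) :
  linS sc g -> lin f -> linS sc (fun x => g (f x)).
Proof. by move=> [gD gZ] [fD fZ]; split=> [x y|c x]; rewrite ?fD ?fZ ?gD ?gZ. Qed.

Lemma additiveS_scale V : additiveS ( *:%R : k -> V -> V).
Proof. by move=> c x y; rewrite scalerDr. Qed.

(** Only the summand varies while the tensor keeps its presentation, so linearity is checked term by
    term. The case of a varying tensor is [linS_swu]. *)
Lemma linS_swf V P sc I (M N : zmodType) (r : I -> M -> M) (l : I -> N -> N)
    (f : V -> M -> N -> P) (u : btens r l) :
  additiveS sc -> (forall a b, linS sc (fun x => f x a b)) ->
  linS sc (fun x => tlift (f x) u).
Proof.
move=> scD fl; split=> [x y|c x].
  by rewrite -swD; apply: eq_sw => a b; case: (fl a b).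
by rewrite (sw_morph _ _ (scD c)); apply: eq_sw => a b; case: (fl a b).
Qed.

(** A scalar on either factor comes out as the same [sc c] on the target. *)
Lemma bilS_balanced M N P sc (f : M -> N -> P) :
  bilS sc f ->
  balanced (fun (c : k) m => c *: m) (fun (c : k) n => c *: n) f.
Proof.
move=> [fl fr]; split=> [m m' n|m n n'|c m n].
- by case: (fl n).
- by case: (fr m).
- by case: (fl n) => _ ->; case: (fr m) => _ ->.
Qed.

Lemma kscaleE M N c (u : M ⊗ N) : c *: u = kscale c u.
Proof. by []. Qed.

Lemma linS_tlift M N P sc (f : M -> N -> P) :
  additiveS sc -> bilS sc f -> linS sc (fun u : M ⊗ N => tlift f u).
Proof.
move=> scD fb; have fB := bilS_balanced fb; split=> [u v|c]; first exact: tliftD.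
apply: tens_ind => [|m n|u v fu fv].
- rewrite scaler0 (@morph0 (M ⊗ N) _ (tlift f)) ?(morph0 (scD c)) // => u v.
  exact: tliftD.
- by rewrite kscaleE kscale_tens !tlift_tens //; case: fb => fl _; case: (fl n).
- by rewrite scalerDr !tliftD // fu fv scD.
Qed.

Lemma linS_swu V M N P sc (f : M -> N -> P) (u : V -> M ⊗ N) :
  additiveS sc -> (forall n, linS sc (f^~ n)) -> (forall m, linS sc (f m)) ->
  lin u -> linS sc (fun x => tlift f (u x)).
Proof. by move=> scD fl fr ul; apply: (linS_comp (linS_tlift scD _) ul). Qed.

Lemma lin_tensl V M N (f : V -> M) (n : N) :
  lin f -> lin (fun x => tens (f x) n : M ⊗ N).
Proof.
apply: (linS_comp (g := fun m => tens m n : M ⊗ N)).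
split=> [x y|c x]; last by rewrite kscaleE kscale_tens.
by case: (tens_balanced (fun (d : k) (m : M) => d *: m) (fun d (n : N) => d *: n)).
Qed.

Lemma lin_tensr V M N (f : V -> N) (m : M) :
  lin f -> lin (fun x => tens m (f x) : M ⊗ N).
Proof.
have [_ tD tb] := tens_balanced (fun (d : k) (m : M) => d *: m) (fun d (n : N) => d *: n).
apply: (linS_comp (g := fun n => tens m n : M ⊗ N)).
by split=> [x y|c x]; rewrite ?tD // kscaleE kscale_tens tb.
Qed.

Lemma lin_scale V W (f : V -> W) c : lin f -> lin (fun x => c *: f x).
Proof.
apply: (linS_comp (g := fun w => c *: w)).
split=> [x y|d x]; first exact: scalerDr.
by rewrite !scalerA mulrC.
Qed.

Lemma lin_scalel V W (f : V -> k^o) (w : W) : lin f -> lin (fun x => (f x : k) *: w).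
Proof.
apply: (linS_comp (g := fun c : k^o => (c : k) *: w)).
by split=> [x y|d x]; rewrite ?scalerDl ?scalerA.
Qed.

Lemma lin_mull V (H : algType k) (f : V -> H) h : lin f -> lin (fun x => f x * h).
Proof.
apply: (linS_comp (g := fun x => x * h)).
by split=> [x y|d x]; rewrite ?mulrDl ?scalerAl.
Qed.

Lemma lin_mulr V (H : algType k) (f : V -> H) h : lin f -> lin (fun x => h * f x).
Proof.
apply: (linS_comp (g := fun x => h * x)).
by split=> [x y|d x]; rewrite ?mulrDr ?scalerAr.
Qed.

Lemma lin_amull V W (al : algebra_on W) (f : V -> W) w :
  is_algebra al -> lin f -> lin (fun x => amul al (f x) w).
Proof.
by move=> hal; apply: (linS_comp (g := fun x => amul al x w)); apply/lin_linear/amul_linl.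
Qed.

Lemma lin_amulr V W (al : algebra_on W) (f : V -> W) w :
  is_algebra al -> lin f -> lin (fun x => amul al w (f x)).
Proof.
by move=> hal; apply: (linS_comp (g := fun x => amul al w x)); apply/lin_linear/amul_linr.
Qed.

Lemma lin_ext M N (W : lmodType k) (f g : M ⊗ N -> W) :
  lin f -> lin g -> (forall m n, f (tens m n) = g (tens m n)) -> f =1 g.
Proof. by move=> [fD _] [gD _]; apply: tens_ext. Qed.

End Linearity.

Notation lin := (linS *:%R).

Lemma linSD (k : fieldType) (V : lmodType k) (P : zmodType) (sc : k -> P -> P) (f : V -> P) :
  linS sc f -> {morph f : x y / x + y}.
Proof. by case. Qed.

Lemma lin_sw (k : fieldType) (V W : lmodType k) (g : V -> W) (I : Type) (M N : zmodType)
    (r : I -> M -> M) (l : I -> N -> N) (f : M -> N -> V) (u : btens r l) :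
  lin g -> g (tlift f u) = \sw_(x, y <- u) g (f x y).
Proof. by move=> [gD _]; apply: sw_morph. Qed.

Lemma scale_sw (k : fieldType) (V : lmodType k) (c : k) (I : Type) (M N : zmodType)
    (r : I -> M -> M) (l : I -> N -> N) (f : M -> N -> V) (u : btens r l) :
  c *: tlift f u = \sw_(x, y <- u) (c *: f x y).
Proof. by apply: (lin_sw (g := fun x => c *: x)); apply: lin_scale. Qed.

(** * Tensor products of algebras *)

Section BialgebraLinearity.
Variables (k : fieldType) (H : algType k) (B : coalgebra_on H).
Hypothesis hB : is_bialgebra B.

Lemma lin_cop (V : lmodType k) (f : V -> H) : lin f -> lin (fun x => cop B (f x)).
Proof. exact/linS_comp/lin_linear/cop_lin. Qed.

Lemma lin_cou (V : lmodType k) (f : V -> H) :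
  lin f -> lin (fun x => cou B (f x) : k^o).
Proof. exact/linS_comp/lin_linear/cou_lin. Qed.

End BialgebraLinearity.

(* A Yetter-Drinfeld module algebra without its coaction: the smash product
   A_F # H^F is needed before the coaction of A_F is known to satisfy any law. *)
Record is_module_algebra (k : fieldType) (H : algType k) (A : lmodType k)
    (B : coalgebra_on H) (X : yd_data H A) : Prop := {
  ma_algebra : is_algebra (yd_alg X);
  ma_linl : forall a, lin ((act X)^~ a);
  ma_linr : forall h, lin (act X h);
  ma_act1 : forall a, act X 1 a = a;
  ma_actM : forall g h a, act X (g * h) a = act X g (act X h a);
  ma_mul : forall h a b,
    act X h (amul (yd_alg X) a b)
    = \sw_(h1, h2 <- cop B h) amul (yd_alg X) (act X h1 a) (act X h2 b);
  ma_one : forall h, act X h (aone (yd_alg X)) = cou B h *: aone (yd_alg X) }.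

Section ModuleAlgebraLinearity.
Variables (k : fieldType) (H : algType k) (A V : lmodType k) (B : coalgebra_on H).
Variable X : yd_data H A.
Hypothesis hA : is_module_algebra B X.

Lemma lin_actl (f : V -> H) a : lin f -> lin (fun x => act X (f x) a).
Proof. exact: (linS_comp (ma_linl hA a)). Qed.
Lemma lin_actr h (f : V -> A) : lin f -> lin (fun x => act X h (f x)).
Proof. exact: (linS_comp (ma_linr hA h)). Qed.

End ModuleAlgebraLinearity.

Lemma lin_coact (k : fieldType) (H : algType k) (A V : lmodType k)
    (B : coalgebra_on H) (X : yd_data H A) (hM : is_yd_module B X) (f : V -> A) :
  lin f -> lin (fun x => coact X (f x)).
Proof. exact/linS_comp/lin_linear/(coact_lin hM). Qed.

Section Evaluation.
Variables (k : fieldType) (M N : lmodType k) (P : zmodType) (sc : k -> P -> P).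
Variable f : M -> N -> P.
Hypothesis fb : bilS sc f.

Lemma sw_tens m n : tlift f (tens m n : M ⊗ N) = f m n.
Proof. exact/tlift_tens/(bilS_balanced fb). Qed.

Lemma sw_bind (I : Type) (M' N' : zmodType) (r : I -> M' -> M') (l : I -> N' -> N')
    (g : M' -> N' -> M ⊗ N) (w : btens r l) :
  tlift f (\sw_(a, b <- w) g a b) = \sw_(a, b <- w) tlift f (g a b).
Proof. exact/sw_sw/(bilS_balanced fb). Qed.

End Evaluation.

Section TensorAlgebra.
Variables (k : fieldType) (V W : lmodType k) (a : algebra_on V) (b : algebra_on W).

(** [tmul] is the case of two copies of H; iterating the construction gives the algebra on
    [H ⊗ (H ⊗ H)] in which the cocycle identities are inverted. *)
Definition tens_alg : algebra_on (V ⊗ W) :=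
  AlgebraOn
    (fun u v : V ⊗ W => \sw_(x1, x2 <- u) \sw_(y1, y2 <- v)
       (tens (amul a x1 y1) (amul b x2 y2) : V ⊗ W))
    (tens (aone a) (aone b)).

End TensorAlgebra.

(** Extension point of [lin], redefined once the linearity of [tmul] is available. *)
Ltac lin_rule := fail.

Ltac lin_hyp :=
  match goal with
  | h : linS _ _ |- _ => apply (linS_comp h)
  | h : forall a, linS _ _ |- _ => apply (linS_comp (h _))
  | h : forall a b, linS _ _ |- _ => apply (linS_comp (h _ _))
  end.

(* Without the constr: test a pattern variable would happily match an open term. *)
Ltac is_const f := lazymatch f with (fun _ => ?c) => let d := constr:(c) in idtac end.

(** Syntax-directed: at each node one argument is expected to contain the variable, and [is_const]
    decides which. The axioms of the coalgebra, algebra or module that a rule needs are taken from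
    the context. *)
Ltac lin_step :=
  lazymatch goal with
  | |- additiveS _ => first [eassumption | apply additiveS_scale]
  | |- bilS _ _ => split
  | |- trilS _ _ => split
  | |- linS _ (fun x => x) => apply linS_id
  | |- linS _ (fun x => @tlift _ _ _ _ _ _ (@?f x) (@?u x)) =>
      tryif is_const u then apply linS_swf else
      (* The vector space structures of both factors are read off the scalings in the type of the
         tensor. *)
      lazymatch goal with
      | |- @linS ?k ?V ?P ?sc (fun x => @tlift _ _ _
            (fun _ (_ : @GRing.Lmodule.sort _ ?M) => _)
            (fun _ (_ : @GRing.Lmodule.sort _ ?N) => _) _ ?f _) =>
          apply (@linS_swu k V M N P sc f u)
      | _ => apply linS_swu
      end
  | |- linS _ (fun x => @tens _ _ _ (fun _ _ => GRing.scale _ _) _ (@?u x) (@?v x)) =>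
      tryif is_const v then apply lin_tensl else apply lin_tensr
  | |- linS _ (fun x => GRing.mul (@?u x) (@?v x)) =>
      tryif is_const v then apply lin_mull else apply lin_mulr
  | |- linS _ (fun x => cop ?B (@?u x)) => eapply lin_cop; [eassumption|]
  | |- linS _ (fun x => cou ?B (@?u x)) => eapply lin_cou; [eassumption|]
  | |- linS _ (fun x => GRing.scale (@?u x) (@?v x)) =>
      tryif is_const v then apply lin_scalel else apply lin_scale
  | |- linS _ (fun x => amul ?a (@?u x) (@?v x)) =>
      tryif is_const v then (eapply lin_amull; [eassumption|])
      else (eapply lin_amulr; [eassumption|])
  | |- linS _ (fun x => act _ (@?u x) (@?v x)) =>
      tryif is_const v then (eapply lin_actl; [eassumption|])
      else (eapply lin_actr; [eassumption|])
  | |- linS _ (fun x => coact _ (@?u x)) =>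
      first [lin_hyp | eapply lin_coact; [eassumption|]]
  | |- linS _ (fun x => _) => first [solve [auto 2 with nocore] | lin_rule | lin_hyp]
  | |- @linS ?k ?V ?P ?sc ?f => change (@linS k V P sc (fun x => f x))
  | |- forall _, _ => intro
  end.
Ltac lin := repeat (lin_step; cbv beta).

Section TensorAlgebraLaws.
Variables (k : fieldType) (V W : lmodType k) (a : algebra_on V) (b : algebra_on W).
Hypotheses (ha : is_algebra a) (hb : is_algebra b).
Local Notation mul := (amul (tens_alg a b)).

Lemma sw_amul (P : zmodType) (sc : k -> P -> P) (f : V -> W -> P) (u v : V ⊗ W) :
  bilS sc f ->
  tlift f (mul u v) = 
  \sw_(x1, x2 <- u) \sw_(y1, y2 <- v) f (amul a x1 y1) (amul b x2 y2).
Proof.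
move=> fb; rewrite (sw_bind fb); apply: eq_sw => x1 x2.
by rewrite (sw_bind fb); apply: eq_sw => y1 y2; rewrite (sw_tens fb).
Qed.

Lemma tens_algE x1 x2 y1 y2 :
  mul (tens x1 x2) (tens y1 y2) = tens (amul a x1 y1) (amul b x2 y2).
Proof. by rewrite /= !(sw_tens (sc := *:%R)) //; lin. Qed.

Lemma tens_algP : is_algebra (tens_alg a b).
Proof.
split; try by move=> ?; apply/lin_linear; rewrite /=; lin.
- move=> u v w; move: u.
  apply: (lin_ext (f := mul^~ (mul v w)) (g := fun u => mul (mul u v) w));
    [by rewrite /=; lin | by rewrite /=; lin | move=> u1 u2; move: v].
  apply: (lin_ext (f := fun v => mul _ (mul v w)) (g := fun v => mul (mul _ v) w));
    [by rewrite /=; lin | by rewrite /=; lin | move=> v1 v2; move: w].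
  apply: (lin_ext (f := fun w => mul _ (mul _ w)) (g := fun w => mul (mul _ _) w));
    [by rewrite /=; lin | by rewrite /=; lin | move=> w1 w2].
  by rewrite !tens_algE (amulA ha) (amulA hb).
- apply: (lin_ext (f := mul _) (g := id)); [by rewrite /=; lin | by [] | move=> v1 v2].
  by rewrite tens_algE (amul1l ha) (amul1l hb).
- apply: (lin_ext (f := mul^~ _) (g := id)); [by rewrite /=; lin | by [] | move=> v1 v2].
  by rewrite tens_algE (amul1r ha) (amul1r hb).
Qed.

End TensorAlgebraLaws.

Section Threefold.
Variables (k : fieldType) (U V W : lmodType k) (P : zmodType) (sc : k -> P -> P).
Variable f : U -> V -> W -> P.
Hypotheses (scD : additiveS sc) (f3 : trilS sc f).

(* Giving the lmodType explicitly keeps the structure in the form that the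
   unification in sw_tens expects. *)
Definition sw3 (w : U ⊗ (V ⊗ W)) : P :=
  @tlift k U (V ⊗ W : lmodType k) _ _ P (fun x v => \sw_(y, z <- v) f x y z) w.

Lemma linS_sw3 : linS sc sw3.
Proof. by case: f3 => f1 f2 f3'; rewrite /sw3; lin. Qed.

Lemma sw3_tens x v : sw3 (tens x v) = \sw_(y, z <- v) f x y z.
Proof. by case: f3 => f1 f2 f3'; rewrite /sw3 (sw_tens (sc := sc)) //; lin. Qed.

Lemma sw3_tens3 x y z : sw3 (tens x (tens y z)) = f x y z.
Proof. by case: f3 => f1 f2 f3'; rewrite sw3_tens (sw_tens (sc := sc)) //; lin. Qed.

Lemma sw3_sw I (M N : zmodType) (r : I -> M -> M) (l : I -> N -> N)
    (g : M -> N -> U ⊗ (V ⊗ W)) (u : btens r l) :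
  sw3 (\sw_(a, b <- u) g a b) = \sw_(a, b <- u) sw3 (g a b).
Proof. by apply: (sw_morph _ _ (g := sw3)); case: linS_sw3. Qed.

End Threefold.

(** * Drinfeld twists *)

Section TensorSquare.
Variables (k : fieldType) (H : algType k).

Definition ring_alg : algebra_on H := AlgebraOn *%R 1.

Lemma ring_algP : is_algebra ring_alg.
Proof.
split=> [y|x|x y z|x|x]; try apply/lin_linear; rewrite /=; lin.
- exact: mulrA.
- exact: mul1r.
- exact: mulr1.
Qed.

Local Notation alg2 := (tens_alg ring_alg ring_alg).
Local Notation alg3 := (tens_alg ring_alg alg2).

Lemma tmul_algP : is_algebra alg2.
Proof. exact: tens_algP ring_algP ring_algP. Qed.

Lemma tmul3_algP : is_algebra alg3.
Proof. exact: tens_algP ring_algP tmul_algP. Qed.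

Lemma lin_tmul_l (V : lmodType k) (f : V -> H ⊗ H) v :
  lin f -> lin (fun x => tmul (f x) v).
Proof. exact: lin_amull tmul_algP. Qed.

Lemma lin_tmul_r (V : lmodType k) (f : V -> H ⊗ H) v :
  lin f -> lin (fun x => tmul v (f x)).
Proof. exact: lin_amulr tmul_algP. Qed.

Lemma sw_tmul (P : zmodType) (sc : k -> P -> P) (f : H -> H -> P) (u v : H ⊗ H) :
  bilS sc f ->
  tlift f (tmul u v) = \sw_(x1, x2 <- u) \sw_(y1, y2 <- v) f (x1 * y1) (x2 * y2).
Proof. exact: (@sw_amul _ _ _ ring_alg ring_alg). Qed.

Lemma tmulE x1 x2 y1 y2 :
  tmul (tens x1 x2) (tens y1 y2) = tens (x1 * y1) (x2 * y2) :> (H ⊗ H).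
Proof. exact: tens_algE ring_algP ring_algP _ _ _ _. Qed.

Lemma tmulA : associative (@tmul k H).
Proof. exact: amulA tmul_algP. Qed.
Lemma tmul1l : left_id (tens 1 1) (@tmul k H).
Proof. exact: amul1l tmul_algP. Qed.
Lemma tmul1r : right_id (tens 1 1) (@tmul k H).
Proof. exact: amul1r tmul_algP. Qed.

Lemma bilin_ext (W : lmodType k) (f g : H ⊗ H -> H ⊗ H -> W) :
  (forall v, lin (f^~ v)) -> (forall v, lin (g^~ v)) ->
  (forall u, lin (f u)) -> (forall u, lin (g u)) ->
  (forall x1 x2 y1 y2, f (tens x1 x2) (tens y1 y2) = g (tens x1 x2) (tens y1 y2)) ->
  forall u v, f u v = g u v.
Proof.
move=> fl gl fr gr fg u v; move: u; apply: lin_ext => // x1 x2; move: v.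
by apply: lin_ext.
Qed.

End TensorSquare.

Ltac lin_rule ::=
  lazymatch goal with
  | |- linS _ (fun x => tmul (@?u x) (@?v x)) =>
      tryif is_const v then apply lin_tmul_l else apply lin_tmul_r
  end.

(** * The cocycle identities in the threefold tensor power, and the bialgebra H^F *)

Section Twist.
Variables (k : fieldType) (H : algType k) (B : coalgebra_on H) (F Finv : H ⊗ H).
Hypotheses (hB : is_bialgebra B) (hF : drinfeld_twist B F Finv).

Let A2 := tmul_algP H.
Let A3 := tmul3_algP H.
Local Notation mul3 := (amul (tens_alg (ring_alg H) (tens_alg (ring_alg H) (ring_alg H)))).

(** [D12] and [D23] are Delta ⊗ id and id ⊗ Delta; [e12] and [e23] append a unit on the right and on
    the left. All four are unital algebra maps, so identities of the twist become equations in one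
    algebra, where inverses can be taken. *)
Definition D12 (u : H ⊗ H) : H ⊗ (H ⊗ H) :=
  \sw_(x, y <- u) \sw_(x1, x2 <- cop B x) (tens x1 (tens x2 y) : H ⊗ (H ⊗ H)).
Definition D23 (u : H ⊗ H) : H ⊗ (H ⊗ H) :=
  \sw_(x, y <- u) (tens x (cop B y) : H ⊗ (H ⊗ H)).
Definition e12 (u : H ⊗ H) : H ⊗ (H ⊗ H) :=
  \sw_(x, y <- u) (tens x (tens y 1) : H ⊗ (H ⊗ H)).
Definition e23 (u : H ⊗ H) : H ⊗ (H ⊗ H) := tens 1 u.

Lemma D12E x y : D12 (tens x y) = \sw_(x1, x2 <- cop B x) (tens x1 (tens x2 y) : H ⊗ (H ⊗ H)).
Proof. by rewrite /D12 (sw_tens (sc := *:%R)) //; lin. Qed.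
Lemma D23E x y : D23 (tens x y) = tens x (cop B y).
Proof. by rewrite /D23 (sw_tens (sc := *:%R)) //; lin. Qed.
Lemma e12E x y : e12 (tens x y) = tens x (tens y 1).
Proof. by rewrite /e12 (sw_tens (sc := *:%R)) //; lin. Qed.

Lemma mul3E x1 u y1 v : mul3 (tens x1 u) (tens y1 v) = tens (x1 * y1) (tmul u v).
Proof. exact: tens_algE (ring_algP H) A2 _ _ _ _. Qed.

Lemma D23M u v : D23 (tmul u v) = mul3 (D23 u) (D23 v).
Proof.
move: u v; apply: bilin_ext.
1-4: by move=> w; rewrite /D23; lin.
by move=> x1 x2 y1 y2; rewrite tmulE !D23E (copM hB) mul3E.
Qed.

Lemma D12M u v : D12 (tmul u v) = mul3 (D12 u) (D12 v).
Proof.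
move: u v; apply: bilin_ext.
1-4: by move=> w; rewrite /D12; lin.
move=> x1 x2 y1 y2; rewrite tmulE !D12E (copM hB) (sw_tmul (sc := *:%R)); last by lin.
rewrite (lin_sw (g := mul3^~ _)); last by lin.
apply: eq_sw => a b; rewrite (lin_sw (g := mul3 _)); last by lin.
by apply: eq_sw => c d; rewrite mul3E tmulE.
Qed.

Lemma e12M u v : e12 (tmul u v) = mul3 (e12 u) (e12 v).
Proof.
move: u v; apply: bilin_ext.
1-4: by move=> w; rewrite /e12; lin.
by move=> x1 x2 y1 y2; rewrite tmulE !e12E mul3E tmulE mul1r.
Qed.

Lemma e23M u v : e23 (tmul u v) = mul3 (e23 u) (e23 v).
Proof. by rewrite /e23 mul3E mul1r. Qed.

Local Notation one3 := (tens 1 (tens 1 1) : H ⊗ (H ⊗ H)).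

Lemma D23_one : D23 (tens 1 1) = one3.
Proof. by rewrite D23E (cop1 hB). Qed.

Lemma D12_one : D12 (tens 1 1) = one3.
Proof. by rewrite D12E (cop1 hB) (sw_tens (sc := *:%R)) //; lin. Qed.

(** With the third leg kept as a parameter, [D12 u] is a Sweedler sum of terms [ins3 y (cop B x)],
    and multiplication by [e12] acts inside each term. *)
Definition ins3 y (u : H ⊗ H) : H ⊗ (H ⊗ H) :=
  \sw_(x1, x2 <- u) (tens x1 (tens x2 y) : H ⊗ (H ⊗ H)).

Lemma e12_ins3 u y v : mul3 (e12 u) (ins3 y v) = ins3 y (tmul u v).
Proof.
move: u v; apply: bilin_ext.
1-4: by move=> w; rewrite /e12 /ins3; lin.
move=> x1 x2 y1 y2; rewrite tmulE e12E /ins3 !(sw_tens (sc := *:%R)) ?mul3E ?tmulE ?mul1r //;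
  by lin.
Qed.

Lemma ins3_e12 u y v : mul3 (ins3 y u) (e12 v) = ins3 y (tmul u v).
Proof.
move: u v; apply: bilin_ext.
1-4: by move=> w; rewrite /e12 /ins3; lin.
move=> x1 x2 y1 y2; rewrite tmulE e12E /ins3 !(sw_tens (sc := *:%R)) ?mul3E ?tmulE ?mulr1 //;
  by lin.
Qed.

Lemma cocycle3 : mul3 (e23 F) (D23 F) = mul3 (e12 F) (D12 F).
Proof.
transitivity (\sw_(f1, f2 <- F) (tens f1 (tmul F (cop B f2)) : H ⊗ (H ⊗ H))).
  rewrite /D23 (lin_sw (g := mul3 _)); last by lin.
  by apply: eq_sw => x y; rewrite mul3E mul1r.
rewrite (twist_cocycle hF) (lin_sw (g := mul3 _)); last by lin.
by apply: eq_sw => x y; rewrite -/(ins3 y _) -/(ins3 y _) e12_ins3.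
Qed.

Lemma inverse_uniq (V : lmodType k) (al : algebra_on V) x x' y' :
  is_algebra al -> amul al x x' = aone al -> amul al y' x = aone al -> x' = y'.
Proof. by move=> h xx' y'x; rewrite -(amul1l h x') -y'x -(amulA h) xx' (amul1r h). Qed.

Lemma e23_one : e23 (tens 1 1) = one3. Proof. by []. Qed.
Lemma e12_one : e12 (tens 1 1) = one3. Proof. exact: e12E. Qed.

Lemma D23V : mul3 (D23 F) (D23 Finv) = one3.
Proof. by rewrite -D23M (twist_mulV hF) D23_one. Qed.
Lemma e23V : mul3 (e23 F) (e23 Finv) = one3.
Proof. by rewrite -e23M (twist_mulV hF) e23_one. Qed.
Lemma e12Vl : mul3 (e12 Finv) (e12 F) = one3.
Proof. by rewrite -e12M (twist_mulVl hF) e12_one. Qed.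
Lemma D12Vl : mul3 (D12 Finv) (D12 F) = one3.
Proof. by rewrite -D12M (twist_mulVl hF) D12_one. Qed.

Lemma mul3_1l w : mul3 one3 w = w. Proof. exact: amul1l A3 w. Qed.
Lemma mul3_1r w : mul3 w one3 = w. Proof. exact: amul1r A3 w. Qed.

(** The two sides are a right and a left inverse of the element in [cocycle3], each computed from a
    different one of its two expressions. *)
Lemma cocycle3V : mul3 (D23 Finv) (e23 Finv) = mul3 (D12 Finv) (e12 Finv).
Proof.
apply: (inverse_uniq (x := mul3 (e23 F) (D23 F)) A3).
  by rewrite (amulA A3) -(amulA A3 (e23 F)) D23V mul3_1r e23V.
by rewrite cocycle3 (amulA A3) -(amulA A3 (D12 Finv)) e12Vl mul3_1r D12Vl.
Qed.

(** This is [cocycle3] multiplied by [e12 Finv] on the left and by [D23 Finv] on the right. It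
    resolves the place where an inverse twist meets a twist in the iterated coaction of A_F. *)
Lemma cocycle3_mixed : mul3 (e12 Finv) (e23 F) = mul3 (D12 F) (D23 Finv).
Proof.
rewrite -[e23 F]mul3_1r -D23V (amulA A3 (e23 F)) cocycle3 !(amulA A3).
by rewrite e12Vl mul3_1l.
Qed.

Local Notation BF := (twisted_bialgebra B F Finv).

Lemma copA3 h : D12 (cop B h) = D23 (cop B h).
Proof. exact: copA hB h. Qed.

(** Both sides are the coassociativity [copA3 h] conjugated by the element of [cocycle3], whose
    inverse is given by [cocycle3V]. *)
Lemma twisted_copA h :
  \sw_(h1, h2 <- cop BF h) \sw_(h11, h12 <- cop BF h1)
     (tens h11 (tens h12 h2) : H ⊗ (H ⊗ H))
  = \sw_(h1, h2 <- cop BF h) (tens h1 (cop BF h2) : H ⊗ (H ⊗ H)).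
Proof.
transitivity (mul3 (mul3 (e12 F) (D12 (cop BF h))) (e12 Finv)).
  rewrite [D12 _](_ : _ = \sw_(h1, h2 <- cop BF h) ins3 h2 (cop B h1)) //.
  rewrite (lin_sw (g := fun w => mul3 (mul3 (e12 F) w) (e12 Finv))); last by lin.
  by apply: eq_sw => x y; rewrite e12_ins3 ins3_e12.
transitivity (mul3 (mul3 (e23 F) (D23 (cop BF h))) (e23 Finv)); last first.
  rewrite /D23 (lin_sw (g := fun w => mul3 (mul3 (e23 F) w) (e23 Finv))); last by lin.
  by apply: eq_sw => x y; rewrite !mul3E mul1r mulr1.
rewrite [cop BF h]/(tmul (tmul F (cop B h)) Finv) !D12M !D23M !(amulA A3) cocycle3 copA3.
by rewrite -!(amulA A3 _ _ (e12 _)) -!(amulA A3 _ _ (e23 _)) cocycle3V.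
Qed.

Definition coul (u : H ⊗ H) : H := \sw_(x, y <- u) (cou B x *: y).
Definition cour (u : H ⊗ H) : H := \sw_(x, y <- u) (cou B y *: x).

Lemma coulM u v : coul (tmul u v) = coul u * coul v.
Proof.
move: u v; apply: bilin_ext.
1-4: by move=> w; rewrite /coul; lin.
move=> x1 x2 y1 y2; rewrite tmulE /coul !(sw_tens (sc := *:%R)); try by lin.
by rewrite (couM hB) -scalerAl -scalerAr scalerA.
Qed.

Lemma courM u v : cour (tmul u v) = cour u * cour v.
Proof.
move: u v; apply: bilin_ext.
1-4: by move=> w; rewrite /cour; lin.
move=> x1 x2 y1 y2; rewrite tmulE /cour !(sw_tens (sc := *:%R)); try by lin.
by rewrite (couM hB) -scalerAl -scalerAr scalerA.
Qed.

Lemma coul_one : coul (tens 1 1) = 1.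
Proof. by rewrite /coul (sw_tens (sc := *:%R)) ?(cou1 hB) ?scale1r //; lin. Qed.
Lemma cour_one : cour (tens 1 1) = 1.
Proof. by rewrite /cour (sw_tens (sc := *:%R)) ?(cou1 hB) ?scale1r //; lin. Qed.

(** [coul] is multiplicative and equals 1 at [F], hence also at its inverse. *)
Lemma twist_coulV : coul Finv = 1.
Proof.
by rewrite -[coul _]mul1r -[X in X * _](twist_coul hF) -/(coul F) -coulM (twist_mulV hF) coul_one.
Qed.

Lemma twist_courV : cour Finv = 1.
Proof.
by rewrite -[cour _]mul1r -[X in X * _](twist_cour hF) -/(cour F) -courM (twist_mulV hF) cour_one.
Qed.

Lemma twisted_bialgebraP : is_bialgebra BF.
Proof.
split=> /=.
- by apply/lin_linear; lin.
- exact: cou_lin hB.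
- exact: twisted_copA.
- move=> h; rewrite -/(coul _) !coulM twist_coulV /coul (cop_coul hB) (twist_coul hF).
  by rewrite mul1r mulr1.
- move=> h; rewrite -/(cour _) !courM twist_courV /cour (cop_cour hB) (twist_cour hF).
  by rewrite mul1r mulr1.
- by rewrite (cop1 hB) tmul1r (twist_mulV hF).
- move=> g h; rewrite (copM hB) !tmulA -(tmulA _ Finv F) (twist_mulVl hF).
  by rewrite tmul1r.
- exact: cou1 hB.
- exact: couM hB.
Qed.

(** * The identities of the twist and the coproduct under multilinear maps *)

Section Transfer.
Variables (P : zmodType) (sc : k -> P -> P).
Hypothesis scD : additiveS sc.

Lemma sw_coassoc (f : H -> H -> H -> P) h : trilS sc f ->
  \sw_(h1, h2 <- cop B h) \sw_(h11, h12 <- cop B h1) f h11 h12 h2 =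
  \sw_(h1, h2 <- cop B h) \sw_(h21, h22 <- cop B h2) f h1 h21 h22.
Proof.
move=> f3; have := congr1 (sw3 f) (copA3 h); rewrite /D12 /D23 !(sw3_sw scD f3).
under eq_sw => x y.
  rewrite (sw3_sw scD f3); under eq_sw => z t do rewrite (sw3_tens3 scD f3).
  over.
by move=> ->; apply: eq_sw => x y; rewrite (sw3_tens scD f3).
Qed.

Section Threefold.
Variable f : H -> H -> H -> P.
Hypothesis f3 : trilS sc f.

Let f1 y z : linS sc (fun x => f x y z). Proof. by case: f3. Qed.
Let f2 x z : linS sc (fun y => f x y z). Proof. by case: f3. Qed.
Let f3' x y : linS sc (fun z => f x y z). Proof. by case: f3. Qed.

Lemma sw3_ins3 y u : sw3 f (ins3 y u) = \sw_(x1, x2 <- u) f x1 x2 y.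
Proof. by rewrite (sw3_sw scD f3); apply: eq_sw => *; rewrite (sw3_tens3 scD f3). Qed.

Lemma sw3_D12e12 u v :
  sw3 f (mul3 (D12 u) (e12 v)) = 
  \sw_(x, y <- u) \sw_(x1, x2 <- cop B x) \sw_(z, t <- v) f (x1 * z) (x2 * t) y.
Proof.
rewrite {1}/D12 (lin_sw (g := mul3^~ _)); last by lin.
rewrite (sw3_sw scD f3); apply: eq_sw => x y.
by rewrite -/(ins3 _ _) ins3_e12 sw3_ins3 (sw_tmul (sc := sc)) //; lin.
Qed.

Lemma sw3_e12D12 u v :
  sw3 f (mul3 (e12 v) (D12 u)) = 
  \sw_(x, y <- u) \sw_(z, t <- v) \sw_(x1, x2 <- cop B x) f (z * x1) (t * x2) y.
Proof.
rewrite {1}/D12 (lin_sw (g := mul3 _)); last by lin.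
rewrite (sw3_sw scD f3); apply: eq_sw => x y.
by rewrite -/(ins3 _ _) e12_ins3 sw3_ins3 (sw_tmul (sc := sc)) //; lin.
Qed.

Lemma sw3_D23e23 u v :
  sw3 f (mul3 (D23 u) (e23 v)) = 
  \sw_(x, y <- u) \sw_(y1, y2 <- cop B y) \sw_(z, t <- v) f x (y1 * z) (y2 * t).
Proof.
rewrite {1}/D23 (lin_sw (g := mul3^~ _)); last by lin.
rewrite (sw3_sw scD f3); apply: eq_sw => x y.
by rewrite mul3E mulr1 (sw3_tens scD f3) (sw_tmul (sc := sc)) //; lin.
Qed.

Lemma sw3_e23D23 u v :
  sw3 f (mul3 (e23 v) (D23 u)) = 
  \sw_(x, y <- u) \sw_(z, t <- v) \sw_(y1, y2 <- cop B y) f x (z * y1) (t * y2).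
Proof.
rewrite {1}/D23 (lin_sw (g := mul3 _)); last by lin.
rewrite (sw3_sw scD f3); apply: eq_sw => x y.
by rewrite mul3E mul1r (sw3_tens scD f3) (sw_tmul (sc := sc)) //; lin.
Qed.

Lemma sw3_e12e23 u v :
  sw3 f (mul3 (e12 u) (e23 v)) = \sw_(x, y <- u) \sw_(z, t <- v) f x (y * z) t.
Proof.
rewrite {1}/e12 (lin_sw (g := mul3^~ _)); last by lin.
rewrite (sw3_sw scD f3); apply: eq_sw => x y.
rewrite mul3E mulr1 (sw3_tens scD f3) (sw_tmul (sc := sc)); last by lin.
rewrite (sw_tens (sc := sc)); last by lin.
by apply: eq_sw => *; rewrite mul1r.
Qed.

Lemma sw3_D12D23 u v :
  sw3 f (mul3 (D12 u) (D23 v)) = 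
  \sw_(x, y <- u) \sw_(z, t <- v) \sw_(x1, x2 <- cop B x) \sw_(t1, t2 <- cop B t)
     f (x1 * z) (x2 * t1) (y * t2).
Proof.
rewrite {1}/D12 (lin_sw (g := mul3^~ _)); last by lin.
rewrite (sw3_sw scD f3); apply: eq_sw => x y.
rewrite {1}/D23 (lin_sw (g := mul3 _)); last by lin.
rewrite (sw3_sw scD f3); apply: eq_sw => z t.
rewrite (lin_sw (g := mul3^~ _)); last by lin.
rewrite (sw3_sw scD f3); apply: eq_sw => x1 x2.
rewrite mul3E (sw3_tens scD f3) (sw_tmul (sc := sc)); last by lin.
by rewrite (sw_tens (sc := sc)) //; lin.
Qed.

Lemma sw_cocycle :
  \sw_(x, y <- F) \sw_(z, t <- F) \sw_(x1, x2 <- cop B x) f (z * x1) (t * x2) y =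
  \sw_(x, y <- F) \sw_(z, t <- F) \sw_(y1, y2 <- cop B y) f x (z * y1) (t * y2).
Proof. by rewrite -sw3_e12D12 -cocycle3 sw3_e23D23. Qed.

Lemma sw_cocycleV :
  \sw_(x, y <- Finv) \sw_(x1, x2 <- cop B x) \sw_(z, t <- Finv) f (x1 * z) (x2 * t) y =
  \sw_(x, y <- Finv) \sw_(y1, y2 <- cop B y) \sw_(z, t <- Finv) f x (y1 * z) (y2 * t).
Proof. by rewrite -sw3_D12e12 -cocycle3V sw3_D23e23. Qed.

Lemma sw_cocycle_mixed :
  \sw_(x, y <- Finv) \sw_(z, t <- F) f x (y * z) t =
  \sw_(x, y <- F) \sw_(z, t <- Finv) \sw_(x1, x2 <- cop B x) \sw_(t1, t2 <- cop B t)
     f (x1 * z) (x2 * t1) (y * t2).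
Proof. by rewrite -sw3_e12e23 cocycle3_mixed sw3_D12D23. Qed.

End Threefold.

Section Twofold.
Variable f : H -> H -> P.
Hypothesis fb : bilS sc f.

Lemma sw_FV : \sw_(x, y <- F) \sw_(z, t <- Finv) f (x * z) (y * t) = f 1 1.
Proof. by rewrite -(sw_tmul _ _ fb) (twist_mulV hF) (sw_tens fb). Qed.

Lemma sw_VF : \sw_(x, y <- Finv) \sw_(z, t <- F) f (x * z) (y * t) = f 1 1.
Proof. by rewrite -(sw_tmul _ _ fb) (twist_mulVl hF) (sw_tens fb). Qed.

(** This is [Delta(h) F^-1 = F^-1 Delta^F(h)], the definition of Delta^F multiplied by [Finv] on the
    left. It is the only way in which the coproduct of H^F enters the computations with [Finv]. *)
Lemma sw_copV h :
  \sw_(h1, h2 <- cop B h) \sw_(x, y <- Finv) f (h1 * x) (h2 * y) =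
  \sw_(x, y <- Finv) \sw_(h1, h2 <- cop BF h) f (x * h1) (y * h2).
Proof.
by rewrite -!(sw_tmul _ _ fb) /= !tmulA (twist_mulVl hF) tmul1l.
Qed.

Lemma sw_copF h :
  \sw_(h1, h2 <- cop BF h) \sw_(x, y <- F) f (h1 * x) (h2 * y) =
  \sw_(x, y <- F) \sw_(h1, h2 <- cop B h) f (x * h1) (y * h2).
Proof.
by rewrite -!(sw_tmul _ _ fb) /= -!tmulA (twist_mulVl hF) tmul1r.
Qed.

Lemma sw_copM g h :
  tlift f (cop B (g * h)) =
  \sw_(g1, g2 <- cop B g) \sw_(h1, h2 <- cop B h) f (g1 * h1) (g2 * h2).
Proof. by rewrite (copM hB) (sw_tmul _ _ fb). Qed.

Lemma sw_cop1 : tlift f (cop B 1) = f 1 1.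
Proof. by rewrite (cop1 hB) (sw_tens fb). Qed.

End Twofold.

End Transfer.

Section Counits.
Variables (V : lmodType k) (f : H -> V).
Hypothesis fl : lin f.

Let sw_coul u : \sw_(x, y <- u) (cou B x *: f y) = f (coul u).
Proof. by rewrite (lin_sw _ _ fl); apply: eq_sw => x y; rewrite (proj2 fl). Qed.
Let sw_cour u : \sw_(x, y <- u) (cou B y *: f x) = f (cour u).
Proof. by rewrite (lin_sw _ _ fl); apply: eq_sw => x y; rewrite (proj2 fl). Qed.

Lemma sw_cop_coul h : \sw_(x, y <- cop B h) (cou B x *: f y) = f h.
Proof. by rewrite sw_coul; congr f; apply: cop_coul hB h. Qed.
Lemma sw_cop_cour h : \sw_(x, y <- cop B h) (cou B y *: f x) = f h.
Proof. by rewrite sw_cour; congr f; apply: cop_cour hB h. Qed.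
Lemma sw_F_cour : \sw_(x, y <- F) (cou B y *: f x) = f 1.
Proof. by rewrite sw_cour; congr f; apply: twist_cour hF. Qed.
Lemma sw_V_coul : \sw_(x, y <- Finv) (cou B x *: f y) = f 1.
Proof. by rewrite sw_coul twist_coulV. Qed.
Lemma sw_V_cour : \sw_(x, y <- Finv) (cou B y *: f x) = f 1.
Proof. by rewrite sw_cour twist_courV. Qed.

End Counits.

End Twist.

(** * Smash products *)

Section SmashProduct.
Variables (k : fieldType) (H : algType k) (A : lmodType k) (B : coalgebra_on H).
Variable X : yd_data H A.
Hypotheses (hB : is_bialgebra B) (hA : is_module_algebra B X).

Let halg := ma_algebra hA.
Local Notation "a *_A b" := (amul (yd_alg X) a b) (at level 40, left associativity).
Local Notation "x *' y" := (amul (smash_alg B X) x y) (at level 40, left associativity).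
Local Notation "1_A" := (aone (yd_alg X)).
Local Notation "h ▷ a" := (act X h a) (at level 35, right associativity).

Local Notation "a ♯ h" := (tens a h : A ⊗ H) (at level 42, no associativity).

Lemma smashE a h b g :
  tens a h *' tens b g = \sw_(h1, h2 <- cop B h) (tens (a *_A (h1 ▷ b)) (h2 * g) : A ⊗ H).
Proof. by rewrite /= !(sw_tens (sc := *:%R)) //; lin. Qed.

Lemma smash_linl v : lin (fun u => u *' v).
Proof. by rewrite /=; lin. Qed.
Lemma smash_linr u : lin (fun v => u *' v).
Proof. by rewrite /=; lin. Qed.

Lemma smash_swl I (M N : zmodType) (r : I -> M -> M) (l : I -> N -> N)
    (f : M -> N -> A ⊗ H) (u : btens r l) v :
  tlift f u *' v = \sw_(x, y <- u) (f x y *' v).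
Proof. exact: (lin_sw _ _ (smash_linl v)). Qed.

Lemma smash_swr I (M N : zmodType) (r : I -> M -> M) (l : I -> N -> N)
    (f : M -> N -> A ⊗ H) (u : btens r l) v :
  v *' tlift f u = \sw_(x, y <- u) (v *' f x y).
Proof. exact: (lin_sw _ _ (smash_linr v)). Qed.

Lemma smash_assoc u v w : u *' (v *' w) = u *' v *' w.
Proof.
move: u; apply: (lin_ext (f := fun u => u *' (v *' w)) (g := fun u => u *' v *' w)).
- exact: smash_linl.
- exact: linS_comp (smash_linl w) (smash_linl v).
move=> a h; move: v; apply: (lin_ext (f := fun v => _ *' (v *' w)) (g := fun v => _ *' v *' w)).
- exact: linS_comp (smash_linr _) (smash_linl w).
- exact: linS_comp (smash_linl w) (smash_linr _).
move=> b g; move: w; apply: (lin_ext (f := fun w => _ *' (_ *' w)) (g := fun w => _ *' w)).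
- exact: linS_comp (smash_linr _) (smash_linr _).
- exact: smash_linr.
move=> c l; rewrite !smashE smash_swl smash_swr.
transitivity (\sw_(g1, g2 <- cop B g) \sw_(h1, h2 <- cop B h) \sw_(h11, h12 <- cop B h1)
   (tens (a *_A ((h11 ▷ b) *_A (h12 ▷ g1 ▷ c))) (h2 * (g2 * l)) : A ⊗ H)).
  apply: eq_sw => g1 g2; rewrite smashE; apply: eq_sw => h1 h2.
  rewrite (ma_mul hA) (lin_sw (g := fun x => (a *_A x) ♯ _)) //; lin.
rewrite sw_exch.
transitivity (\sw_(h1, h2 <- cop B h) \sw_(h21, h22 <- cop B h2) \sw_(g1, g2 <- cop B g)
   (tens (a *_A ((h1 ▷ b) *_A (h21 ▷ g1 ▷ c))) (h22 * (g2 * l)) : A ⊗ H)).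
  rewrite -(sw_coassoc hB (sc := *:%R)); [|by lin..].
  by apply: eq_sw => h1 h2; rewrite sw_exch.
apply: eq_sw => h1 h2; rewrite smashE (sw_copM hB (sc := *:%R)); last by lin.
by apply: eq_sw => h21 h22; apply: eq_sw => g1 g2; rewrite (amulA halg) (ma_actM hA) mulrA.
Qed.

Lemma smash_mul_s a b h : tens a 1 *' tens b h = tens (a *_A b) h.
Proof.
rewrite smashE (sw_cop1 hB (sc := *:%R)) ?(ma_act1 hA) ?mul1r //; lin.
Qed.

Lemma smash_mul_j a h g : tens a h *' tens 1_A g = tens a (h * g).
Proof.
rewrite smashE -(sw_cop_coul hB (f := fun h => a ♯ (h * g))); last by lin.
apply: eq_sw => h1 h2; rewrite (ma_one hA).
rewrite (proj2 (_ : lin (fun x => (a *_A x) ♯ (h2 * g)))) ?(amul1r halg) //; lin.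
Qed.

Lemma smash_j_s h a : tens 1_A h *' tens a 1 = \sw_(h1, h2 <- cop B h) (tens (h1 ▷ a) h2 : A ⊗ H).
Proof. by rewrite smashE; apply: eq_sw => *; rewrite (amul1l halg) mulr1. Qed.

Lemma smash_split a h : tens a h = tens a 1 *' tens 1_A h.
Proof. by rewrite smash_mul_j mul1r. Qed.

Lemma smash_algP : is_algebra (smash_alg B X).
Proof.
split=> [v|u|u v w||].
- exact/lin_linear/smash_linl.
- exact/lin_linear/smash_linr.
- exact: smash_assoc.
- apply: lin_ext; [exact: smash_linr|by []|move=> a h].
  by rewrite smash_mul_s (amul1l halg).
- apply: (lin_ext (f := fun u => u *' _)); [exact: smash_linl|by []|move=> a h].
  by rewrite smash_mul_j mulr1.
Qed.

End SmashProduct.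

(** * The twisted smash product *)

Section TwistedSmash.
Variables (k : fieldType) (H : algType k) (A : lmodType k) (B : coalgebra_on H).
Variables (X : yd_data H A) (F Finv : H ⊗ H).
Hypotheses (hB : is_bialgebra B) (hF : drinfeld_twist B F Finv).
Hypothesis hA : is_module_algebra B X.

Let halg := ma_algebra hA.
Local Notation BF := (twisted_bialgebra B F Finv).
Local Notation XF := (twisted_yd X F Finv).
Local Notation "a *_A b" := (amul (yd_alg X) a b) (at level 40, left associativity).
Local Notation "a *_F b" := (amul (yd_alg XF) a b) (at level 40, left associativity).
Local Notation "x *' y" := (amul (smash_alg B X) x y) (at level 40, left associativity).
Local Notation "x *'F y" := (amul (smash_alg BF XF) x y) (at level 40, left associativity).
Local Notation "1_A" := (aone (yd_alg X)).
Local Notation "h ▷ a" := (act X h a) (at level 35, right associativity).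
Local Notation "a ♯ h" := (tens a h : A ⊗ H) (at level 42, no associativity).

Lemma act_sw h I (M N : zmodType) (r : I -> M -> M) (l : I -> N -> N)
    (f : M -> N -> A) (u : btens r l) :
  h ▷ tlift f u = \sw_(x, y <- u) (h ▷ f x y).
Proof. exact: (lin_sw _ _ (ma_linr hA h)). Qed.

Lemma mulA_swl I (M N : zmodType) (r : I -> M -> M) (l : I -> N -> N)
    (f : M -> N -> A) (u : btens r l) a :
  tlift f u *_A a = \sw_(x, y <- u) (f x y *_A a).
Proof. by apply: (lin_sw (g := (amul (yd_alg X))^~ a)); lin. Qed.

Lemma mulA_swr I (M N : zmodType) (r : I -> M -> M) (l : I -> N -> N)
    (f : M -> N -> A) (u : btens r l) a :
  a *_A tlift f u = \sw_(x, y <- u) (a *_A f x y).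
Proof. by apply: (lin_sw (g := amul (yd_alg X) a)); lin. Qed.

Lemma twisted_mulE a b : a *_F b = \sw_(e1, e2 <- Finv) ((e1 ▷ a) *_A (e2 ▷ b)).
Proof. by []. Qed.

(** Associativity is the cocycle identity of [Finv] acting on the three factors, since H acts on a
    product through Delta. The unit laws are the counitality of [Finv]. *)
Lemma twisted_algebraP : is_algebra (yd_alg XF).
Proof.
split=> [b|a|a b c|a|a].
- by apply/lin_linear; rewrite /=; lin.
- by apply/lin_linear; rewrite /=; lin.
- rewrite !twisted_mulE.
  transitivity (\sw_(e1, e2 <- Finv) \sw_(h1, h2 <- cop B e2) \sw_(g1, g2 <- Finv)
      ((e1 ▷ a) *_A (((h1 * g1) ▷ b) *_A ((h2 * g2) ▷ c)))).
    apply: eq_sw => e1 e2; rewrite act_sw mulA_swr sw_exch; apply: eq_sw => g1 g2.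
    by rewrite (ma_mul hA) mulA_swr; apply: eq_sw => h1 h2; rewrite !(ma_actM hA).
  rewrite -(sw_cocycleV hB hF (sc := *:%R) _
     (f := fun x y z => (x ▷ a) *_A ((y ▷ b) *_A (z ▷ c)))); [|by lin..].
  apply: eq_sw => e1 e2; rewrite act_sw mulA_swl sw_exch; apply: eq_sw => g1 g2.
  rewrite (ma_mul hA) mulA_swl; apply: eq_sw => h1 h2.
  by rewrite !(ma_actM hA) (amulA halg).
- rewrite twisted_mulE -[RHS](ma_act1 hA).
  rewrite -(sw_V_coul hB hF (f := (act X)^~ a)); last by lin.
  apply: eq_sw => e1 e2; rewrite (ma_one hA).
  by rewrite (proj2 (_ : lin (fun x => x *_A (e2 ▷ a)))) ?(amul1l halg) //; lin.
- rewrite twisted_mulE -[RHS](ma_act1 hA).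
  rewrite -(sw_V_cour hB hF (f := (act X)^~ a)); last by lin.
  apply: eq_sw => e1 e2; rewrite (ma_one hA).
  by rewrite (proj2 (_ : lin (fun x => (e1 ▷ a) *_A x))) ?(amul1r halg) //; lin.
Qed.

(** The action is unchanged; its compatibility with the new product is [sw_copV], which exchanges
    Delta for Delta^F across [Finv]. *)
Lemma twisted_module_algebraP : is_module_algebra BF XF.
Proof.
split; try by case: hA.
- exact: twisted_algebraP.
- move=> h a b; rewrite [LHS]act_sw /=.
  transitivity (\sw_(h1, h2 <- cop B h) \sw_(e1, e2 <- Finv)
     (((h1 * e1) ▷ a) *_A ((h2 * e2) ▷ b))).
    rewrite sw_exch; apply: eq_sw => e1 e2; rewrite (ma_mul hA).
    by apply: eq_sw => h1 h2; rewrite !(ma_actM hA).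
  rewrite (sw_copV hF (sc := *:%R) (f := fun x y => (x ▷ a) *_A (y ▷ b))); last by lin.
  by rewrite sw_exch; do 2!apply: eq_sw => ? ?; rewrite !(ma_actM hA).
Qed.

Let hBF := twisted_bialgebraP hB hF.
Let hAF := twisted_module_algebraP.
Let halgF := ma_algebra hAF.

Local Notation zeta := (zeta X Finv).

Lemma lin_zeta : lin zeta.
Proof. by rewrite /zeta; lin. Qed.

Lemma zetaE a h : zeta (a ♯ h) = \sw_(e1, e2 <- Finv) ((e1 ▷ a) ♯ (e2 * h)).
Proof. by rewrite /zeta (sw_tens (sc := *:%R)) //; lin. Qed.

Let hS := smash_algP hB hA.
Let hSF := smash_algP hBF hAF.

Lemma zetaM u v : zeta (u *'F v) = zeta u *' zeta v.
Proof.
have lz := lin_zeta.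
move: u; apply: (lin_ext (f := fun u => zeta (u *'F v)) (g := fun u => zeta u *' zeta v));
  [by lin|by lin|move=> a h; move: v].
apply: (lin_ext (f := fun v => zeta (_ *'F v)) (g := fun v => zeta _ *' zeta v));
  [by lin|by lin|].
move=> b g; rewrite (smashE hBF hAF) (lin_sw _ _ lin_zeta).
transitivity (\sw_(h1, h2 <- cop BF h) \sw_(e1, e2 <- Finv) \sw_(d1, d2 <- cop B e2)
   \sw_(c1, c2 <- Finv)
    (((e1 ▷ a) *_A ((d1 * c1) ▷ h1 ▷ b)) ♯ (d2 * c2 * (h2 * g)))).
  apply: eq_sw => h1 h2; rewrite zetaE.
  rewrite -(sw_cocycleV hB hF (sc := *:%R) _
    (f := fun x y z => ((x ▷ a) *_A (y ▷ h1 ▷ b)) ♯ (z * (h2 * g)))); [|by lin..].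
  apply: eq_sw => e1 e2; rewrite twisted_mulE act_sw.
  rewrite (lin_sw (g := fun x => x ♯ _)); last by lin.
  rewrite sw_exch; apply: eq_sw => c1 c2; rewrite (ma_mul hA).
  rewrite (lin_sw (g := fun x => x ♯ _)); last by lin.
  by apply: eq_sw => d1 d2; rewrite !(ma_actM hA).
rewrite !zetaE (smash_swl hB hA) sw_exch; apply: eq_sw => e1 e2.
rewrite (smash_swr hA) sw_exch.
under [RHS]eq_sw => c1 c2.
  rewrite (smashE hB hA) (sw_copM hB (sc := *:%R)); last by lin.
  over.
rewrite [RHS]sw_exch; apply: eq_sw => d1 d2; rewrite sw_exch [RHS]sw_exch.
(* With the cocycle identity spent, what remains is [Delta(h) F^-1 = F^-1 Delta^F(h)] under this
   bilinear map. *)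
have bil : bilS *:%R (fun x y => ((e1 ▷ a) *_A ((d1 * x) ▷ b)) ♯ (d2 * y * g)) by lin.
transitivity (\sw_(c1, c2 <- Finv) \sw_(h1, h2 <- cop BF h)
   (((e1 ▷ a) *_A ((d1 * (c1 * h1)) ▷ b)) ♯ (d2 * (c2 * h2) * g))).
  by do 2!apply: eq_sw => ? ?; rewrite !mulrA !(ma_actM hA).
rewrite -(sw_copV hF bil).
by do 2!apply: eq_sw => ? ?; rewrite !mulrA !(ma_actM hA).
Qed.

Lemma zeta_bij : bijective zeta.
Proof.
(* [zeta] is the action of [Finv] on [A ⊗ H], on A by the action and on H by left multiplication, so
   its inverse is the action of [F]. *)
pose zeta' (u : A ⊗ H) := \sw_(a, h <- u) \sw_(f1, f2 <- F) ((f1 ▷ a) ♯ (f2 * h)).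
have lin' : lin zeta' by rewrite /zeta'; lin.
have E' a h : zeta' (a ♯ h) = \sw_(f1, f2 <- F) ((f1 ▷ a) ♯ (f2 * h)).
  by rewrite /zeta' (sw_tens (sc := *:%R)) //; lin.
exists zeta'.
  apply: (lin_ext (f := fun u => zeta' (zeta u))); [exact: linS_comp lin' lin_zeta|by []|].
  move=> a h; rewrite zetaE (lin_sw _ _ lin') -[in RHS](ma_act1 hA a) -[in RHS](mul1r h).
  rewrite -(sw_FV hF (sc := *:%R) (f := fun x y => (x ▷ a) ♯ (y * h))); last by lin.
  rewrite sw_exch; apply: eq_sw => e1 e2; rewrite E'.
  by apply: eq_sw => f1 f2; rewrite !(ma_actM hA) mulrA.
apply: (lin_ext (f := fun u => zeta (zeta' u))); [exact: linS_comp lin_zeta lin'|by []|].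
move=> a h; rewrite E' (lin_sw _ _ lin_zeta) -[in RHS](ma_act1 hA a) -[in RHS](mul1r h).
rewrite -(sw_VF hF (sc := *:%R) (f := fun x y => (x ▷ a) ♯ (y * h))); last by lin.
rewrite sw_exch; apply: eq_sw => e1 e2; rewrite zetaE.
by apply: eq_sw => f1 f2; rewrite !(ma_actM hA) mulrA.
Qed.

Definition sG a : A ⊗ H := \sw_(e1, e2 <- Finv) ((e1 ▷ a) ♯ e2).

Lemma zeta_s a : zeta (a ♯ 1) = sG a.
Proof. by rewrite zetaE; apply: eq_sw => *; rewrite mulr1. Qed.

Lemma zeta_j h : zeta (1_A ♯ h) = 1_A ♯ h.
Proof.
rewrite zetaE -[in RHS](mul1r h) -(sw_V_coul hB hF (f := fun x => 1_A ♯ (x * h))); last by lin.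
apply: eq_sw => e1 e2; rewrite (ma_one hA).
by rewrite (proj2 (_ : lin (fun x => x ♯ (e2 * h)))) //; lin.
Qed.

End TwistedSmash.

(** * Yetter-Drinfeld module algebras *)

Lemma yd_module_algebra (k : fieldType) (H : algType k) (A : lmodType k)
    (B : coalgebra_on H) (X : yd_data H A) :
  is_yd_module_algebra B X -> is_module_algebra B X.
Proof.
move=> [[al ar a1 aM _ _ _ _] hA am ao _ _].
by split=> // [a|h]; apply/lin_linear.
Qed.

Section YetterDrinfeldSmash.
Variables (k : fieldType) (H : algType k) (A : lmodType k) (B : coalgebra_on H).
Variable X : yd_data H A.
Hypotheses (hB : is_bialgebra B) (hM : is_yd_module B X) (hA : is_module_algebra B X).

Let halg := ma_algebra hA.
Local Notation "a *_A b" := (amul (yd_alg X) a b) (at level 40, left associativity).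
Local Notation "x *' y" := (amul (smash_alg B X) x y) (at level 40, left associativity).
Local Notation "1_A" := (aone (yd_alg X)).
Local Notation "h ▷ a" := (act X h a) (at level 35, right associativity).
Local Notation "a ♯ h" := (tens a h : A ⊗ H) (at level 42, no associativity).
Local Notation t := (coact X).

Lemma sw_coactA (P : zmodType) (sc : k -> P -> P) (f : A -> H -> H -> P) a :
  additiveS sc -> trilS sc f ->
  \sw_(a0, a1 <- t a) \sw_(a00, a01 <- t a0) f a00 a01 a1 =
  \sw_(a0, a1 <- t a) \sw_(a11, a12 <- cop B a1) f a0 a11 a12.
Proof.
move=> scD f3; have := congr1 (sw3 f) (coactA hM a); rewrite !(sw3_sw scD f3).
under eq_sw => x y.
  rewrite (sw3_sw scD f3); under eq_sw => z u do rewrite (sw3_tens3 scD f3).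
  over.
by move=> ->; apply: eq_sw => x y; rewrite (sw3_tens scD f3).
Qed.

Lemma sw_yd_compat (P : zmodType) (sc : k -> P -> P) (f : A -> H -> P) h a :
  additiveS sc -> bilS sc f ->
  \sw_(h1, h2 <- cop B h) \sw_(a0, a1 <- t a) f (h1 ▷ a0) (h2 * a1) =
  \sw_(h1, h2 <- cop B h) \sw_(b0, b1 <- t (h2 ▷ a)) f b0 (b1 * h1).
Proof.
move=> scD fb; have := congr1 (tlift f) (yd_compat hM h a).
by rewrite !(sw_bind fb) => E; etransitivity; [|etransitivity; [exact: E|]];
  apply: eq_sw => *; rewrite (sw_bind fb); apply: eq_sw => *; rewrite (sw_tens fb).
Qed.

Lemma sw_coact_cou (V : lmodType k) (f : A -> V) a : lin f ->
  \sw_(a0, a1 <- t a) (cou B a1 *: f a0) = f a.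
Proof.
move=> fl; rewrite -[in RHS](coact_cou hM a) (lin_sw _ _ fl).
by apply: eq_sw => *; rewrite (proj2 fl).
Qed.

Lemma tens_eta (u : A ⊗ H) : u = \sw_(a, h <- u) (a ♯ h).
Proof. exact: tens_sum. Qed.

Lemma smash_t_j a h : t a *' (1_A ♯ h) = \sw_(a0, a1 <- t a) (a0 ♯ (a1 * h)).
Proof.
rewrite {1}(tens_eta (t a)) (smash_swl hB hA).
by apply: eq_sw => *; rewrite (smash_mul_j hB hA).
Qed.

Lemma smash_s_t a b : (a ♯ 1) *' t b = \sw_(b0, b1 <- t b) ((a *_A b0) ♯ b1).
Proof.
rewrite {1}(tens_eta (t b)) (smash_swr hA).
by apply: eq_sw => *; rewrite (smash_mul_s hB hA).
Qed.

Lemma smash_j_tE h a :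
  (1_A ♯ h) *' t a = \sw_(h1, h2 <- cop B h) \sw_(a0, a1 <- t a) ((h1 ▷ a0) ♯ (h2 * a1)).
Proof.
rewrite {1}(tens_eta (t a)) (smash_swr hA) sw_exch; apply: eq_sw => a0 a1.
by rewrite (smashE hB hA); apply: eq_sw => *; rewrite (amul1l halg).
Qed.

(** The Yetter-Drinfeld condition itself: its left side is the product of [j h] and [t a] in A #
    H. *)
Lemma smash_j_t h a :
  (1_A ♯ h) *' t a = \sw_(h1, h2 <- cop B h) (t (h2 ▷ a) *' (1_A ♯ h1)).
Proof.
rewrite smash_j_tE (sw_yd_compat (sc := *:%R) (f := fun a h => a ♯ h)); [|by lin..].
by apply: eq_sw => *; rewrite smash_t_j.
Qed.

(** Coassociativity of the coaction splits the H-leg of [t b]. This form precedes braided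
    commutativity because that of A_F is extracted from it. *)
Lemma smash_t_mul_coassoc b a h :
  t b *' (a ♯ h) =
  \sw_(b0, b1 <- t b) \sw_(b00, b01 <- t b0) ((b00 *_A (b01 ▷ a)) ♯ (b1 * h)).
Proof.
rewrite {1}(tens_eta (t b)) (smash_swl hB hA).
rewrite (sw_coactA (sc := *:%R) _ (f := fun x y z => (x *_A (y ▷ a)) ♯ (z * h))); [|by lin..].
by apply: eq_sw => *; rewrite (smashE hB hA).
Qed.

Section BraidedCommutative.
Hypothesis hbc : braided_commutative X.

(** Braided commutativity collapses the inner sum of [smash_t_mul_coassoc]. *)
Lemma smash_t_mul b a h :
  t b *' (a ♯ h) = \sw_(b0, b1 <- t b) ((a *_A b0) ♯ (b1 * h)).
Proof.
rewrite smash_t_mul_coassoc; apply: eq_sw => b0 b1.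
by rewrite -(lin_sw (g := fun x => x ♯ (b1 * h))) ?hbc //; lin.
Qed.

Lemma smash_stC a b : (a ♯ 1) *' t b = t b *' (a ♯ 1).
Proof. by rewrite smash_s_t smash_t_mul; apply: eq_sw => *; rewrite mulr1. Qed.

(** The right side is the expression required of the coaction of a product. It is left unfolded
    because for A_F this formula serves to prove that law. *)
Lemma smash_tt a b :
  t b *' t a = \sw_(a0, a1 <- t a) \sw_(b0, b1 <- t b) ((a0 *_A b0) ♯ (b1 * a1)).
Proof.
rewrite {1}(tens_eta (t a)) (smash_swr hA).
by apply: eq_sw => *; rewrite smash_t_mul.
Qed.

End BraidedCommutative.

End YetterDrinfeldSmash.

(** * The twisted coaction *)

Section TwistedYetterDrinfeld.
Variables (k : fieldType) (H : algType k) (A : lmodType k) (B : coalgebra_on H).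
Variables (X : yd_data H A) (F Finv : H ⊗ H).
Hypotheses (hB : is_bialgebra B) (hF : drinfeld_twist B F Finv).
Hypotheses (hX : is_yd_module_algebra B X) (hbc : braided_commutative X).

Local Notation BF := (twisted_bialgebra B F Finv).
Local Notation XF := (twisted_yd X F Finv).

Let hM : is_yd_module B X. Proof. by case: hX. Qed.
Let hA := yd_module_algebra hX.
Let halg := ma_algebra hA.
Let hBF := twisted_bialgebraP hB hF.
Let hAF := twisted_module_algebraP hB hF hA.
Let halgF := ma_algebra hAF.
Let hS := smash_algP hB hA.
Let hSF := smash_algP hBF hAF.

Local Notation "a *_A b" := (amul (yd_alg X) a b) (at level 40, left associativity).
Local Notation "a *_F b" := (amul (yd_alg XF) a b) (at level 40, left associativity).
Local Notation "x *' y" := (amul (smash_alg B X) x y) (at level 40, left associativity).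
Local Notation "x *'F y" := (amul (smash_alg BF XF) x y) (at level 40, left associativity).
Local Notation "1_A" := (aone (yd_alg X)).
Local Notation "h ▷ a" := (act X h a) (at level 35, right associativity).
Local Notation "a ♯ h" := (tens a h : A ⊗ H) (at level 42, no associativity).
Local Notation t := (coact X).
Local Notation tF := (coact XF).
Local Notation zeta := (zeta X Finv).
Local Notation j h := (1_A ♯ h).
Local Notation s a := (a ♯ 1).
Local Notation sG := (sG X Finv).

Definition tG a : A ⊗ H := \sw_(e1, e2 <- Finv) (t (e2 ▷ a) *' j e1).

Let lz : lin zeta := lin_zeta Finv hA.

Lemma zeta_inj : injective zeta.
Proof. exact/bij_inj/(zeta_bij hF hA). Qed.

Lemma sw_tF (P : zmodType) (sc : k -> P -> P) (f : A -> H -> P) a :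
  additiveS sc -> bilS sc f ->
  tlift f (tF a) = 
  \sw_(f1, f2 <- F) \sw_(e1, e2 <- Finv) \sw_(x0, x1 <- t (e2 ▷ a))
    f (f1 ▷ x0) (f2 * x1 * e1).
Proof.
move=> scD fb; rewrite /= (sw_bind fb); apply: eq_sw => f1 f2.
rewrite (sw_bind fb); apply: eq_sw => e1 e2.
by rewrite (sw_bind fb); apply: eq_sw => x0 x1; rewrite (sw_tens fb).
Qed.

(** The [F] in the coaction of A_F acts by the same rule as the [Finv] in [zeta] and cancels against
    it; the remaining [Finv] is that of [tG]. *)
Lemma zeta_t a : zeta (tF a) = tG a.
Proof.
rewrite {1}/zeta (sw_tF (sc := *:%R)); [|by lin..].
rewrite sw_exch; apply: eq_sw => e1 e2; rewrite sw_exch.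
rewrite (smash_t_j hB hA); apply: eq_sw => x0 x1.
rewrite sw_exch -(ma_act1 hA x0) -(mul1r (x1 * e1)).
rewrite -(sw_VF hF (sc := *:%R) (f := fun x y => (x ▷ x0) ♯ (y * (x1 * e1)))); last by lin.
by do 2!apply: eq_sw => ? ?; rewrite (ma_act1 hA) (ma_actM hA) !mulrA.
Qed.

Let jM h g : j h *' j g = j (h * g). Proof. exact: (smash_mul_j hB hA). Qed.

Lemma smash_j_tG h a :
  j h *' tG a = \sw_(h1, h2 <- cop BF h) (tG (h2 ▷ a) *' j h1).
Proof.
rewrite (smash_swr hA).
transitivity (\sw_(h1, h2 <- cop B h) \sw_(e1, e2 <- Finv) (t ((h2 * e2) ▷ a) *' j (h1 * e1))).
  rewrite sw_exch; apply: eq_sw => e1 e2.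
  rewrite (amulA hS) (smash_j_t hB hM hA) (smash_swl hB hA).
  by apply: eq_sw => h1 h2; rewrite -(amulA hS) jM (ma_actM hA).
rewrite (sw_copV hF (sc := *:%R) (f := fun x y => t (y ▷ a) *' j x)); last by lin.
rewrite sw_exch; apply: eq_sw => h1 h2; rewrite (smash_swl hB hA).
by apply: eq_sw => e1 e2; rewrite -(amulA hS) jM (ma_actM hA).
Qed.

(** Both products are brought to words of the form s, t, j: on the left [smash_j_t] moves j past t,
    on the right [smash_j_s] moves j past s and [smash_stC] swaps s and t. The coefficients are then
    the two sides of the cocycle identity of [Finv]. *)
Lemma smash_sGtG a b : sG a *' tG b = tG b *' sG a.
Proof.
transitivity (\sw_(e1, e2 <- Finv) \sw_(h1, h2 <- cop B e2) \sw_(d1, d2 <- Finv)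
   (s (e1 ▷ a) *' t ((h2 * d2) ▷ b) *' j (h1 * d1))).
  rewrite (smash_swl hB hA); apply: eq_sw => e1 e2.
  rewrite (smash_swr hA) sw_exch; apply: eq_sw => d1 d2.
  rewrite (smash_split hB hA) !(amulA hS) -(amulA hS (s _) (j _)) (smash_j_t hB hM hA).
  rewrite (smash_swr hA) (smash_swl hB hA); apply: eq_sw => h1 h2.
  by rewrite -!(amulA hS) jM (ma_actM hA).
rewrite -(sw_cocycleV hB hF (sc := *:%R) _ 
   (f := fun x y z => s (x ▷ a) *' t (z ▷ b) *' j y)); [|by lin..].
rewrite (smash_swl hB hA); apply: eq_sw => e1 e2.
rewrite (smash_swr hA) sw_exch; apply: eq_sw => d1 d2.
rewrite (smash_split hB hA (d1 ▷ a)) !(amulA hS) -(amulA hS (t _) (j _)) (smash_j_s hB hA).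
rewrite (smash_swr hA) (smash_swl hB hA); apply: eq_sw => h1 h2.
rewrite (smash_split hB hA (h1 ▷ _)) (smash_stC hB hM hA hbc).
by rewrite -!(amulA hS) jM (ma_actM hA).
Qed.

(** After [smash_j_t] the two targets are adjacent and merge by [smash_tt] and [coact_mul]. The
    cocycle identity of [Finv] then moves the coproduct to the leg that acts on the product of [a]
    and [b]. *)
Lemma smash_tGtG a b : tG b *' tG a = tG (a *_F b).
Proof.
transitivity (\sw_(e1, e2 <- Finv) \sw_(h1, h2 <- cop B e1) \sw_(d1, d2 <- Finv)
   (t (((h2 * d2) ▷ a) *_A (e2 ▷ b)) *' j (h1 * d1))).
  rewrite (smash_swl hB hA); apply: eq_sw => e1 e2.
  rewrite (smash_swr hA) sw_exch; apply: eq_sw => d1 d2.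
  rewrite !(amulA hS) -(amulA hS (t _) (j _)) (smash_j_t hB hM hA).
  rewrite (smash_swr hA) (smash_swl hB hA); apply: eq_sw => h1 h2.
  rewrite !(amulA hS) (smash_tt hB hM hA hbc) -(coact_mul hX) -!(amulA hS) jM.
  by rewrite (ma_actM hA).
rewrite (sw_cocycleV hB hF (sc := *:%R) _ 
   (f := fun x y z => t ((y ▷ a) *_A (z ▷ b)) *' j x)); [|by lin..].
apply: eq_sw => e1 e2; rewrite (act_sw hA).
rewrite (lin_sw (g := fun x => t x *' j e1)); last by lin.
rewrite sw_exch; apply: eq_sw => d1 d2; rewrite (ma_mul hA).
rewrite (lin_sw (g := fun x => t x *' j e1)); last by lin.
by apply: eq_sw => h1 h2; rewrite !(ma_actM hA).
Qed.

Lemma lin_tF : lin tF.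
Proof. by rewrite /=; lin. Qed.

Lemma twisted_coact_cou a : \sw_(a0, a1 <- tF a) (cou B a1 *: a0) = a.
Proof.
rewrite (sw_tF (sc := *:%R)); [|by lin..].
rewrite -[RHS](ma_act1 hA) -(sw_F_cour hF (f := fun x => x ▷ a)); last by lin.
apply: eq_sw => f1 f2; rewrite -[in RHS](ma_act1 hA a).
rewrite -(sw_V_coul hB hF (f := fun x => f1 ▷ x ▷ a)); last by lin.
rewrite scale_sw; apply: eq_sw => e1 e2.
rewrite -(sw_coact_cou hM (f := fun x => f1 ▷ x)); last by lin.
rewrite !scale_sw; apply: eq_sw => x0 x1.
by rewrite !(couM hB) !scalerA mulrAC.
Qed.

(** * Coassociativity of the twisted coaction *)

Local Notation T x y z := (tens x (tens y z) : A ⊗ (H ⊗ H)).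

Lemma tens_eta3 x (v : H ⊗ H) : tens x v = \sw_(y, z <- v) T x y z.
Proof.
by rewrite {1}[v]tens_sum -(lin_sw (g := fun v => tens x v : A ⊗ (H ⊗ H))) //; lin.
Qed.

(** The inverse twist of the inner coaction meets the twist of the outer one as
    [Finv^1 ⊗ Finv^2 F^1 ⊗ F^2]. The mixed identity separates them at the price of [F^1_(2)] acting
    under a coaction; the Yetter-Drinfeld condition takes it out, and the cocycle identity of [F]
    gives the twists the shape they have in [twisted_coactA_rhs]. *)
Lemma twisted_coactA_lhs a : 
  \sw_(a0, a1 <- tF a) \sw_(a00, a01 <- tF a0) T a00 a01 a1 =
  \sw_(f1, f2 <- F) \sw_(f1', f2' <- F) \sw_(h1, h2 <- cop B f2)
  \sw_(d1, d2 <- Finv) \sw_(l1, l2 <- cop B d2) \sw_(e1, e2 <- Finv)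
  \sw_(x0, x1 <- t (e2 ▷ a)) \sw_(y0, y1 <- t (l1 ▷ x0))
    T (f1 ▷ y0) (f1' * h1 * y1 * d1) (f2' * h2 * (l2 * x1) * e1).
Proof.
have ltF := lin_tF.
rewrite (sw_tF (sc := *:%R)); [|by lin..].
(* [phi] leaves open the three slots filled by [Finv^1], [Finv^2 F^1] and [F^2]. *)
pose phi p q r := \sw_(e1, e2 <- Finv) \sw_(x0, x1 <- t (e2 ▷ a)) \sw_(f1', f2' <- F)
  \sw_(z0, z1 <- t (q ▷ x0)) T (f1' ▷ z0) (f2' * z1 * p) (r * x1 * e1).
transitivity (\sw_(d1, d2 <- Finv) \sw_(f1, f2 <- F) phi d1 (d2 * f1) f2).
  rewrite [RHS]sw_exch; apply: eq_sw => f1 f2; rewrite [RHS]sw_exch; apply: eq_sw => e1 e2.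
  rewrite [RHS]sw_exch; apply: eq_sw => x0 x1; rewrite (sw_tF (sc := *:%R)); [|by lin..].
  rewrite [RHS]sw_exch; apply: eq_sw => f1' f2'; apply: eq_sw => d1 d2.
  by rewrite (ma_actM hA).
rewrite (sw_cocycle_mixed hB hF (sc := *:%R) _ (f := phi)); [|by rewrite /phi; lin..].
(* [psi] leaves open the slots that hold the twists once these stand to the left of everything
   else. *)
pose psi p q r := \sw_(d1, d2 <- Finv) \sw_(l1, l2 <- cop B d2) \sw_(e1, e2 <- Finv)
  \sw_(x0, x1 <- t (e2 ▷ a)) \sw_(y0, y1 <- t (l1 ▷ x0))
    T (p ▷ y0) (q * y1 * d1) (r * (l2 * x1) * e1).
transitivity (\sw_(f1, f2 <- F) \sw_(f1', f2' <- F) \sw_(h1, h2 <- cop B f1)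
   psi (f1' * h1) (f2' * h2) f2); last first.
  have psi3 : trilS *:%R psi by rewrite /psi; lin.
  exact: (sw_cocycle hF (@additiveS_scale _ _) psi3).
apply: eq_sw => f1 f2.
transitivity (\sw_(d1, d2 <- Finv) \sw_(l1, l2 <- cop B d2) \sw_(e1, e2 <- Finv)
  \sw_(x0, x1 <- t (e2 ▷ a)) \sw_(f1', f2' <- F) \sw_(h1, h2 <- cop B f1)
  \sw_(y0, y1 <- t (l1 ▷ x0)) 
    T ((f1' * h1) ▷ y0) (f2' * h2 * y1 * d1) (f2 * (l2 * x1) * e1)); last first.
  rewrite [RHS]sw_pull3; apply: eq_sw => d1 d2.
  rewrite [RHS]sw_pull3; apply: eq_sw => l1 l2.
  rewrite [RHS]sw_pull3; apply: eq_sw => e1 e2.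
  by rewrite [RHS]sw_pull3; apply: eq_sw => x0 x1.
apply: eq_sw => d1 d2; rewrite sw_exch /phi; apply: eq_sw => l1 l2.
rewrite [LHS]sw_exch; apply: eq_sw => e1 e2; rewrite [LHS]sw_exch; apply: eq_sw => x0 x1.
rewrite [LHS]sw_exch; apply: eq_sw => f1' f2'.
(* The mixed identity has put [h1] directly to the right of [z1], as the Yetter-Drinfeld condition
   requires. *)
transitivity (\sw_(h1, h2 <- cop B f1) \sw_(z0, z1 <- t (h2 ▷ l1 ▷ x0))
    T (f1' ▷ z0) (f2' * (z1 * h1) * d1) (f2 * l2 * x1 * e1)).
  by apply: eq_sw => ? ?; rewrite (ma_actM hA); apply: eq_sw => ? ?; rewrite !mulrA.
rewrite -(sw_yd_compat hM (sc := *:%R) _ _ _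
  (f := fun u v => T (f1' ▷ u) (f2' * v * d1) (f2 * l2 * x1 * e1))); [|by lin..].
by do 2!apply: eq_sw => ? ?; rewrite (ma_actM hA) !mulrA.
Qed.

Lemma twisted_coactA_rhs a : 
  \sw_(a0, a1 <- tF a) (tens a0 (cop BF a1) : A ⊗ (H ⊗ H)) =
  \sw_(f1, f2 <- F) \sw_(f1', f2' <- F) \sw_(h1, h2 <- cop B f2)
  \sw_(d1, d2 <- Finv) \sw_(l1, l2 <- cop B d1) \sw_(e1, e2 <- Finv)
  \sw_(x0, x1 <- t (d2 ▷ a)) \sw_(w1, w2 <- cop B x1)
    T (f1 ▷ x0) (f1' * h1 * w1 * (l1 * e1)) (f2' * h2 * w2 * (l2 * e2)).
Proof.
rewrite (sw_tF (sc := *:%R)); [|by lin..]; apply: eq_sw => f1 f2.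
rewrite [RHS]sw_pull3; apply: eq_sw => d1 d2.
transitivity (\sw_(x0, x1 <- t (d2 ▷ a)) \sw_(f1', f2' <- F) \sw_(h1, h2 <- cop B f2)
  \sw_(w1, w2 <- cop B x1) \sw_(l1, l2 <- cop B d1) \sw_(e1, e2 <- Finv)
    T (f1 ▷ x0) (f1' * h1 * w1 * (l1 * e1)) (f2' * h2 * w2 * (l2 * e2))); last first.
  rewrite [LHS]sw_exch; apply: eq_sw => f1' f2'; rewrite [LHS]sw_exch; apply: eq_sw => h1 h2.
  by rewrite [LHS]sw_pull3; apply: eq_sw => l1 l2; rewrite [LHS]sw_pull3.
apply: eq_sw => x0 x1; rewrite tens_eta3 /= (sw_tmul (sc := *:%R)); last by lin.
rewrite (sw_tmul (sc := *:%R)); last by lin.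
apply: eq_sw => f1' f2'; rewrite (sw_copM hB (sc := *:%R)); last by lin.
rewrite (sw_copM hB (sc := *:%R)); last by lin.
by do 4!apply: eq_sw => ? ?; rewrite !mulrA.
Qed.

(** The factors of [F] agree term by term and can be frozen. The rest is an identity for [Finv]
    alone, obtained from the Yetter-Drinfeld condition, the coassociativity of the untwisted
    coaction and the cocycle identity of [Finv]. *)
Lemma twisted_coactA a : 
  \sw_(a0, a1 <- tF a) \sw_(a00, a01 <- tF a0) T a00 a01 a1 =
  \sw_(a0, a1 <- tF a) (tens a0 (cop BF a1) : A ⊗ (H ⊗ H)).
Proof.
rewrite twisted_coactA_lhs twisted_coactA_rhs.
apply: eq_sw => p f2; apply: eq_sw => f1' f2'; apply: eq_sw => h1 h2.
move: (f1' * h1) (f2' * h2) => q r.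
(* [kappa] leaves open the three slots that are filled by the inverse twists on both sides. *)
pose kappa u v w := \sw_(x0, x1 <- t (w ▷ a)) \sw_(w1, w2 <- cop B x1)
  T (p ▷ x0) (q * w1 * u) (r * w2 * v).
have kappa3 : trilS *:%R kappa by rewrite /kappa; lin.
transitivity (\sw_(d1, d2 <- Finv) \sw_(l1, l2 <- cop B d2) \sw_(e1, e2 <- Finv)
   kappa d1 (l1 * e1) (l2 * e2)); last first.
  by rewrite -(sw_cocycleV hB hF (@additiveS_scale _ _) kappa3).
apply: eq_sw => d1 d2; rewrite sw_exch [RHS]sw_exch; apply: eq_sw => e1 e2.
transitivity (\sw_(l1, l2 <- cop B d2) \sw_(x0, x1 <- t (l2 ▷ e2 ▷ a))
   \sw_(y0, y1 <- t x0) T (p ▷ y0) (q * y1 * d1) (r * (x1 * l1) * e1)).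
  by rewrite -(sw_yd_compat hM (sc := *:%R) _ _ _ (f := fun u v =>
    \sw_(y0, y1 <- t u) T (p ▷ y0) (q * y1 * d1) (r * v * e1))); [|by lin..].
apply: eq_sw => l1 l2; rewrite /kappa (ma_actM hA).
rewrite (sw_coactA hM (sc := *:%R) _ (f := fun y0 y1 x1 =>
  T (p ▷ y0) (q * y1 * d1) (r * (x1 * l1) * e1))); [|by lin..].
by do 2!apply: eq_sw => ? ?; rewrite !mulrA.
Qed.

Lemma twisted_yd_moduleP : is_yd_module BF XF.
Proof.
split.
- by move=> a; apply/lin_linear/(ma_linl hA).
- by move=> a; apply/lin_linear/(ma_linr hA).
- exact: ma_act1 hA.
- exact: ma_actM hA.
- exact/lin_linear/lin_tF.
- exact: twisted_coactA.
- exact: twisted_coact_cou.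
- move=> h a; rewrite -(smash_j_tE hBF hAF).
  transitivity (\sw_(h1, h2 <- cop BF h) (tF (h2 ▷ a) *'F j h1)); last first.
    by apply: eq_sw => h1 h2; rewrite (smash_t_j hBF hAF).
  apply: zeta_inj; rewrite (zetaM hB hF hA) zeta_t (zeta_j hB hF hA) smash_j_tG.
  rewrite (lin_sw _ _ lz); apply: eq_sw => h1 h2.
  by rewrite (zetaM hB hF hA) zeta_t (zeta_j hB hF hA).
Qed.

Let hMF := twisted_yd_moduleP.

Lemma twisted_braided_commutative : braided_commutative XF.
Proof.
move=> a b; pose eps (u : A ⊗ H) := \sw_(x, h <- u) (cou B h *: x).
have leps : lin eps by rewrite /eps; lin.
have epsE x h : eps (x ♯ h) = cou B h *: x.
  by rewrite /eps (sw_tens (sc := *:%R)) //; lin.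
(* Commutation of source and target, hit with the counit of [H]. *)
have : eps (s a *'F tF b) = eps (tF b *'F s a).
  congr eps; apply: zeta_inj.
  by rewrite !(zetaM hB hF hA) zeta_t !(zeta_s Finv hA) smash_sGtG.
rewrite (smash_s_t hBF hAF) (smash_t_mul_coassoc hBF hMF hAF) !(lin_sw _ _ leps) => E.
symmetry; etransitivity; [|etransitivity; [exact: E|]].
  rewrite -[in LHS](twisted_coact_cou b) (lin_sw (g := amul (yd_alg XF) a)); last by lin.
  apply: eq_sw => b0 b1; rewrite epsE (proj2 (_ : lin (amul (yd_alg XF) a))) //; lin.
(* On this side the counit falls on the outer leg of the iterated coaction and is absorbed by the
   counit law, which leaves [g b]. *)
pose g b := \sw_(b0, b1 <- tF b) (b0 *_F (b1 ▷ a)).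
have ltF := lin_tF; have lg : lin g by rewrite /g; lin.
rewrite -/(g b) -(sw_coact_cou hMF b lg); apply: eq_sw => b0 b1.
rewrite /g scale_sw (lin_sw _ _ leps); apply: eq_sw => b00 b01.
by rewrite epsE mulr1.
Qed.

Lemma twisted_yd_module_algebraP : is_yd_module_algebra BF XF.
Proof.
split.
- exact: hMF.
- exact: halgF.
- exact: ma_mul hAF.
- exact: ma_one hAF.
- move=> a b; rewrite -(smash_tt hBF hMF hAF twisted_braided_commutative).
  by apply: zeta_inj; rewrite (zetaM hB hF hA) !zeta_t smash_tGtG.
- apply: zeta_inj; rewrite zeta_t (zeta_j hB hF hA).
  have -> : j 1 = t 1_A *' j 1 by rewrite (coact_one hX) jM mul1r.
  rewrite -(sw_V_cour hB hF (f := fun x => t 1_A *' j x)); last by lin.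
  apply: eq_sw => e1 e2; rewrite (ma_one hA).
  by rewrite (proj2 (_ : lin (fun x => t x *' j e1))) //; lin.
Qed.

End TwistedYetterDrinfeld.

(** * Tensor products over the base of a bialgebroid *)

Section BimoduleTensor.
Variables (k : fieldType) (A M : lmodType k) (al : algebra_on M) (s t : A -> M) (one : A).
Hypotheses (hal : is_algebra al) (ls : lin s) (lt : lin t).
Hypotheses (s1 : s one = aone al) (t1 : t one = aone al).

Local Notation T2 := (bialgebroid_tens (amul al) s t).
Local Notation "x *' y" := (amul al x y) (at level 40, left associativity).

Definition bscale (c : k) (u : T2) : T2 := \sw_(x, y <- u) (tens (c *: x) y : T2).

Let bt := tens_balanced (fun a h => t a *' h) (fun a h => s a *' h).

Lemma btens_bal a x y : tens (t a *' x) y = tens x (s a *' y) :> T2.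
Proof. by case: bt. Qed.

Lemma scale_mull c x y : (c *: x) *' y = c *: (x *' y).
Proof. by rewrite (proj2 (_ : lin (fun x => x *' y))) //; lin. Qed.

Lemma scale_mulr c x y : x *' (c *: y) = c *: (x *' y).
Proof. by rewrite (proj2 (_ : lin (fun y => x *' y))) //; lin. Qed.

Lemma tgt_scale c x : t (c *: one) *' x = c *: x.
Proof. by rewrite (proj2 lt) t1 scale_mull (amul1l hal). Qed.

Lemma src_scale c x : s (c *: one) *' x = c *: x.
Proof. by rewrite (proj2 ls) s1 scale_mull (amul1l hal). Qed.

(** The tensor product is balanced over A only; a scalar crosses it as the element [c *: one] of
    A. *)
Lemma btens_scaler c x y : tens x (c *: y) = tens (c *: x) y :> T2.
Proof. by rewrite -src_scale -btens_bal tgt_scale. Qed.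

Lemma bscale_balanced c :
  balanced (fun a h => t a *' h) (fun a h => s a *' h) (fun x y => tens (c *: x) y : T2).
Proof.
case: bt => tDl tDr tb; split=> [x x' y|x y y'|a x y].
- by rewrite scalerDr tDl.
- by rewrite tDr.
- by rewrite -scale_mulr tb.
Qed.

Lemma bscaleE c x y : bscale c (tens x y) = tens (c *: x) y.
Proof. exact: tlift_tens (bscale_balanced c). Qed.

Lemma additiveS_bscale : additiveS bscale.
Proof. by move=> c u v; apply: tliftD (bscale_balanced c). Qed.

Lemma linS_btensl y : linS bscale (fun x => tens x y : T2).
Proof. by case: bt => tDl _ _; split=> [x x'|c x]; rewrite ?bscaleE. Qed.

Lemma linS_btensr x : linS bscale (fun y => tens x y : T2).
Proof. by case: bt => _ tDr _; split=> [y y'|c y]; rewrite ?bscaleE ?btens_scaler. Qed.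

End BimoduleTensor.

(** The axioms without comultiplication and counit. They suffice to define actions and scalings on
    the tensor products over A, which the balancedness proofs need while the other axioms are still
    being established. *)
Record pre_bialgebroid (k : fieldType) (A M : lmodType k) (B : bialgebroid A M) : Prop := {
  pre_base : is_algebra (base_alg B);
  pre_total : is_algebra (total_alg B);
  pre_src_lin : lin (src B);
  pre_src1 : src B (aone (base_alg B)) = aone (total_alg B);
  pre_srcM : forall a b,
    src B (amul (base_alg B) a b) = amul (total_alg B) (src B a) (src B b);
  pre_tgt_lin : lin (tgt B);
  pre_tgt1 : tgt B (aone (base_alg B)) = aone (total_alg B);
  pre_tgtM : forall a b,
    tgt B (amul (base_alg B) a b) = amul (total_alg B) (tgt B b) (tgt B a);
  pre_stC : forall a b,
    amul (total_alg B) (src B a) (tgt B b) = amul (total_alg B) (tgt B b) (src B a) }.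

(** * Balanced maps on tensor products over A *)

Section Bialgebroid.
Variables (k : fieldType) (A M : lmodType k) (B : bialgebroid A M).
Hypothesis hB : pre_bialgebroid B.

Local Notation "x *' y" := (amul (total_alg B) x y) (at level 40, left associativity).
Local Notation one := (aone (total_alg B)).
Local Notation "1_A" := (aone (base_alg B)).
Local Notation s := (src B).
Local Notation t := (tgt B).
Local Notation Delta := (comul B).
Local Notation T2 := (tens2 B).
Local Notation T3 := (tens3 B).

Let hal := pre_total hB.
Let mA := amulA hal.
Let bt := tens_balanced (fun a h => t a *' h) (fun a h => s a *' h).

Definition sc2 : k -> T2 -> T2 := @bscale k A M (total_alg B) s t.

Lemma sc2D : additiveS sc2.
Proof. exact: additiveS_bscale. Qed.

Lemma sc2E c x y : sc2 c (tens x y) = tens (c *: x) y.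
Proof. exact: bscaleE. Qed.

Lemma linS_tens2l y : linS sc2 (fun x => tens x y : T2).
Proof. exact: linS_btensl. Qed.

Lemma linS_tens2r x : linS sc2 (fun y => tens x y : T2).
Proof.
exact: (linS_btensr hal (pre_src_lin hB) (pre_tgt_lin hB) (pre_src1 hB) (pre_tgt1 hB)).
Qed.

Lemma tens2_bal a x y : tens (t a *' x) y = tens x (s a *' y) :> T2.
Proof. exact: btens_bal. Qed.

Lemma tens2_balanced (P : zmodType) (f : M -> M -> P) :
  (forall y, {morph (fun x => f x y) : x x' / x + x'}) ->
  (forall x, {morph f x : y y' / y + y'}) ->
  (forall a x y, f (t a *' x) y = f x (s a *' y)) ->
  balanced (fun a h => t a *' h) (fun a h => s a *' h) f.
Proof. by move=> fl fr fb; split=> [x x' y|x y y'|a x y]; rewrite ?fl ?fr ?fb. Qed.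

Lemma mul2_balanced y1 y2 :
  balanced (fun a h => t a *' h) (fun a h => s a *' h)
    (fun x1 x2 => tens (x1 *' y1) (x2 *' y2) : T2).
Proof.
have l1 := linS_tens2l; have l2 := linS_tens2r.
apply: tens2_balanced => [y|x|a x y].
- by apply: (linSD (sc := sc2)); lin.
- by apply: (linSD (sc := sc2)); lin.
- by rewrite -!mA tens2_bal.
Qed.

Lemma bimod2_balanced a a' :
  balanced (fun a h => t a *' h) (fun a h => s a *' h)
    (fun x y => tens (s a *' x) (t a' *' y) : T2).
Proof.
have l1 := linS_tens2l; have l2 := linS_tens2r.
apply: tens2_balanced => [y|x|b x y].
- by apply: (linSD (sc := sc2)); lin.
- by apply: (linSD (sc := sc2)); lin.
- by rewrite !mA (pre_stC hB) -(pre_stC hB b) -!mA tens2_bal.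
Qed.

Lemma bimod2E a a' x y : bimod2 a a' (tens x y : T2) = tens (s a *' x) (t a' *' y).
Proof. exact: tlift_tens (bimod2_balanced a a'). Qed.

Lemma bimod2D a a' : {morph bimod2 (B := B) a a' : u v / u + v}.
Proof. by move=> u v; apply: tliftD (bimod2_balanced a a'). Qed.

(** Expressed through the bimodule structure, a scalar can cross the outer tensor sign of [T3],
    which is balanced over [bimod2 a 1_A]. *)
Lemma sc2_bimod2 c u : sc2 c u = bimod2 (c *: 1_A) 1_A u.
Proof.
move: u; apply: tens_ext; [exact: sc2D|exact: bimod2D|move=> x y].
rewrite sc2E bimod2E (pre_tgt1 hB) (amul1l hal).
by rewrite (src_scale hal (pre_src_lin hB) (pre_src1 hB)).
Qed.

Let bt3 := tens_balanced (fun a h => t a *' h) (fun a (u : T2) => bimod2 a 1_A u).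

Lemma tens3_bal a x (u : T2) : tens (t a *' x) u = tens x (bimod2 a 1_A u) :> T3.
Proof. by case: bt3. Qed.

Definition sc3 (c : k) (w : T3) : T3 := \sw_(x, u <- w) (tens (c *: x) u : T3).

Lemma sc3_balanced c :
  balanced (fun a h => t a *' h) (fun a (u : T2) => bimod2 a 1_A u)
    (fun x u => tens (c *: x) u : T3).
Proof.
case: bt3 => tDl tDr tb; split=> [x x' y|x y y'|a x y].
- by rewrite scalerDr tDl.
- by rewrite tDr.
- by rewrite -(scale_mulr hal) tb.
Qed.

Lemma sc3E c x u : sc3 c (tens x u) = tens (c *: x) u.
Proof. exact: tlift_tens (sc3_balanced c). Qed.

Lemma sc3D : additiveS sc3.
Proof. by move=> c u v; apply: tliftD (sc3_balanced c). Qed.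

Lemma linS_tens3l (V : lmodType k) (f : V -> M) u : lin f -> linS sc3 (fun x => tens (f x) u : T3).
Proof.
apply: (linS_comp (g := fun x => tens x u : T3)).
by case: bt3 => tDl _ _; split=> [x x'|c x]; rewrite ?sc3E.
Qed.

Lemma linS_tens3r (V : lmodType k) (f : V -> T2) x :
  linS sc2 f -> linS sc3 (fun y => tens x (f y) : T3).
Proof.
case: bt3 => _ tDr _ [fD fZ]; split=> [y y'|c y]; first by rewrite fD tDr.
by rewrite fZ sc2_bimod2 -tens3_bal (tgt_scale hal (pre_tgt_lin hB) (pre_tgt1 hB)) sc3E.
Qed.

Lemma tens3D x : {morph (fun u => tens x u : T3) : u v / u + v}.
Proof. by case: bt3 => _ tDr _ u v; rewrite tDr. Qed.

Lemma tens3_balanced y :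
  balanced (fun a h => t a *' h) (fun a h => s a *' h)
    (fun x1 x2 => tens x1 (tens x2 y : T2) : T3).
Proof.
case: bt bt3 => [tDl tDr tb] [tDl3 tDr3 tb3]; split=> [x x' z|x z z'|a x z].
- by rewrite tDl3.
- by rewrite tDl tDr3.
- by rewrite tens3_bal bimod2E (pre_tgt1 hB) (amul1l hal).
Qed.

Section Comultiplication.
Variable D : M -> T2.
Hypothesis DD : {morph D : x y / x + y}.
Hypothesis D_bimod : forall a a' h, D (s a *' (t a' *' h)) = bimod2 a a' (D h).

Let D_src a x : D (s a *' x) = bimod2 a 1_A (D x).
Proof. by rewrite -D_bimod (pre_tgt1 hB) (amul1l hal). Qed.

Let D_tgt a x : D (t a *' x) = bimod2 1_A a (D x).
Proof. by rewrite -D_bimod (pre_src1 hB) (amul1l hal). Qed.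

(** Stated for any additive bimodule map [D]: besides the comultiplication it is applied to
    [u ↦ Delta(u) G] in the cocycle condition. *)
Lemma comul_l_balanced :
  balanced (fun a h => t a *' h) (fun a h => s a *' h)
    (fun x y => \sw_(x1, x2 <- D x) (tens x1 (tens x2 y : T2) : T3)).
Proof.
case: bt bt3 => [tDl tDr tb] [tDl3 tDr3 tb3].
apply: tens2_balanced => [y x x'|x y y'|a x y].
- by rewrite DD tliftD //; apply: tens3_balanced.
- by rewrite -swD; apply: eq_sw => x1 x2; rewrite tDr tDr3.
- rewrite D_tgt (sw_sw _ _ (tens3_balanced y)); apply: eq_sw => x1 x2.
  rewrite (tlift_tens _ _ (tens3_balanced y)) (pre_src1 hB) (amul1l hal).
  by rewrite tens2_bal.
Qed.

Lemma comul_r_balanced :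
  balanced (fun a h => t a *' h) (fun a h => s a *' h)
    (fun x y => tens x (D y) : T3).
Proof.
case: bt3 => [tDl3 tDr3 tb3]; apply: tens2_balanced => [y x x'|x y y'|a x y].
- by rewrite tDl3.
- by rewrite DD tDr3.
- by rewrite D_src tb3.
Qed.

End Comultiplication.

Section Counit.
Variable e : M -> A.
Hypotheses (le : lin e) (e_src : forall a x, e (s a *' x) = amul (base_alg B) a (e x)).
Hypothesis e_tgt : forall a x, e (t a *' x) = amul (base_alg B) (e x) a.

Let ls := pre_src_lin hB.
Let lt := pre_tgt_lin hB.

Lemma counitl_balanced :
  balanced (fun a h => t a *' h) (fun a h => s a *' h) (fun x y => s (e x) *' y).
Proof.
apply: tens2_balanced => [y|x|a x y].
- by apply: (linSD (sc := *:%R)); lin.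
- by apply: (linSD (sc := *:%R)); lin.
- by rewrite e_tgt mA (pre_srcM hB).
Qed.

Lemma counitr_balanced :
  balanced (fun a h => t a *' h) (fun a h => s a *' h) (fun x y => t (e y) *' x).
Proof.
apply: tens2_balanced => [y|x|a x y].
- by apply: (linSD (sc := *:%R)); lin.
- by apply: (linSD (sc := *:%R)); lin.
- by rewrite e_src mA (pre_tgtM hB).
Qed.

End Counit.

Let l1 := linS_tens2l.
Let l2 := linS_tens2r.
Let sD := sc2D.

Lemma takeuchi_l_balanced a :
  balanced (fun a h => t a *' h) (fun a h => s a *' h)
    (fun x y => tens (x *' t a) y : T2).
Proof.
case: bt => [tDl tDr tb]; apply: tens2_balanced => [y|x y y'|b x y].
- by apply: (linSD (sc := sc2)); lin.
- by rewrite tDr.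
- by rewrite -mA tens2_bal.
Qed.

Lemma takeuchi_r_balanced a :
  balanced (fun a h => t a *' h) (fun a h => s a *' h)
    (fun x y => tens x (y *' s a) : T2).
Proof.
case: bt => [tDl tDr tb]; apply: tens2_balanced => [y x x'|x|b x y].
- by rewrite tDl.
- by apply: (linSD (sc := sc2)); lin.
- by rewrite -mA tens2_bal.
Qed.

(** The Takeuchi condition, multiplied on the right by [tens x y], is exactly the balancing over A
    in the second factor. *)
Lemma mul2_takeuchi_balanced (u : T2) : takeuchi u ->
  balanced (fun a h => t a *' h) (fun a h => s a *' h)
    (fun y1 y2 => \sw_(x1, x2 <- u) (tens (x1 *' y1) (x2 *' y2) : T2)).
Proof.
move=> tu; apply: tens2_balanced => [y|x|a x y].
- by apply: (linSD (sc := sc2)); lin.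
- by apply: (linSD (sc := sc2)); lin.
- have := congr1 (tlift (fun x1 x2 => tens (x1 *' x) (x2 *' y) : T2)) (tu a).
  rewrite !(sw_sw _ _ (mul2_balanced x y)) => E.
  etransitivity; [|etransitivity; [exact: E|]]; apply: eq_sw => x1 x2;
    by rewrite (tlift_tens _ _ (mul2_balanced x y)) mA.
Qed.

Lemma mul2E (u : T2) y1 y2 : takeuchi u ->
  mul2 u (tens y1 y2) = \sw_(x1, x2 <- u) (tens (x1 *' y1) (x2 *' y2) : T2).
Proof.
by move=> tu; rewrite /mul2 sw_exch (tlift_tens _ _ (mul2_takeuchi_balanced tu)).
Qed.

Lemma mul2Dr (u : T2) : takeuchi u -> {morph mul2 u : v w / v + w}.
Proof.
move=> tu v w; rewrite /mul2 sw_exch (tliftD _ _ (mul2_takeuchi_balanced tu)).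
by congr (_ + _); rewrite sw_exch.
Qed.

(** In the first factor A acts from the far left, so the balancing passes through each term of
    [v]. *)
Lemma mul2l_balanced (v : T2) :
  balanced (fun a h => t a *' h) (fun a h => s a *' h)
    (fun x1 x2 => \sw_(y1, y2 <- v) (tens (x1 *' y1) (x2 *' y2) : T2)).
Proof.
apply: tens2_balanced => [y|x|a x y].
- by apply: (linSD (sc := sc2)); lin.
- by apply: (linSD (sc := sc2)); lin.
- by apply: eq_sw => y1 y2; rewrite -!mA tens2_bal.
Qed.

Lemma mul2_bimod2 a a' (u v : T2) : mul2 (bimod2 a a' u) v = bimod2 a a' (mul2 u v).
Proof.
move: u; apply: (tens_ext (f := fun u : T2 => mul2 (bimod2 a a' u) v)
  (g := fun u => bimod2 a a' (mul2 u v))).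
- by move=> x y; rewrite bimod2D; apply: (tliftD _ _ (mul2l_balanced v)).
- by move=> x y; rewrite -bimod2D; congr bimod2; apply: (tliftD _ _ (mul2l_balanced v)).
move=> x y; rewrite bimod2E /mul2 !(tlift_tens _ _ (mul2l_balanced v)).
rewrite (sw_morph _ _ (@bimod2D a a')); apply: eq_sw => y1 y2.
by rewrite bimod2E !mA.
Qed.

Lemma mul2Dl (v : T2) : {morph (fun u => mul2 u v) : u w / u + w}.
Proof. by move=> u w; apply: (tliftD _ _ (mul2l_balanced v)). Qed.

End Bialgebroid.

(** * The scalar extension bialgebroid *)

Section ScalarExtension.
Variables (k : fieldType) (H : algType k) (A : lmodType k) (B : coalgebra_on H).
Variable X : yd_data H A.
Hypotheses (hB : is_bialgebra B) (hX : is_yd_module_algebra B X).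
Hypothesis hbc : braided_commutative X.

Let hM : is_yd_module B X. Proof. by case: hX. Qed.
Let hA := yd_module_algebra hX.
Let halg := ma_algebra hA.
Let hS := smash_algP hB hA.
Local Notation E := (scalar_extension B X).
Local Notation "a *_A b" := (amul (yd_alg X) a b) (at level 40, left associativity).
Local Notation "x *' y" := (amul (smash_alg B X) x y) (at level 40, left associativity).
Local Notation "1_A" := (aone (yd_alg X)).
Local Notation "h ▷ a" := (act X h a) (at level 35, right associativity).
Local Notation "a ♯ h" := (tens a h : A ⊗ H) (at level 42, no associativity).
Local Notation t := (coact X).
Local Notation s a := (a ♯ 1).
Local Notation j h := (1_A ♯ h).
Local Notation Delta := (comul E).
Local Notation eps := (counit E).
Local Notation T2 := (tens2 E).
Local Notation T3 := (tens3 E).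
Local Notation "x ⊗A y" := (tens x y : T2) (at level 43, no associativity).

Let bsc : k -> T2 -> T2 := bscale (al := smash_alg B X) (s := @smash_src k H A) (t := smash_tgt X).

Let lsrc : lin (@smash_src k H A). Proof. by rewrite /smash_src; lin. Qed.
Let ltgt : lin (smash_tgt X). Proof. by rewrite /smash_tgt; lin. Qed.
Let tgt1 : smash_tgt X 1_A = aone (smash_alg B X).
Proof. exact: coact_one hX. Qed.
Let bl : forall y, linS bsc (fun x => x ⊗A y). Proof. exact: linS_btensl. Qed.
Let br : forall x, linS bsc (fun y => x ⊗A y).
Proof. exact: (linS_btensr hS lsrc ltgt (erefl _) tgt1). Qed.
Let bD : additiveS bsc. Proof. exact: additiveS_bscale. Qed.

Lemma lin_counit : lin eps. Proof. by rewrite /=; lin. Qed.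
Lemma counitE a h : eps (a ♯ h) = cou B h *: a.
Proof. by rewrite /= (sw_tens (sc := *:%R)) //; lin. Qed.

Lemma linS_comul : linS bsc Delta. Proof. by rewrite /=; lin. Qed.
Lemma comulE a h : Delta (a ♯ h) = \sw_(h1, h2 <- cop B h) ((a ♯ h1) ⊗A (j h2)).
Proof. by rewrite /= (sw_tens (sc := bsc)) //; lin. Qed.

Let comul_sw I (M N : zmodType) (r : I -> M -> M) (l : I -> N -> N)
    (f : M -> N -> A ⊗ H) (u : btens r l) :
  Delta (tlift f u) = \sw_(x, y <- u) Delta (f x y).
Proof. exact: (sw_morph _ _ (linSD linS_comul)). Qed.

Let tbal a x y : (t a *' x) ⊗A y = x ⊗A (s a *' y).
Proof. exact: btens_bal. Qed.

Lemma smash_t_split a h : t a *' j h = \sw_(a0, a1 <- t a) (s a0 *' j (a1 * h)).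
Proof.
rewrite (smash_t_j hB hA); apply: eq_sw => a0 a1; exact: smash_split hB hA _ _.
Qed.

Lemma src_mul a b h : s a *' (b ♯ h) = (a *_A b) ♯ h.
Proof. exact: smash_mul_s hB hA _ _ _. Qed.

Lemma src_tgt_mul a a' b h :
  s a *' (t a' *' (b ♯ h)) = \sw_(x, y <- t a') (((a *_A b) *_A x) ♯ (y * h)).
Proof.
rewrite (smash_t_mul hB hM hA hbc) (smash_swr hA); apply: eq_sw => x y.
by rewrite src_mul (amulA halg).
Qed.

Let sS a b : s (a *_A b) = s a *' s b. Proof. by rewrite src_mul. Qed.
Let stC a b : s a *' t b = t b *' s a := smash_stC hB hM hA hbc a b.

Lemma ext_pre_bialgebroid : pre_bialgebroid E.
Proof.
split; [exact: halg|exact: hS|exact: lsrc|by []|exact: sS|exact: ltgt|exact: tgt1| |exact: stC].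
by move=> a b; rewrite [LHS](coact_mul hX); apply/esym/(smash_tt hB hM hA hbc).
Qed.

Let hP := ext_pre_bialgebroid.

(** On the right side the target on the second leg is split into a source times an element of H. The
    source crosses the tensor sign and becomes a target on the first leg, which iterates the
    coaction; coassociativity matches this with the coproduct of the H-leg on the left side. *)
Lemma ext_comul_bimod a a' h : Delta (s a *' (t a' *' h)) = bimod2 a a' (Delta h).
Proof.
have bim := bimod2_balanced hP a a'; move: h; pose f u := Delta (s a *' (t a' *' u)).
apply: (tens_ext (f := f) (g := fun u => bimod2 (B := E) a a' (Delta u))).
- have lf : lin (fun u => s a *' (t a' *' u)) by lin.
  exact: (linSD (linS_comp linS_comul lf)).
- by move=> u v; rewrite (linSD linS_comul) [LHS](tliftD _ _ bim).
move=> b h; rewrite /f src_tgt_mul comul_sw comulE.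
transitivity (\sw_(x, y <- t a') \sw_(y1, y2 <- cop B y) \sw_(h1, h2 <- cop B h)
   ((((a *_A b) *_A x) ♯ (y1 * h1)) ⊗A (j (y2 * h2)))).
  by apply: eq_sw => x y; rewrite comulE (sw_copM hB (sc := bsc)) //; lin.
rewrite -(sw_coactA hM _ bD (f := fun x y1 y2 => \sw_(h1, h2 <- cop B h)
   ((((a *_A b) *_A x) ♯ (y1 * h1)) ⊗A (j (y2 * h2))))); last by lin.
rewrite /bimod2 (sw_sw _ _ bim) [RHS](_ : _ = \sw_(h1, h2 <- cop B h)
   ((s a *' (b ♯ h1)) ⊗A (t a' *' j h2))); last first.
  by apply: eq_sw => h1 h2; rewrite (tlift_tens _ _ bim).
rewrite [RHS](_ : _ = \sw_(h1, h2 <- cop B h) \sw_(x, y <- t a')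
   ((t x *' ((a *_A b) ♯ h1)) ⊗A (j (y * h2)))); last first.
  apply: eq_sw => h1 h2; rewrite smash_t_split (sw_morph _ _ (linSD (br _))).
  by apply: eq_sw => x y; rewrite -tbal src_mul.
rewrite sw_exch; apply: eq_sw => x y; rewrite sw_exch; apply: eq_sw => h1 h2.
rewrite (smash_t_mul hB hM hA hbc).
by rewrite (sw_morph _ _ (linSD (bl _))).
Qed.

Let lc := lin_counit.
Let ld := linS_comul.

Let counit_sw I (M N : zmodType) (r : I -> M -> M) (l : I -> N -> N)
    (f : M -> N -> A ⊗ H) (u : btens r l) :
  eps (tlift f u) = \sw_(x, y <- u) eps (f x y).
Proof. exact: lin_sw lin_counit. Qed.

Lemma ext_counit_bimod a a' u : eps (s a *' (t a' *' u)) = a *_A eps u *_A a'.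
Proof.
move: u; apply: (lin_ext (f := fun u => eps (s a *' (t a' *' u)))
  (g := fun u => a *_A eps u *_A a')); [by lin|by lin|move=> b h].
rewrite src_tgt_mul counit_sw counitE.
pose g x := cou B h *: (a *_A b *_A x); have lg : lin g by rewrite /g; lin.
transitivity (g a').
  rewrite -(sw_coact_cou hM a' lg); apply: eq_sw => x y.
  by rewrite counitE (couM hB) scalerA.
by rewrite /g (scale_mulr halg) (scale_mull halg).
Qed.

Lemma ext_counit_src a u : eps (s a *' u) = a *_A eps u.
Proof.
have := ext_counit_bimod a 1_A u.
by rewrite [t 1_A](coact_one hX) (amul1l hS) (amul1r halg).
Qed.

Lemma ext_counit_tgt a u : eps (t a *' u) = eps u *_A a.
Proof.
have := ext_counit_bimod 1_A a u.
by rewrite [s 1_A](_ : _ = aone (smash_alg B X)) // (amul1l hS) (amul1l halg).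
Qed.

Let counitl_bal := counitl_balanced hP lc ext_counit_tgt.
Let counitr_bal := counitr_balanced hP lc ext_counit_src.

(** By the Yetter-Drinfeld condition [t a] moves left past [j h_(1)] as [t (h_(2) ▷ a)], then past
    the source, and crosses the tensor sign as a source. Coassociativity of H turns the result into
    [j h_(2)] times [s a] on the second leg. *)
Lemma ext_takeuchi u : takeuchi (Delta u).
Proof.
move=> a.
pose f u := \sw_(x, y <- Delta u) ((x *' t a) ⊗A y).
pose g u := \sw_(x, y <- Delta u) (x ⊗A (y *' s a)).
have bf := takeuchi_l_balanced hP a; have bg := takeuchi_r_balanced hP a.
suff: f =1 g by apply.
apply: tens_ext.
- by move=> x y; rewrite /f (linSD ld) (tliftD _ _ bf).
- by move=> x y; rewrite /g (linSD ld) (tliftD _ _ bg).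
move=> b h; rewrite /f /g comulE (sw_sw _ _ bf) (sw_sw _ _ bg).
transitivity (\sw_(h1, h2 <- cop B h) \sw_(h11, h12 <- cop B h1)
    ((b ♯ h11) ⊗A (s (h12 ▷ a) *' j h2))).
  apply: eq_sw => h1 h2; rewrite (tlift_tens _ _ bf) (smash_split hB hA b h1) -(amulA hS).
  rewrite (smash_j_t hB hM hA) (smash_swr hA) (sw_morph _ _ (linSD (bl _))).
  apply: eq_sw => h11 h12; rewrite (amulA hS) (smash_stC hB hM hA hbc).
  by rewrite -(amulA hS) src_mul (amul1r halg) tbal.
rewrite (sw_coassoc hB bD (f := fun x y z => (b ♯ x) ⊗A (s (y ▷ a) *' j z))); last by lin.
apply: eq_sw => h1 h2; rewrite (tlift_tens _ _ bg) (smash_j_s hB hA).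
rewrite (sw_morph _ _ (linSD (br _))); apply: eq_sw => h21 h22.
by rewrite src_mul (amul1r halg).
Qed.

Lemma ext_comulM u v : Delta (u *' v) = mul2 (Delta u) (Delta v).
Proof.
move: u; apply: (tens_ext (f := fun u => Delta (u *' v)) (g := fun u => mul2 _ _)).
- have lf : lin (fun u => u *' v) by lin.
  exact: (linSD (linS_comp ld lf)).
- by move=> u w; rewrite (linSD ld) (mul2Dl hP).
(* Additivity of [mul2] in its second argument rests on the Takeuchi property of the first. *)
move=> a h; have tk := ext_takeuchi (a ♯ h).
move: v; apply: (tens_ext (f := fun v => Delta (_ *' v)) (g := fun v => mul2 _ _)).
- have lf : lin (fun v => (a ♯ h) *' v) by lin.
  exact: (linSD (linS_comp ld lf)).
- by move=> u w; rewrite (linSD ld) (mul2Dr hP).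
move=> b g; rewrite (smashE hB hA) comul_sw (comulE b g).
rewrite (sw_morph _ _ (mul2Dr hP tk)).
transitivity (\sw_(g1, g2 <- cop B g) \sw_(h1, h2 <- cop B h) \sw_(h11, h12 <- cop B h1)
   (((a *_A (h11 ▷ b)) ♯ (h12 * g1)) ⊗A (j (h2 * g2)))); last first.
  apply: eq_sw => g1 g2; rewrite (mul2E hP _ _ tk) comulE (sw_sw _ _ (mul2_balanced hP _ _)).
  apply: eq_sw => h1 h2; rewrite (tlift_tens _ _ (mul2_balanced hP _ _)).
  by rewrite (smash_mul_j hB hA) (smashE hB hA) (sw_morph _ _ (linSD (bl _))).
transitivity (\sw_(g1, g2 <- cop B g) \sw_(h1, h2 <- cop B h) \sw_(h21, h22 <- cop B h2)
   (((a *_A (h1 ▷ b)) ♯ (h21 * g1)) ⊗A (j (h22 * g2)))); last first.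
  apply: eq_sw => g1 g2; symmetry.
  by apply: (sw_coassoc hB bD (f := fun x y z =>
    ((a *_A (x ▷ b)) ♯ (y * g1)) ⊗A (j (z * g2)))); lin.
rewrite [RHS]sw_exch; apply: eq_sw => h1 h2; rewrite [RHS]sw_exch comulE.
by rewrite (sw_copM hB (sc := bsc)) //; lin.
Qed.

Lemma ext_comulA u :
  \sw_(x, y <- Delta u) \sw_(x1, x2 <- Delta x) (tens x1 (x2 ⊗A y) : T3)
  = \sw_(x, y <- Delta u) (tens x (Delta y) : T3).
Proof.
have bfl := comul_l_balanced hP (linSD ld) ext_comul_bimod.
have bfr := comul_r_balanced hP (linSD ld) ext_comul_bimod.
pose f u := \sw_(x, y <- Delta u) \sw_(x1, x2 <- Delta x) (tens x1 (x2 ⊗A y) : T3).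
pose g u := \sw_(x, y <- Delta u) (tens x (Delta y) : T3).
suff: f =1 g by apply.
apply: tens_ext.
- by move=> x y; rewrite /f (linSD ld) (tliftD _ _ bfl).
- by move=> x y; rewrite /g (linSD ld) (tliftD _ _ bfr).
move=> a h; rewrite /f /g comulE (sw_sw _ _ bfl) (sw_sw _ _ bfr).
pose T x y z : T3 := tens (a ♯ x) (j y ⊗A j z).
have T3l : trilS (sc3 (B := E)) T.
  split=> [y z|x z|x y].
  - by apply: (linS_tens3l hP); lin.
  - by apply: (linS_tens3r hP); apply: (linS_comp (bl _)); lin.
  - by apply: (linS_tens3r hP); apply: (linS_comp (br _)); lin.
transitivity (\sw_(h1, h2 <- cop B h) \sw_(h11, h12 <- cop B h1) T h11 h12 h2).
  apply: eq_sw => h1 h2; rewrite (tlift_tens _ _ bfl) comulE.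
  rewrite (sw_sw _ _ (tens3_balanced hP _)); apply: eq_sw => h11 h12.
  by rewrite (tlift_tens _ _ (tens3_balanced hP _)).
rewrite (sw_coassoc hB (sc3D hP) _ T3l); apply: eq_sw => h1 h2.
rewrite (tlift_tens _ _ bfr) comulE.
by rewrite (sw_morph _ _ (tens3D (B := E) _)).
Qed.

Lemma ext_counitl u : \sw_(x, y <- Delta u) (s (eps x) *' y) = u.
Proof.
pose f u := \sw_(x, y <- Delta u) (s (eps x) *' y).
suff: f =1 id by apply.
apply: tens_ext => // [x y|a h].
  by rewrite /f (linSD ld) (tliftD _ _ counitl_bal).
rewrite /f comulE (sw_sw _ _ counitl_bal).
rewrite -(sw_cop_coul hB (f := fun h => a ♯ h)); last by lin.
apply: eq_sw => h1 h2; rewrite (tlift_tens _ _ counitl_bal) counitE src_mul (amul1r halg).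
by rewrite (proj2 (_ : lin (fun x => x ♯ h2))) //; lin.
Qed.

Lemma ext_counitr u : \sw_(x, y <- Delta u) (t (eps y) *' x) = u.
Proof.
pose f u := \sw_(x, y <- Delta u) (t (eps y) *' x).
suff: f =1 id by apply.
apply: tens_ext => // [x y|a h].
  by rewrite /f (linSD ld) (tliftD _ _ counitr_bal).
rewrite /f comulE (sw_sw _ _ counitr_bal).
rewrite -(sw_cop_cour hB (f := fun h => a ♯ h)); last by lin.
apply: eq_sw => h1 h2; rewrite (tlift_tens _ _ counitr_bal) counitE.
rewrite (proj2 (_ : lin (fun x => t x *' (a ♯ h1)))); last by lin.
by rewrite [t 1_A](coact_one hX) (amul1l hS).
Qed.

Lemma ext_base_act a h b : eps ((a ♯ h) *' s b) = a *_A (h ▷ b).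
Proof.
rewrite (smashE hB hA) counit_sw.
pose g x := a *_A (x ▷ b); have lg : lin g by rewrite /g; lin.
rewrite -/(g h) -(sw_cop_cour hB lg); apply: eq_sw => h1 h2.
by rewrite counitE mulr1.
Qed.

Lemma counit_mul_j u h : eps (u *' j h) = cou B h *: eps u.
Proof.
move: u; apply: (lin_ext (f := fun u => eps (u *' j h)) (g := fun u => cou B h *: eps u));
  [by lin|by lin|move=> a g].
by rewrite (smash_mul_j hB hA) !counitE (couM hB) scalerA mulrC.
Qed.

Lemma ext_counit_mul_src u v : eps (u *' s (eps v)) = eps (u *' v).
Proof.
move: v; apply: (lin_ext (f := fun v => eps (u *' s (eps v))) (g := fun v => eps (u *' v)));
  [by lin|by lin|move=> b g].
rewrite [in RHS](smash_split hB hA b g) (amulA hS) counit_mul_j counitE.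
by rewrite (proj2 (_ : lin (fun x => eps (u *' s x)))) //; lin.
Qed.

(** Deduces the counit axiom for the target from the one for the source. [smash_j_t] moves the
    target to the left, where [eps] evaluates it. *)
Lemma ext_counit_st u b : eps (u *' t b) = eps (u *' s b).
Proof.
move: u; apply: (lin_ext (f := fun u => eps (u *' t b)) (g := fun u => eps (u *' s b)));
  [by lin|by lin|move=> a h].
rewrite ext_base_act (smash_split hB hA a h) -(amulA hS) ext_counit_src.
congr (_ *_A _); rewrite (smash_j_t hB hM hA) counit_sw.
rewrite -(sw_cop_coul hB (f := fun h => h ▷ b)); last by lin.
apply: eq_sw => h1 h2; rewrite counit_mul_j; congr (_ *: _).
rewrite -[t _](amul1r hS) ext_counit_tgt counitE.
by rewrite (cou1 hB) scale1r (amul1l halg).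
Qed.

Lemma scalar_extensionP : is_left_bialgebroid E.
Proof.
split.
- exact: halg.
- exact: hS.
- exact/lin_linear/lsrc.
- by [].
- exact: (pre_srcM hP).
- exact/lin_linear/ltgt.
- exact: tgt1.
- exact: (pre_tgtM hP).
- exact: (pre_stC hP).
- exact: (linSD ld).
- exact: ext_comul_bimod.
- exact/lin_linear/lc.
- exact: ext_counit_bimod.
- exact: ext_comulA.
- exact: ext_counitl.
- exact: ext_counitr.
- exact: ext_takeuchi.
- by rewrite [LHS]comulE (sw_cop1 hB (sc := bsc)) //; lin.
- exact: ext_comulM.
- by rewrite [LHS]counitE (cou1 hB) scale1r.
- exact: ext_counit_mul_src.
- by move=> u v; rewrite [LHS]ext_counit_st [LHS]ext_counit_mul_src.
Qed.

End ScalarExtension.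

(** * Transport of a bialgebroid structure *)

Section Transport.
Variables (k : fieldType) (A M M' : lmodType k).
Variables (B : bialgebroid A M) (B' : bialgebroid A M') (f : M -> M').

Local Notation "x *' y" := (amul (total_alg B) x y) (at level 40, left associativity).
Local Notation "x *'' y" := (amul (total_alg B') x y) (at level 40, left associativity).
Local Notation "a *_A b" := (amul (base_alg B) a b) (at level 40, left associativity).
Local Notation s := (src B).
Local Notation t := (tgt B).
Local Notation s' := (src B').
Local Notation t' := (tgt B').
Local Notation Delta := (comul B).
Local Notation Delta' := (comul B').
Local Notation eps := (counit B).
Local Notation eps' := (counit B').

Definition tens2_map (u : tens2 B) : tens2 B' := \sw_(x, y <- u) (tens (f x) (f y) : tens2 B').

Definition tens3_map (w : tens3 B) : tens3 B' :=
  @tlift _ M (tens2 B) _ _ _ (fun x u => tens (f x) (tens2_map u) : tens3 B') w.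

Hypotheses (hB : is_left_bialgebroid B) (hal' : is_algebra (total_alg B')).
Hypothesis base_eq : base_alg B = base_alg B'.
Hypotheses (f_bij : bijective f) (lf : lin f).
Hypothesis fM : forall x y, f (x *' y) = f x *'' f y.
Hypothesis f1 : f (aone (total_alg B)) = aone (total_alg B').
Hypotheses (fs : forall a, f (s a) = s' a) (ft : forall a, f (t a) = t' a).
Hypothesis f_comul : forall h, tens2_map (Delta h) = Delta' (f h).
Hypothesis f_counit : forall h, eps' (f h) = eps h.

Let surj x' : exists x, x' = f x.
Proof. by case: f_bij => g _ fg; exists (g x'); rewrite fg. Qed.

Lemma bialgebroid_pre : pre_bialgebroid B.
Proof.
by split; [exact: base_algebra hB|exact: total_algebra hB|exact/lin_linear/(src_lin hB)
  |exact: src1 hB|exact: srcM hB|exact/lin_linear/(tgt_lin hB)|exact: tgt1 hB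
  |exact: tgtM hB|exact: src_tgtC hB].
Qed.

Let hP := bialgebroid_pre.
Let ls : lin s := pre_src_lin hP.
Let lt : lin t := pre_tgt_lin hP.

Lemma transport_pre : pre_bialgebroid B'.
Proof.
have ls' : s' = fun a => f (s a) by apply: funext => a; rewrite fs.
have lt' : t' = fun a => f (t a) by apply: funext => a; rewrite ft.
split; rewrite -?base_eq.
- exact: base_algebra hB.
- exact: hal'.
- by rewrite ls'; apply: linS_comp.
- by rewrite -fs (src1 hB) f1.
- by move=> a b; rewrite -!fs (srcM hB) fM.
- by rewrite lt'; apply: linS_comp.
- by rewrite -ft (tgt1 hB) f1.
- by move=> a b; rewrite -!ft (tgtM hB) fM.
- by move=> a b; rewrite -fs -ft -!fM (src_tgtC hB).
Qed.

Let hP' := transport_pre.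
Let bl' := linS_tens2l hP'.
Let br' := linS_tens2r hP'.
Let sD' := sc2D hP'.

Lemma tens2_map_balanced :
  balanced (fun a h => t a *' h) (fun a h => s a *' h)
    (fun x y => tens (f x) (f y) : tens2 B').
Proof.
apply: (tens2_balanced (B := B)) => [y|x|a x y].
- by apply: (linSD (sc := sc2 (B := B'))); lin.
- by apply: (linSD (sc := sc2 (B := B'))); lin.
- by rewrite !fM fs ft tens2_bal.
Qed.

Let b2 := tens2_map_balanced.

Lemma tens2_mapE x y : tens2_map (tens x y) = tens (f x) (f y).
Proof. exact: tlift_tens b2. Qed.

Lemma tens2_mapD : {morph tens2_map : u v / u + v}.
Proof. by move=> u v; apply: tliftD b2. Qed.

Lemma sw_tens2_map (P : zmodType) (g : M' -> M' -> P) u :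
  balanced (fun a h => t' a *'' h) (fun a h => s' a *'' h) g ->
  tlift g (tens2_map u) = \sw_(x, y <- u) g (f x) (f y).
Proof.
by move=> bg; rewrite (sw_sw _ _ bg); apply: eq_sw => x y; rewrite (tlift_tens _ _ bg).
Qed.

Lemma tens2_map_bimod2 a a' u : tens2_map (bimod2 a a' u) = bimod2 a a' (tens2_map u).
Proof.
move: u; apply: (tens_ext (f := fun u : tens2 B => tens2_map (bimod2 a a' u))
  (g := fun u => bimod2 a a' (tens2_map u))).
- by move=> u v; rewrite (bimod2D hP) tens2_mapD.
- by move=> u v; rewrite tens2_mapD (bimod2D hP').
by move=> x y; rewrite (bimod2E hP) !tens2_mapE (bimod2E hP') !fM fs ft.
Qed.

Lemma tens3_map_balanced :
  balanced (fun a h => t a *' h) (fun a (u : tens2 B) => bimod2 a (aone (base_alg B)) u)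
    (fun x u => tens (f x) (tens2_map u) : tens3 B').
Proof.
split=> [x x' u|x u v|a x u].
- have [tD _ _] := tens_balanced (fun a h => t' a *'' h)
    (fun a (u : tens2 B') => bimod2 a (aone (base_alg B')) u).
  by rewrite (linSD lf) tD.
- by rewrite tens2_mapD (tens3D (B := B')).
- by rewrite fM ft tens3_bal tens2_map_bimod2 base_eq.
Qed.

Let b3 := tens3_map_balanced.

Lemma tens3_mapE x u : tens3_map (tens x u) = tens (f x) (tens2_map u).
Proof. exact: tlift_tens b3. Qed.

Lemma tens3_mapD : {morph tens3_map : u v / u + v}.
Proof. by move=> u v; apply: tliftD b3. Qed.

Lemma tens2_map_mul2 u v : takeuchi u -> takeuchi (tens2_map u) ->
  tens2_map (mul2 u v) = mul2 (tens2_map u) (tens2_map v).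
Proof.
move=> tu tu'; move: v; apply: (tens_ext (f := fun v : tens2 B => tens2_map (mul2 u v))
  (g := fun v => mul2 (tens2_map u) (tens2_map v))).
- by move=> v w; rewrite (mul2Dr hP tu) tens2_mapD.
- by move=> v w; rewrite tens2_mapD (mul2Dr hP' tu').
move=> y1 y2; rewrite (mul2E hP _ _ tu) tens2_mapE (mul2E hP' _ _ tu').
rewrite (sw_tens2_map _ (mul2_balanced hP' _ _)) (sw_morph _ _ tens2_mapD).
by apply: eq_sw => x1 x2; rewrite tens2_mapE !fM.
Qed.

(** A sum over [Delta' (f x)] becomes a sum over [Delta x] only for balanced summands. Hence
    additivity and bilinearity over the base are transported before the other axioms: they make the
    summands of coassociativity and of the counit laws balanced. *)
Lemma transport_bialgebroid : is_left_bialgebroid B'.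
Proof.
have D'D : {morph Delta' : x y / x + y}.
  move=> x' y'; have [x ->] := surj x'; have [y ->] := surj y'.
  by rewrite -(linSD lf) -!f_comul (comulD hB) tens2_mapD.
have D'b a a' h : Delta' (s' a *'' (t' a' *'' h)) = bimod2 a a' (Delta' h).
  have [x ->] := surj h; rewrite -fs -ft -!fM -!f_comul (comul_bimod hB).
  exact: tens2_map_bimod2.
have le' : lin eps'.
  have [g gf fg] := f_bij.
  have lg : lin g.
    split=> [x y|c x]; apply: (can_inj gf).
      by rewrite fg (linSD lf) !fg.
    by rewrite fg (proj2 lf) fg.
  have -> : eps' = fun x => eps (g x) by apply: funext => x; rewrite -f_counit fg.
  exact: linS_comp (proj1 (lin_linear _) (counit_lin hB)) lg.
have e'b a a' h : eps' (s' a *'' (t' a' *'' h)) =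
    amul (base_alg B') (amul (base_alg B') a (eps' h)) a'.
  by have [x ->] := surj h; rewrite -fs -ft -!fM !f_counit (counit_bimod hB) base_eq.
have e's a h : eps' (s' a *'' h) = amul (base_alg B') a (eps' h).
  have := e'b a (aone (base_alg B')) h.
  by rewrite (pre_tgt1 hP') (amul1l hal') (amul1r (pre_base hP')).
have e't a h : eps' (t' a *'' h) = amul (base_alg B') (eps' h) a.
  have := e'b (aone (base_alg B')) a h.
  by rewrite (pre_src1 hP') (amul1l hal') (amul1l (pre_base hP')).
have bl3 := comul_l_balanced hP' D'D D'b.
have br3 := comul_r_balanced hP' D'D D'b.
have tk h : takeuchi (Delta' h).
  have [x ->] := surj h; rewrite -f_comul => a.
  rewrite (sw_tens2_map _ (takeuchi_l_balanced hP' a)).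
  rewrite (sw_tens2_map _ (takeuchi_r_balanced hP' a)).
  have := congr1 tens2_map (comul_takeuchi hB x a).
  rewrite !(sw_morph _ _ tens2_mapD) => E.
  by etransitivity; [|etransitivity; [exact: E|]]; apply: eq_sw => y z;
    rewrite tens2_mapE fM ?fs ?ft.
split.
- exact: pre_base hP'.
- exact: hal'.
- exact/lin_linear/(pre_src_lin hP').
- exact: pre_src1 hP'.
- exact: pre_srcM hP'.
- exact/lin_linear/(pre_tgt_lin hP').
- exact: pre_tgt1 hP'.
- exact: pre_tgtM hP'.
- exact: pre_stC hP'.
- exact: D'D.
- exact: D'b.
- exact/lin_linear.
- exact: e'b.
- move=> h; have [x ->] := surj h; rewrite -f_comul (sw_tens2_map _ bl3) (sw_tens2_map _ br3).
  have := congr1 tens3_map (comulA hB x).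
  rewrite !(sw_morph _ _ tens3_mapD) => E.
  etransitivity; [|etransitivity; [exact: E|]]; apply: eq_sw => y z.
    rewrite -f_comul (sw_tens2_map _ (tens3_balanced hP' _)) (sw_morph _ _ tens3_mapD).
    by apply: eq_sw => y1 y2; rewrite tens3_mapE tens2_mapE.
  by rewrite tens3_mapE f_comul.
- move=> h; have [x ->] := surj h; rewrite -f_comul.
  rewrite (sw_tens2_map _ (counitl_balanced hP' le' e't)).
  rewrite -[in RHS](comul_counitl hB x) (lin_sw _ _ lf).
  by apply: eq_sw => y z; rewrite fM f_counit fs.
- move=> h; have [x ->] := surj h; rewrite -f_comul.
  rewrite (sw_tens2_map _ (counitr_balanced hP' le' e's)).
  rewrite -[in RHS](comul_counitr hB x) (lin_sw _ _ lf).
  by apply: eq_sw => y z; rewrite fM f_counit ft.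
- exact: tk.
- by rewrite -f1 -f_comul (comul1 hB) tens2_mapE.
- move=> g' h'; have [g eg] := surj g'; have [h eh] := surj h'; have := tk g'; subst g' h'.
  rewrite -fM -!f_comul (comulM hB) => tk'.
  by apply: tens2_map_mul2 tk'; apply: comul_takeuchi hB g.
- by rewrite -f1 f_counit (counit1 hB) base_eq.
- move=> g' h'; have [g ->] := surj g'; have [h ->] := surj h'.
  by rewrite f_counit -fs -!fM !f_counit (counit_src hB).
- move=> g' h'; have [g ->] := surj g'; have [h ->] := surj h'.
  by rewrite f_counit -ft -!fM !f_counit (counit_tgt hB).
Qed.

End Transport.

(** * The twist of the scalar extension *)

Section TwistedExtension.
Variables (k : fieldType) (H : algType k) (A : lmodType k) (B : coalgebra_on H).
Variables (X : yd_data H A) (F Finv : H ⊗ H).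
Hypotheses (hB : is_bialgebra B) (hF : drinfeld_twist B F Finv).
Hypotheses (hX : is_yd_module_algebra B X) (hbc : braided_commutative X).

Local Notation BF := (twisted_bialgebra B F Finv).
Local Notation XF := (twisted_yd X F Finv).

Let hM : is_yd_module B X. Proof. by case: hX. Qed.
Let hA := yd_module_algebra hX.
Let halg := ma_algebra hA.
Let hBF := twisted_bialgebraP hB hF.
Let hXF := twisted_yd_module_algebraP hB hF hX hbc.
Let hbcF := twisted_braided_commutative hB hF hX hbc.
Let hAF := twisted_module_algebraP hB hF hA.
Let hS := smash_algP hB hA.

Local Notation "a *_A b" := (amul (yd_alg X) a b) (at level 40, left associativity).
Local Notation "x *' y" := (amul (smash_alg B X) x y) (at level 40, left associativity).
Local Notation "x *'F y" := (amul (smash_alg BF XF) x y) (at level 40, left associativity).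
Local Notation "1_A" := (aone (yd_alg X)).
Local Notation "h ▷ a" := (act X h a) (at level 35, right associativity).
Local Notation "a ♯ h" := (tens a h : A ⊗ H) (at level 42, no associativity).
Local Notation t := (coact X).
Local Notation zeta := (zeta X Finv).
Local Notation j h := (1_A ♯ h).
Local Notation s a := (a ♯ 1).
Local Notation sG := (sG X Finv).
Local Notation tG := (tG B X Finv).
Local Notation E := (scalar_extension B X).
Local Notation EF := (scalar_extension BF XF).
Local Notation G := (ext_cocycle B X Finv).
Local Notation Ginv := (ext_cocycle_inv B X F Finv).
Local Notation EG := (twist_bialgebroid Ginv).
Local Notation Delta := (comul E).
Local Notation eps := (counit E).
Local Notation T2 := (tens2 E).
Local Notation T3 := (tens3 E).
Local Notation T2G := (twist_tens2 G).
Local Notation "x ⊗A y" := (tens x y : T2) (at level 43, no associativity).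
Local Notation "x ⊗G y" := (tens x y : T2G) (at level 43, no associativity).

Let hE : is_left_bialgebroid E := scalar_extensionP hB hX hbc.
Let hP : pre_bialgebroid E := bialgebroid_pre hE.
Let mA := amulA hS.
Let jM h g : j h *' j g = j (h * g). Proof. exact: smash_mul_j hB hA _ _ _. Qed.
Let lc : lin eps := lin_counit X hB.
Let bl := linS_tens2l hP.
Let br := linS_tens2r hP.
Let sD := sc2D hP.

(** * Twisted base, source and target, and multiplication by the cocycle and its inverse *)

Lemma sw_ext_cocycle (P : zmodType) (f : A ⊗ H -> A ⊗ H -> P) :
  balanced (fun a h => t a *' h) (fun a h => s a *' h) f ->
  tlift f G = \sw_(e1, e2 <- Finv) f (j e1) (j e2).
Proof.
by move=> fb; rewrite (sw_sw _ _ fb); apply: eq_sw => e1 e2; rewrite (tlift_tens _ _ fb).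
Qed.

Lemma base_act_j h a : base_act E (j h) a = h ▷ a.
Proof. by rewrite [LHS](ext_base_act hB hX) (amul1l halg). Qed.

Lemma base_act_src a u b : base_act E (s a *' u) b = a *_A base_act E u b.
Proof. by rewrite /base_act -(ext_counit_src hB hX hbc) mA. Qed.

Lemma base_act_tgt a u b : base_act E (t a *' u) b = base_act E u b *_A a.
Proof. by rewrite /base_act -(ext_counit_tgt hB hX hbc) mA. Qed.

Lemma lin_base_act b : lin (fun u => base_act E u b).
Proof. by rewrite /base_act; lin. Qed.

Let lba := lin_base_act.
Let ls : lin (@smash_src k H A) := pre_src_lin hP.
Let lt : lin t := pre_tgt_lin hP.

(** An equality of records, by extensionality, because transport requires literally the same base
    algebra on both sides. *)
Lemma twist_baseE : twist_base G = yd_alg XF.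
Proof.
congr AlgebraOn; apply: funext => a; apply: funext => b.
rewrite sw_ext_cocycle; first by apply: eq_sw => e1 e2; rewrite !base_act_j.
apply: (tens2_balanced (B := E)) => [y|x|c x y].
- by apply: (linSD (sc := *:%R)); lin.
- by apply: (linSD (sc := *:%R)); lin.
- by rewrite base_act_tgt base_act_src (amulA halg).
Qed.

Lemma twist_srcE a : twist_src G a = sG a.
Proof.
rewrite /twist_src sw_ext_cocycle.
  by apply: eq_sw => e1 e2; rewrite base_act_j -(smash_split hB hA).
apply: (tens2_balanced (B := E)) => [y|x|c x y].
- by apply: (linSD (sc := *:%R)); lin.
- by apply: (linSD (sc := *:%R)); lin.
- by rewrite base_act_tgt mA [src E (_ *_A _)](pre_srcM hP).
Qed.

Lemma twist_tgtE a : twist_tgt G a = tG a.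
Proof.
rewrite /twist_tgt sw_ext_cocycle; first by apply: eq_sw => e1 e2; rewrite base_act_j.
apply: (tens2_balanced (B := E)) => [y|x|c x y].
- by apply: (linSD (sc := *:%R)); lin.
- by apply: (linSD (sc := *:%R)); lin.
- by rewrite base_act_src mA [tgt E (_ *_A _)](pre_tgtM hP).
Qed.

Let lsG : lin sG. Proof. by rewrite /sG; lin. Qed.
Let ltG : lin tG. Proof. by rewrite /tG; lin. Qed.
Let sG1 : sG 1_A = j 1.
Proof. by rewrite -(zeta_s Finv hA) (zeta_j hB hF hA). Qed.
Let tG1 : tG 1_A = j 1.
Proof. by rewrite -(zeta_t hB hF hX) (coact_one hXF) (zeta_j hB hF hA). Qed.

Lemma tensG_bal a x y : (tG a *' x) ⊗G y = x ⊗G (sG a *' y).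
Proof. by rewrite -twist_srcE -twist_tgtE; apply: btens_bal. Qed.

Definition scG : k -> T2G -> T2G :=
  bscale (al := smash_alg B X) (s := twist_src G) (t := twist_tgt G).

Lemma scGD : additiveS scG. Proof. exact: additiveS_bscale. Qed.
Lemma linS_tensGl y : linS scG (fun x => x ⊗G y). Proof. exact: linS_btensl. Qed.
Lemma linS_tensGr x : linS scG (fun y => x ⊗G y).
Proof.
have es : twist_src G = sG by apply: funext; apply: twist_srcE.
have et : twist_tgt G = tG by apply: funext; apply: twist_tgtE.
by apply: (linS_btensr (one := 1_A) hS); rewrite ?es ?et.
Qed.

Let gl := linS_tensGl.
Let gr := linS_tensGr.
Let gD := scGD.

Lemma tensG_balanced (P : zmodType) (f : A ⊗ H -> A ⊗ H -> P) :
  (forall y, {morph (fun x => f x y) : x x' / x + x'}) ->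
  (forall x, {morph f x : y y' / y + y'}) ->
  (forall a x y, f (tG a *' x) y = f x (sG a *' y)) ->
  balanced (fun a h => twist_tgt G a *' h) (fun a h => twist_src G a *' h) f.
Proof.
move=> fl fr fb; split=> [x x' y|x y y'|a x y]; rewrite ?fl ?fr //.
by rewrite twist_srcE twist_tgtE fb.
Qed.

Lemma sw_ext_cocycle_inv (P : zmodType) (f : A ⊗ H -> A ⊗ H -> P) :
  balanced (fun a h => twist_tgt G a *' h) (fun a h => twist_src G a *' h) f ->
  tlift f Ginv = \sw_(f1, f2 <- F) f (j f1) (j f2).
Proof.
by move=> fb; rewrite (sw_sw _ _ fb); apply: eq_sw => f1 f2; rewrite (tlift_tens _ _ fb).
Qed.

(** [F] undoes the twist of the source, as it does for the target in [tgt_untwist]. Elements of A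
    are thereby rewritten in a form that can cross the twisted tensor sign. *)
Lemma src_untwist a : \sw_(f1, f2 <- F) (sG (f1 ▷ a) *' j f2) = s a.
Proof.
transitivity (\sw_(f1, f2 <- F) \sw_(e1, e2 <- Finv) (((e1 * f1) ▷ a) ♯ (e2 * f2))).
  apply: eq_sw => f1 f2; rewrite (smash_swl hB hA); apply: eq_sw => e1 e2.
  by rewrite (smash_mul_j hB hA) (ma_actM hA).
rewrite sw_exch (sw_VF hF (sc := *:%R) (f := fun x y => (x ▷ a) ♯ y)); last by lin.
by rewrite (ma_act1 hA).
Qed.

Lemma tgt_untwist a : \sw_(f1, f2 <- F) (tG (f2 ▷ a) *' j f1) = t a.
Proof.
transitivity (\sw_(f1, f2 <- F) \sw_(e1, e2 <- Finv) (t ((e2 * f2) ▷ a) *' j (e1 * f1))).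
  apply: eq_sw => f1 f2; rewrite (smash_swl hB hA); apply: eq_sw => e1 e2.
  by rewrite -mA jM (ma_actM hA).
rewrite sw_exch (sw_VF hF (sc := *:%R) (f := fun x y => t (y ▷ a) *' j x)); last by lin.
by rewrite (ma_act1 hA) (amul1r hS).
Qed.

(* Left multiplication by [F] is well defined from [⊗A] to [⊗G]. *)
Lemma twist_inv_mul_balanced :
  balanced (fun a h => t a *' h) (fun a h => s a *' h)
    (fun x y => \sw_(f1, f2 <- F) ((j f1 *' x) ⊗G (j f2 *' y))).
Proof.
apply: (tens2_balanced (B := E)) => [y|x|a x y].
- by apply: (linSD (sc := scG)); lin.
- by apply: (linSD (sc := scG)); lin.
(* [t a] is written through [tG], moved left past [j f1] with Delta^F, and crosses the twisted
   tensor sign as [sG]; [sw_copF] exchanges Delta^F for Delta. *)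
transitivity (\sw_(f1, f2 <- F) \sw_(g1, g2 <- F) \sw_(h1, h2 <- cop B f1)
  ((j (g1 * h1) *' x) ⊗G (sG ((g2 * h2) ▷ a) *' (j f2 *' y)))).
  apply: eq_sw => f1 f2.
  rewrite -(sw_copF hF (sc := scG)
    (f := fun u v => (j u *' x) ⊗G (sG (v ▷ a) *' (j f2 *' y)))); last by lin.
  rewrite -[tgt E a]tgt_untwist (smash_swl hB hA) (smash_swr hA) (sw_morph _ _ (linSD (gl _))).
  rewrite [RHS]sw_exch; apply: eq_sw => g1 g2.
  rewrite -!mA (mA _ (tG _)) (smash_j_tG hB hF hX) (smash_swl hB hA).
  rewrite (sw_morph _ _ (linSD (gl _))).
  by apply: eq_sw => h1 h2; rewrite -!mA tensG_bal (mA (j h1)) jM (ma_actM hA).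
(* The cocycle identity of [F] shifts the coproduct to the second leg, where [src_untwist]
   reassembles the untwisted source. *)
rewrite (sw_cocycle hF gD
  (f := fun p q r => (j p *' x) ⊗G (sG (q ▷ a) *' (j r *' y)))); last by lin.
apply: eq_sw => f1 f2; rewrite sw_exch.
rewrite [src E a *' y in RHS](_ : _ = s a *' y) // mA (smash_j_s hB hA).
rewrite (smash_swl hB hA) (sw_morph _ _ (linSD (gr _))); apply: eq_sw => h1 h2.
rewrite (smash_split hB hA (h1 ▷ a)) -mA -(src_untwist (h1 ▷ a)) (smash_swl hB hA).
rewrite (sw_morph _ _ (linSD (gr _))); apply: eq_sw => g1 g2.
by rewrite (ma_actM hA) -jM !mA.
Qed.

Lemma twist_inv_mulE u :
  twist_inv_mul Ginv u = \sw_(x, y <- u) \sw_(f1, f2 <- F) ((j f1 *' x) ⊗G (j f2 *' y)).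
Proof.
rewrite /twist_inv_mul sw_ext_cocycle_inv; first by rewrite [RHS]sw_exch.
apply: tensG_balanced => [y|x|a x y].
- by apply: (linSD (sc := scG)); lin.
- by apply: (linSD (sc := scG)); lin.
- by apply: eq_sw => z w; rewrite -!mA tensG_bal.
Qed.

Lemma twist_inv_mulD : {morph twist_inv_mul Ginv : u v / u + v}.
Proof. by move=> u v; rewrite !twist_inv_mulE; apply: tliftD twist_inv_mul_balanced. Qed.

Lemma twist_inv_mul_tens x y :
  twist_inv_mul Ginv (x ⊗A y) = \sw_(f1, f2 <- F) ((j f1 *' x) ⊗G (j f2 *' y)).
Proof. by rewrite twist_inv_mulE (tlift_tens _ _ twist_inv_mul_balanced). Qed.

(* Left multiplication by [F^-1] is well defined from [⊗G] to [⊗A]. *)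
Lemma twist_mul_balanced :
  balanced (fun a h => twist_tgt G a *' h) (fun a h => twist_src G a *' h)
    (fun x y => \sw_(e1, e2 <- Finv) ((j e1 *' x) ⊗A (j e2 *' y))).
Proof.
apply: tensG_balanced => [y|x|a x y].
- by apply: (linSD (sc := sc2 (B := E))); lin.
- by apply: (linSD (sc := sc2 (B := E))); lin.
transitivity (\sw_(e1, e2 <- Finv) \sw_(h1, h2 <- cop B e1) \sw_(d1, d2 <- Finv)
  ((j (h1 * d1) *' x) ⊗A (s ((h2 * d2) ▷ a) *' (j e2 *' y)))).
  apply: eq_sw => e1 e2; rewrite sw_exch (smash_swl hB hA) (smash_swr hA).
  rewrite (sw_morph _ _ (linSD (bl _))); apply: eq_sw => d1 d2.
  rewrite -!mA (mA _ (t _)) (smash_j_t hB hM hA) (smash_swl hB hA).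
  rewrite (sw_morph _ _ (linSD (bl _))).
  by apply: eq_sw => h1 h2; rewrite -!mA (tens2_bal E) (mA (j h1)) jM (ma_actM hA).
rewrite (sw_cocycleV hB hF sD
  (f := fun p q r => (j p *' x) ⊗A (s (q ▷ a) *' (j r *' y)))); last by lin.
apply: eq_sw => e1 e2; rewrite sw_exch (smash_swl hB hA) (smash_swr hA).
rewrite (sw_morph _ _ (linSD (br _))); apply: eq_sw => d1 d2.
rewrite (smash_split hB hA (d1 ▷ a)) -!mA (mA _ (s _)) (smash_j_s hB hA) (smash_swl hB hA).
rewrite (sw_morph _ _ (linSD (br _))); apply: eq_sw => h1 h2.
by rewrite (smash_split hB hA (h1 ▷ _)) (ma_actM hA) -!mA (mA (j h2)) jM.
Qed.

Let tk u : takeuchi (Delta u) := comul_takeuchi hE u.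
Let ld : linS (sc2 (B := E)) Delta := linS_comul hB hX.

Lemma mul2_comul_cocycle a h :
  mul2 (Delta (a ♯ h)) G =
  \sw_(h1, h2 <- cop B h) \sw_(e1, e2 <- Finv) ((a ♯ (h1 * e1)) ⊗A (j (h2 * e2))).
Proof.
rewrite (sw_morph _ _ (mul2Dr hP (tk _))) sw_exch; apply: eq_sw => e1 e2.
rewrite (mul2E hP _ _ (tk _)) (comulE hB hX a h) (sw_sw _ _ (mul2_balanced hP _ _)).
apply: eq_sw => h1 h2; rewrite (tlift_tens _ _ (mul2_balanced hP _ _)).
by congr tens; [apply: smash_mul_j hB hA _ _ _|apply: jM].
Qed.

Let comul_G_D : {morph (fun u => mul2 (Delta u) G) : u v / u + v}.
Proof. by move=> u v; rewrite (linSD ld) (mul2Dl hP). Qed.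

Let comul_G_bimod a a' u :
  mul2 (Delta (s a *' (t a' *' u))) G = bimod2 a a' (mul2 (Delta u) G).
Proof. by rewrite (comul_bimod hE) (mul2_bimod2 hP). Qed.

(** The cocycle and counit conditions are those of [Finv] carried along [j]. The inverse identities
    are [F F^-1 = 1] and [F^-1 F = 1], once left multiplication by [F] and by [Finv] is well defined
    between the two tensor products. *)
Lemma ext_cocycleP : drinfeld_xu_cocycle Ginv.
Proof.
split.
- rewrite (sw_ext_cocycle (comul_l_balanced hP comul_G_D comul_G_bimod)).
  rewrite (sw_ext_cocycle (comul_r_balanced hP comul_G_D comul_G_bimod)).
  pose T x y z : T3 := tens (j x) (j y ⊗A j z).
  have T3l : trilS (sc3 (B := E)) T.
    split=> [y z|x z|x y].
    - by apply: (linS_tens3l hP); lin.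
    - by apply: (linS_tens3r hP); apply: (linS_comp (bl _)); lin.
    - by apply: (linS_tens3r hP); apply: (linS_comp (br _)); lin.
  transitivity (\sw_(e1, e2 <- Finv) \sw_(h1, h2 <- cop B e1) \sw_(d1, d2 <- Finv)
    T (h1 * d1) (h2 * d2) e2).
    apply: eq_sw => e1 e2; rewrite mul2_comul_cocycle (sw_sw _ _ (tens3_balanced hP _)).
    apply: eq_sw => h1 h2; rewrite (sw_sw _ _ (tens3_balanced hP _)); apply: eq_sw => d1 d2.
    by rewrite (tlift_tens _ _ (tens3_balanced hP _)).
  rewrite (sw_cocycleV hB hF (sc3D hP) T3l); apply: eq_sw => e1 e2.
  rewrite mul2_comul_cocycle (sw_morph _ _ (tens3D (B := E) _)); apply: eq_sw => h1 h2.
  by rewrite (sw_morph _ _ (tens3D (B := E) _)).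
- rewrite (sw_ext_cocycle (counitl_balanced hP lc (ext_counit_tgt hB hX hbc))).
  rewrite -[RHS](sw_V_coul hB hF (f := fun x => j x)); last by lin.
  apply: eq_sw => e1 e2; rewrite [eps _](counitE X hB) -(smash_split hB hA).
  by rewrite (proj2 (_ : lin (fun x => x ♯ e2))) //; lin.
- rewrite (sw_ext_cocycle (counitr_balanced hP lc (ext_counit_src hB hX hbc))).
  rewrite -[RHS](sw_V_cour hB hF (f := fun x => j x)); last by lin.
  apply: eq_sw => e1 e2; rewrite [eps _](counitE X hB).
  rewrite (proj2 (_ : lin (fun x => t x *' j e1))); last by lin.
  by rewrite (coact_one hX) jM mul1r.
- rewrite (sw_morph _ _ twist_inv_mulD).
  transitivity (\sw_(e1, e2 <- Finv) \sw_(f1, f2 <- F) (j (f1 * e1) ⊗G j (f2 * e2))).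
    apply: eq_sw => e1 e2; rewrite twist_inv_mul_tens; apply: eq_sw => f1 f2.
    by rewrite !jM.
  by rewrite sw_exch (sw_FV hF (sc := scG) (f := fun x y => j x ⊗G j y)) //; lin.
- rewrite /twist_mul.
  transitivity (\sw_(x, y <- Ginv) \sw_(e1, e2 <- Finv) ((j e1 *' x) ⊗A (j e2 *' y))).
    rewrite [RHS]sw_exch; apply: sw_ext_cocycle.
    apply: (tens2_balanced (B := E)) => [y|x|a x y].
    + by apply: (linSD (sc := sc2 (B := E))); lin.
    + by apply: (linSD (sc := sc2 (B := E))); lin.
    + by apply: eq_sw => z w; rewrite -!mA (tens2_bal E).
  rewrite (sw_ext_cocycle_inv twist_mul_balanced) sw_exch.
  transitivity (\sw_(e1, e2 <- Finv) \sw_(f1, f2 <- F) (j (e1 * f1) ⊗A j (e2 * f2))).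
    by do 2!apply: eq_sw => ? ?; rewrite !jM.
  by rewrite (sw_VF hF (sc := sc2 (B := E)) (f := fun x y => j x ⊗A j y)) //; lin.
Qed.

(** * Compatibility of [zeta] with the bialgebroid structures *)

Let lz : lin zeta := lin_zeta Finv hA.
Let zM := zetaM hB hF hA.

(** The cocycle identity of [Finv] shifts a coproduct from its first leg, where [j e1] multiplies
    [zeta], to its second, where it comes from the comultiplication; [sw_copV] exchanges Delta^F(h)
    for Delta(h). *)
Lemma comul_zeta a h :
  mul2 (Delta (zeta (a ♯ h))) G =
  \sw_(h1, h2 <- cop BF h) \sw_(e1, e2 <- Finv)
    ((j e1 *' zeta (a ♯ h1)) ⊗A (j e2 *' j h2)).
Proof.
rewrite (zetaE Finv hA) (sw_morph _ _ comul_G_D).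
transitivity (\sw_(h1, h2 <- cop BF h) \sw_(e1, e2 <- Finv) \sw_(d1, d2 <- cop B e1)
   \sw_(c1, c2 <- Finv) ((((d1 * c1) ▷ a) ♯ (d2 * c2 * h1)) ⊗A j (e2 * h2))); last first.
  apply: eq_sw => h1 h2; apply: eq_sw => e1 e2; rewrite jM (zetaE Finv hA) (smash_swr hA).
  rewrite (sw_morph _ _ (linSD (bl _))) sw_exch; apply: eq_sw => c1 c2.
  rewrite (smashE hB hA) (sw_morph _ _ (linSD (bl _))); apply: eq_sw => d1 d2.
  by rewrite (amul1l halg) (ma_actM hA) mulrA.
transitivity (\sw_(h1, h2 <- cop BF h) \sw_(e1, e2 <- Finv) \sw_(d1, d2 <- cop B e2)
   \sw_(c1, c2 <- Finv) (((e1 ▷ a) ♯ (d1 * c1 * h1)) ⊗A j (d2 * c2 * h2))); last first.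
  apply: eq_sw => h1 h2; symmetry; apply: (sw_cocycleV hB hF sD
   (f := fun x y z => ((x ▷ a) ♯ (y * h1)) ⊗A j (z * h2))); lin.
rewrite [RHS]sw_exch; apply: eq_sw => e1 e2; rewrite mul2_comul_cocycle.
rewrite (sw_copM hB (sc := sc2 (B := E))); last by lin.
rewrite [RHS]sw_exch; apply: eq_sw => d1 d2.
transitivity (\sw_(h1, h2 <- cop B h) \sw_(c1, c2 <- Finv)
   (((e1 ▷ a) ♯ (d1 * (h1 * c1))) ⊗A j (d2 * (h2 * c2)))).
  by do 2!apply: eq_sw => ? ?; rewrite !mulrA.
rewrite (sw_copV hF (sc := sc2 (B := E))
   (f := fun x y => ((e1 ▷ a) ♯ (d1 * x)) ⊗A j (d2 * y))); last by lin.
by rewrite sw_exch; do 2!apply: eq_sw => ? ?; rewrite !mulrA.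
Qed.

Lemma twist_inv_comul_zeta a h :
  twist_inv_mul Ginv (mul2 (Delta (zeta (a ♯ h))) G) =
  \sw_(h1, h2 <- cop BF h) (zeta (a ♯ h1) ⊗G j h2).
Proof.
rewrite comul_zeta (sw_morph _ _ twist_inv_mulD); apply: eq_sw => h1 h2.
move: (zeta (a ♯ h1)) (j h2) => u v; rewrite (sw_morph _ _ twist_inv_mulD).
transitivity (\sw_(f1, f2 <- F) \sw_(e1, e2 <- Finv)
  ((j (f1 * e1) *' u) ⊗G (j (f2 * e2) *' v))); last first.
  rewrite (sw_FV hF (sc := scG) (f := fun x y => (j x *' u) ⊗G (j y *' v))); last by lin.
  by rewrite !(amul1l hS).
rewrite sw_exch; apply: eq_sw => e1 e2; rewrite twist_inv_mul_tens.
by apply: eq_sw => f1 f2; rewrite !mA !jM.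
Qed.

Lemma zeta_src a : zeta (s a) = twist_src G a.
Proof. by rewrite twist_srcE (zeta_s Finv hA). Qed.

Lemma zeta_tgt a : zeta (coact XF a) = twist_tgt G a.
Proof. by rewrite twist_tgtE (zeta_t hB hF hX). Qed.

Lemma zeta_counit u : eps (zeta u) = counit EF u.
Proof.
have lcF : lin (counit EF) := lin_counit XF hBF.
move: u; apply: (lin_ext (f := fun u => eps (zeta u))); [by lin|exact: lcF|move=> a h].
rewrite (zetaE Finv hA) (lin_sw _ _ lc) [RHS](counitE XF hBF).
pose g x := cou B h *: (x ▷ a); have lg : lin g by rewrite /g; lin.
transitivity (g 1); last by rewrite /g (ma_act1 hA).
rewrite -(sw_V_cour hB hF lg); apply: eq_sw => e1 e2.
by rewrite [eps _](counitE X hB) (couM hB) /g scalerA.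
Qed.

Let hEF : is_left_bialgebroid EF := scalar_extensionP hBF hXF hbcF.

Let base_eq : base_alg EF = base_alg EG := esym twist_baseE.
Let zeta_one : zeta (aone (total_alg EF)) = aone (total_alg EG).
Proof. exact: zeta_j hB hF hA 1. Qed.

Lemma zeta_comul u : @tens2_map _ _ _ _ EF EG zeta (comul EF u) = comul EG (zeta u).
Proof.
have zD := tens2_mapD (B' := EG) hEF hS base_eq lz zM zeta_one zeta_src zeta_tgt.
have zE := tens2_mapE (B' := EG) hEF hS base_eq lz zM zeta_one zeta_src zeta_tgt.
move: u; apply: (tens_ext (f := fun u => @tens2_map _ _ _ _ EF EG zeta (comul EF u))
  (g := fun u => comul EG (zeta u))).
- by move=> u v; rewrite (comulD hEF) zD.
- move=> u v; rewrite (linSD lz).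
  exact: etrans (congr1 (twist_inv_mul Ginv) (comul_G_D _ _)) (twist_inv_mulD _ _).
move=> a h; rewrite (comulE hBF hXF) (sw_morph _ _ zD).
apply: etrans (esym (twist_inv_comul_zeta a h)).
by apply: eq_sw => h1 h2; rewrite zE (zeta_j hB hF hA).
Qed.

Lemma zeta_iso : left_bialgebroid_iso EF EG zeta.
Proof.
have bz := zeta_bij hF hA.
split.
- exact: hEF.
- exact: (transport_bialgebroid (B' := EG) hEF hS base_eq bz lz zM zeta_one zeta_src zeta_tgt
           zeta_comul zeta_counit).
- by move=> a b; rewrite base_eq.
- by [].
- exact: bz.
- exact/lin_linear.
- exact: zM.
- exact: zeta_one.
- exact: zeta_src.
- exact: zeta_tgt.
- exact: zeta_comul.
- exact: zeta_counit.
Qed.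

End TwistedExtension.

Theorem theorem3p1 (k : fieldType) (H : algType k) (B : coalgebra_on H)
  (F Finv : (H ⊗ H)%type) (A : lmodType k) (X : yd_data H A)
  (hB : is_bialgebra B)
  (hF : drinfeld_twist B F Finv)
  (hX : is_yd_module_algebra B X)
  (hbc : braided_commutative X) :
  drinfeld_xu_cocycle (ext_cocycle_inv B X F Finv) /\
  left_bialgebroid_iso
    (scalar_extension (twisted_bialgebra B F Finv) (twisted_yd X F Finv))
    (twist_bialgebroid (ext_cocycle_inv B X F Finv))
    (zeta X Finv).
Proof. by split; [apply: ext_cocycleP|apply: zeta_iso]. Qed.
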